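(* Consider the problem $\min_{x\in\mathcal X}F(x)$, $F(x)=\frac1n\sum_{i=1}^n f_i(g_i(x))+r(x)$, under the assumptions (A1)-(A4) listed in the context, with $\mu>0$, and suppose in addition that each outer function $f_i$ is $L_f$-smooth. Let $x_*$ be the unique minimizer of $F$ over $\mathcal X$. Run the algorithm ALEXR (described in the context) with outer batch size $S$, inner batch size $B$, and any strongly convex distance-generating functions $\psi_i$ (including $\psi_i=\frac12\|\cdot\|_2^2$ and $\psi_i=f_i^*$). (i) If $g_i$ is smooth, then ALEXR with $\eta=\frac{\mu\theta}{1-\theta}$, $\tau=\frac{S}{n(1-\theta)}$ and $\theta=1-O(\epsilon)$ makes $\frac{\mu}{2}\mathbb E\|x_T-x_*\|_2^2\le\epsilon$ in $$T=\tilde O\left(\max\left\{\frac1{\mu S},\frac1{\mu B},\frac{n}{BS}\right\}\epsilon^{-1}\right)$$ iterations. (ii) If $g_i$ is non-smooth, then ALEXR with the same setting of $\eta,\tau$ and $\theta=1-O(\epsilon)$ makes $\frac{\mu}{2}\mathbb E\|x_T-x_*\|_2^2\le\epsilon$ in $$T=\tilde O\left(\max\left\{\frac1{\mu},\frac{n}{BS}\right\}\epsilon^{-1}\right)$$ iterations.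
   Context: **Problem.** $\mathcal X\subseteq\mathbb R^d$, $g_i:\mathcal X\to\mathbb R^m$ with $g_i(x)=\mathbb E_{\zeta_i\sim\mathbb P_i}[g_i(x;\zeta_i)]$, $f_i:\mathbb R^m\to\mathbb R$ deterministic, $i\in[n]=\{1,\dots,n\}$. The norm on $\mathcal X$ is $\|\cdot\|_2$; the dual variables in $\mathbb R^m$ are measured in a norm $\|\cdot\|$, and values of $g_i$ in its dual norm $\|\cdot\|_*$. $f_i^*$ is the convex conjugate of $f_i$, and $\mathcal Y_i\subset\mathbb R^m$ is the (convex, compact) domain of the $i$-th dual variable, so that $f_i(u)=\max_{v\in\mathcal Y_i}\{v^\top u-f_i^*(v)\}$; $\mathcal Y=\mathcal Y_1\times\dots\times\mathcal Y_n\subset\mathbb R^{nm}$, and $y^{(i)}\in\mathbb R^m$ is the $i$-th block of $y\in\mathbb R^{nm}$. **Assumptions.** (A1) $\mathcal X$ is closed and convex; $r$ is proper, lower semicontinuous and $\mu$-convex on $\mathcal X$, i.e. $r-\frac\mu2\|\cdot\|_2^2$ is convex. (A2) Each $g_i$ is convex (coordinatewise) and there is $C_g>0$ with $\|g_i(x)-g_i(x')\|_*\le C_g\|x-x'\|_2$ for all $x,x'\in\mathcal X$. (A3) Each $f_i$ is convex and there is $C_f>0$ with $|f_i(u)-f_i(u')|\le C_f\|u-u'\|_*$ for all $u,u'$. If $g_i$ is nonlinear, $f_i$ is monotonically non-decreasing with respect to each coordinate of its input. (A4) There are finite $\sigma_0^2,\sigma_1^2,\delta^2$ such that for all $x\in\mathcal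 X$, $g_i'(x)\in\partial g_i(x)$, $y\in\mathcal Y$: $\mathbb E_{\zeta_i}\|g_i(x)-g_i(x;\zeta_i)\|_*^2\le\sigma_0^2$; $\mathbb E_{\zeta_i}\|[g_i'(x)]^\top-[g_i'(x;\zeta_i)]^\top\|_{\rm op}^2\le\sigma_1^2$; $\frac1n\sum_{j=1}^n\|[g_j'(x)]^\top y^{(j)}-\frac1n\sum_{i=1}^n[g_i'(x)]^\top y^{(i)}\|_2^2\le\delta^2$. The stochastic (sub)gradients $g_i'(x;\zeta_i)$ are unbiased. **Smoothness.** $g_i$ is smooth (with constant $L_g>0$) if it is differentiable and $\|g_i(x_1)-g_i(x_2)-\nabla g_i(x_2)(x_1-x_2)\|_*\le\frac{L_g}2\|x_1-x_2\|_2^2$ for all $x_1,x_2\in\mathcal X$. $f_i$ is $L_f$-smooth if it is differentiable and $|f_i(u_1)-f_i(u_2)-\langle\nabla f_i(u_2),u_1-u_2\rangle|\le\frac{L_f}2\|u_1-u_2\|_*^2$ for all $u_1,u_2$. **Bregman divergences.** $U_{\psi_i}(u,v)=\psi_i(u)-\psi_i(v)-\langle\psi_i'(v),u-v\rangle$ with $\psi_i'(v)\in\partial\psi_i(v)$; strong convexity of $\psi_i$ is with respect to $\|\cdot\|$. **Algorithm ALEXR.** Parameters $\eta,\tau>0$, $\theta\in[0,1]$, batch sizes $S,B$. Start from $x_{-1}=x_0\in\mathcal X$, $y_0\in\mathcal Y$. For $t=0,1,\dots,T-1$: sample (uniformly) a batch $\mathcal S_t\subset[n]$ with $|\mathcal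 S_t|=S$; for each $i\in\mathcal S_t$ draw two independent mini-batches $\mathcal B_t^{(i)},\tilde{\mathcal B}_t^{(i)}$ of size $B$ from $\mathbb P_i$ (mini-batch estimators are averages over the batch), set $\tilde g_t^{(i)}=g_i(x_t;\mathcal B_t^{(i)})+\theta\,(g_i(x_t;\mathcal B_t^{(i)})-g_i(x_{t-1};\mathcal B_t^{(i)}))$, $y_{t+1}^{(i)}=\arg\max_{v\in\mathcal Y_i}\{v^\top\tilde g_t^{(i)}-f_i^*(v)-\tau U_{\psi_i}(v,y_t^{(i)})\}$; for $i\notin\mathcal S_t$ set $y_{t+1}^{(i)}=y_t^{(i)}$. Then set $G_t=\frac1S\sum_{i\in\mathcal S_t}[g_i'(x_t;\tilde{\mathcal B}_t^{(i)})]^\top y_{t+1}^{(i)}$ with $g_i'(x_t;\tilde{\mathcal B}_t^{(i)})\in\partial g_i(x_t;\tilde{\mathcal B}_t^{(i)})$, and $x_{t+1}=\arg\min_{x\in\mathcal X}\{\langle G_t,x\rangle+r(x)+\frac\eta2\|x-x_t\|_2^2\}$. **Asymptotic convention.** The iteration bounds show the dominant dependence on $n,S,B,\mu,\epsilon$ as $\epsilon\to0$; other problem constants (including those associated with the $\psi_i$) and lower-order terms in $1/\epsilon$ are suppressed. In ''$\theta=1-O(\epsilon)$'' the hidden constant may depend on all problem parameters. $\tilde O$ additionally hides factors polylogarithmic in $1/\epsilon$.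
   Formalization: Besides strong convexity, ψ_i is closed and f_i^*−ρψ_i is convex on Y_i for some ρ>0 (suppressed constants depend on ρ); the subgradient ψ_i'(y_{t+1}) is the one in the optimality condition of the dual step; chosen subgradients g_i' obey the Lipschitz bound along X. *)

(* Defs.v *)
(* Library: MathComp + MathComp-Analysis. *)
From HB Require Import structures.
From mathcomp Require Import all_boot all_order all_algebra.
From mathcomp Require Import all_classical all_reals all_analysis.

Set Implicit Arguments.
Unset Strict Implicit.
Unset Printing Implicit Defensive.

Import Order.TTheory GRing.Theory Num.Theory.
Import numFieldNormedType.Exports.

Local Open Scope classical_set_scope.
Local Open Scope ring_scope.

Section vectors.
Context {R : realType}.

Definition dot p (u v : 'cV[R]_p) : R := \sum_k u k 0 * v k 0.

(* The norm that MathComp-Analysis puts on ['cV[R]_p] is the sup norm; it is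
   used here only for its topology. *)
Definition l2norm p (u : 'cV[R]_p) : R := Num.sqrt (dot u u).

Definition is_norm p (N : 'cV[R]_p -> R) : Prop :=
  [/\ forall u, N u = 0 -> u = 0,
      forall a u, N (a *: u) = `|a| * N u &
      forall u v, N (u + v) <= N u + N v].

Definition dual_norm p (N : 'cV[R]_p -> R) (u : 'cV[R]_p) : R :=
  sup [set dot v u | v in [set v | N v <= 1]].

(* Norm of [M] as an operator from [(R^p, N)] to [(R^q, l2norm)]. *)
Definition op_norm p q (N : 'cV[R]_p -> R) (M : 'M[R]_(q, p)) : R :=
  sup [set l2norm (M *m v) | v in [set v | N v <= 1]].

End vectors.

Section extended_real_convexity.
Context {R : realType} {p : nat}.
Implicit Types (D : set 'cV[R]_p) (h : 'cV[R]_p -> \bar R) (u v : 'cV[R]_p).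
Local Open Scope ereal_scope.

(* For functions that do not take the value -oo. *)
Definition econvex D h : Prop := forall u v (t : R),
  D u -> D v -> (0 < t < 1)%R ->
  h (t *: u + (1 - t) *: v)%R <= t%:E * h u + (1 - t)%:E * h v.

Definition estrongly_convex D (N : 'cV[R]_p -> R) (c : R) h : Prop :=
  forall u v (t : R), D u -> D v -> (0 < t < 1)%R ->
  h (t *: u + (1 - t) *: v)%R + (c / 2 * (t * (1 - t)) * N (u - v) ^+ 2)%:E
    <= t%:E * h u + (1 - t)%:E * h v.

Definition esubgradient h v : set 'cV[R]_p :=
  [set s | h v \is a fin_num /\ forall u, h v + (dot s (u - v)%R)%:E <= h u].

Definition conjugate (f : 'cV[R]_p -> R) v : \bar R :=
  ereal_sup (range (fun u => (dot v u - f u)%:E)).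

(* [U_psi(u, v)], where [s] is the chosen subgradient [psi'(v)]. *)
Definition bregman (psi : 'cV[R]_p -> \bar R) u v (s : 'cV[R]_p) : \bar R :=
  psi u - psi v - (dot s (u - v)%R)%:E.

(* [h - rho * psi] is convex on [D] and [dom h] is included in [dom psi].  The
   convexity inequality is written without differences, so that it stays
   meaningful where both functions are +oo. *)
Definition relatively_strongly_convex D (psi : 'cV[R]_p -> \bar R) (rho : R) h
    : Prop :=
  (forall v, D v -> h v < +oo -> psi v < +oo) /\
  forall u v (t : R), D u -> D v -> (0 < t < 1)%R ->
    h (t *: u + (1 - t) *: v)%R + rho%:E * (t%:E * psi u + (1 - t)%:E * psi v)
      <= t%:E * h u + (1 - t)%:E * h v
         + rho%:E * psi (t *: u + (1 - t) *: v)%R.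

(* [w] is a subgradient at [v] of [h - rho * psi] restricted to [D], again
   written without differences. *)
Definition relative_subgradient D (psi : 'cV[R]_p -> \bar R) (rho : R) h v
    : set 'cV[R]_p :=
  [set w | forall u, D u ->
     h v + rho%:E * psi u + (dot w (u - v)%R)%:E <= h u + rho%:E * psi v].

End extended_real_convexity.

(* Vector-valued maps that are only meaningful on [X]; a matrix plays the role
   of the (sub)Jacobian, row by row. *)
Section vector_maps.
Context {R : realType} {d m : nat}.
Implicit Types (X : set 'cV[R]_d) (g : 'cV[R]_d -> 'cV[R]_m)
  (J : 'cV[R]_d -> 'M[R]_(m, d)).

Definition subjacobian X g (x : 'cV[R]_d) : set 'M[R]_(m, d) :=
  [set J | forall x', X x' ->
     forall k, g x k 0 + (J *m (x' - x)) k 0 <= g x' k 0].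

Definition linear_on X g J : Prop :=
  forall x x', X x -> X x' -> g x' = g x + J x *m (x' - x).

(* The inequality also says that [J x] is the derivative of [g] at [x] relative
   to [X], and hence the Frechet derivative at interior points. *)
Definition smooth_on X (Ns : 'cV[R]_m -> R) (L : R) g J : Prop :=
  forall x1 x2, X x1 -> X x2 ->
  Ns (g x1 - g x2 - J x2 *m (x1 - x2)) <= L / 2 * l2norm (x1 - x2) ^+ 2.

Definition smooth_outer (Ns : 'cV[R]_m -> R) (L : R) (f : 'cV[R]_m -> R)
    : Prop :=
  (forall u, differentiable f u) /\
  forall u1 u2,
    `|f u1 - f u2 - 'd f u2 (u1 - u2)| <= L / 2 * Ns (u1 - u2) ^+ 2.

End vector_maps.

Record fcco (R : realType) (d m n : nat) := Fcco {
  xdom : set 'cV[R]_d;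
  reg : 'cV[R]_d -> \bar R;
  outer : 'I_n -> 'cV[R]_m -> R;
  ydom : 'I_n -> set 'cV[R]_m;
  sample_disp : 'I_n -> measure_display;
  sample : forall i : 'I_n, measurableType (sample_disp i);
  law : forall i : 'I_n, probability (sample i) R;
  sinner : forall i : 'I_n, 'cV[R]_d -> sample i -> 'cV[R]_m;
  sjac : forall i : 'I_n, 'cV[R]_d -> sample i -> 'M[R]_(m, d)
}.
Arguments sinner {R d m n} _ i x z : rename.
Arguments sjac {R d m n} _ i x z : rename.

Section problem.
Context {R : realType} {d m n : nat}.
Variable pb : fcco R d m n.
Let X := xdom pb.

Definition inner (i : 'I_n) (x : 'cV[R]_d) : 'cV[R]_m :=
  \col_k \int[law pb i]_z (sinner pb i x z k 0).

Definition jac (i : 'I_n) (x : 'cV[R]_d) : 'M[R]_(m, d) :=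
  \matrix_(k, j) \int[law pb i]_z (sjac pb i x z k j).

Definition objective (x : 'cV[R]_d) : \bar R :=
  ((n%:R^-1 * \sum_i outer pb i (inner i x))%:E + reg pb x)%E.

Definition minimizer (x : 'cV[R]_d) : Prop :=
  X x /\ forall x', X x' -> (objective x <= objective x')%E.

Let borel := g_sigma_algebraType (@open 'cV[R]_d).

(* The oracles are jointly measurable in the point and the sample. *)
Definition well_posed_oracle : Prop := forall i : 'I_n,
  [/\ forall k : 'I_m, measurable_fun ((X : set borel) `*` [set: sample pb i])
        (fun p : borel * sample pb i => sinner pb i p.1 p.2 k 0),
      forall (k : 'I_m) (j : 'I_d),
        measurable_fun ((X : set borel) `*` [set: sample pb i])
          (fun p : borel * sample pb i => sjac pb i p.1 p.2 k j),
      forall x, X x -> forall k,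
        (law pb i).-integrable setT (fun z => (sinner pb i x z k 0)%:E) &
      forall x, X x -> forall k j,
        (law pb i).-integrable setT (fun z => (sjac pb i x z k j)%:E)].

Definition assumption_reg (mu : R) : Prop :=
  [/\ closed X,
      convex_set (X : set (convex_lmodType 'cV[R]_d)),
      (forall x, X x -> (-oo < reg pb x)%E) /\
        (exists2 x, X x & (reg pb x < +oo)%E),
      lower_semicontinuous (patch (cst +oo%E) X (reg pb)) &
      econvex X (fun x => (reg pb x - (mu / 2 * l2norm x ^+ 2)%:E)%E)].

(* The last clause bounds the chosen subgradients by the Lipschitz constant of
   [inner i] along [X]: at boundary points of [X], subgradients relative to [X]
   may contain arbitrarily large normal components, on which the Lipschitz
   bound has no grip.  It follows from the Lipschitz bound when [inner i] is
   smooth. *)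
Definition assumption_inner (N : 'cV[R]_m -> R) (Cg : R) : Prop :=
  [/\ forall i k, convex_function (X : set (convex_lmodType 'cV[R]_d))
        (fun x => inner i x k 0),
      forall i x x', X x -> X x' ->
        dual_norm N (inner i x - inner i x') <= Cg * l2norm (x - x'),
      forall i x, X x -> forall z,
        subjacobian X (fun x' => sinner pb i x' z) x (sjac pb i x z),
      forall i x, X x -> subjacobian X (inner i) x (jac i x) &
      forall i x x', X x -> X x' ->
        dual_norm N (jac i x *m (x' - x)) <= Cg * l2norm (x' - x)].

Definition assumption_outer (N : 'cV[R]_m -> R) (Cf : R) : Prop :=
  [/\ forall i, convex_function
        (setT : set (convex_lmodType 'cV[R]_m)) (outer pb i),
      forall i u u',
        `|outer pb i u - outer pb i u'| <= Cf * dual_norm N (u - u') &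
      forall i, ~ linear_on X (inner i) (jac i) ->
        forall u u' : 'cV[R]_m, (forall k, u k 0 <= u' k 0) ->
          outer pb i u <= outer pb i u'].

Definition dual_domains : Prop := forall i,
  [/\ compact (ydom pb i),
      convex_set (ydom pb i : set (convex_lmodType 'cV[R]_m)) &
      forall u,
        (exists2 v, ydom pb i v &
           (outer pb i u)%:E = ((dot v u)%:E - conjugate (outer pb i) v)%E) /\
        (forall v, ydom pb i v ->
           ((dot v u)%:E - conjugate (outer pb i) v <= (outer pb i u)%:E)%E)].

Definition assumption_noise (N : 'cV[R]_m -> R) (sigma0 sigma1 delta : R)
    : Prop :=
  [/\ forall i x, X x ->
        (\int[law pb i]_z ((dual_norm N (inner i x - sinner pb i x z)) ^+ 2)%:E
           <= (sigma0 ^+ 2)%:E)%E,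
      forall i x, X x ->
        (\int[law pb i]_z ((op_norm N ((jac i x)^T - (sjac pb i x z)^T)) ^+ 2)%:E
           <= (sigma1 ^+ 2)%:E)%E &
      forall x (y : 'I_n -> 'cV[R]_m), X x -> (forall i, ydom pb i (y i)) ->
        n%:R^-1 * \sum_j l2norm ((jac j x)^T *m y j
                     - n%:R^-1 *: \sum_i (jac i x)^T *m y i) ^+ 2
          <= delta ^+ 2].

(* [psi_i = f_i^*] may take the value +oo, hence the codomain.  The last clause
   relates the strong convexity of [f_i^*] (dual to the smoothness of [f_i]) to
   [psi_i]: [rho] is the modulus of f_i^* relative to psi_i.  It is 1 for
   [psi_i = f_i^*], and a positive one exists for every [psi_i] with Lipschitz
   gradient, in particular half the squared l2 norm.  Strong convexity of
   [psi_i] alone is not enough for the rate: with m = n = 1, f the Huber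
   function and psi v = v^2/2 + |v|^(3/2), the dual iterate approaches 0 only
   at a polynomial speed in t/tau. *)
Definition distance_generating (N : 'cV[R]_m -> R) (mupsi rho : R)
    (psi : 'I_n -> 'cV[R]_m -> \bar R) : Prop := forall i,
  [/\ forall v, (-oo < psi i v)%E,
      lower_semicontinuous (psi i),
      estrongly_convex (ydom pb i) N mupsi (psi i) &
      relatively_strongly_convex (ydom pb i) (psi i) rho
        (conjugate (outer pb i))].

End problem.

Section algorithm.
Context {R : realType} {d m n : nat}.
Variables (pb : fcco R d m n) (psi : 'I_n -> 'cV[R]_m -> \bar R).
Variables (x0 : 'cV[R]_d) (y0 s0 : 'I_n -> 'cV[R]_m).
Variables (S B T : nat) (eta tau theta rho : R).
Context {dO : measure_display} {Omega : measurableType dO}.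
Variable Pr : probability Omega R.

(* The random draws: the outer batches, and the two families of inner
   mini-batches.  Inner mini-batches are drawn for every block, but the
   algorithm reads only those of the blocks in the current outer batch. *)
Record draws := Draws {
  outer_batch : 'I_T -> Omega -> {set 'I_n};
  batch : 'I_T -> forall i : 'I_n, 'I_B -> Omega -> sample pb i;
  batch' : 'I_T -> forall i : 'I_n, 'I_B -> Omega -> sample pb i
}.
Arguments batch : clear implicits.
Arguments batch' : clear implicits.
Variable D : draws.

(* [inl t] is the outer batch of step [t]; [inr (t, i, c, b)] is the [b]-th
   draw of step [t] for block [i], in the second mini-batch when [c] holds. *)
Definition draw_index : finType := ('I_T + 'I_T * 'I_n * bool * 'I_B)%type.

Definition draw_time (k : draw_index) : 'I_T :=
  match k with inl t => t | inr (t, _, _, _) => t end.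

Definition draw_events (k : draw_index) : set (set Omega) :=
  match k with
  | inl t => [set outer_batch D t @^-1` A | A in setT]
  | inr (t, i, c, b) =>
      preimage_set_system setT (if c then batch' D t i b else batch D t i b)
        (measurable : set (set (sample pb i)))
  end.

Definition independent_draws : Prop := forall A : draw_index -> set Omega,
  (forall k, draw_events k (A k)) ->
  Pr (\bigcap_k A k) = (\prod_k fine (Pr (A k)))%:E.

Definition proper_draws : Prop :=
  [/\ forall k A, draw_events k A -> measurable A,
      forall t (A : {set 'I_n}), Pr (outer_batch D t @^-1` [set A]) =
        (if #|A| == S then ('C(n, S)%:R)^-1 else 0)%:E,
      forall t i b (A : set (sample pb i)), measurable A ->
        Pr (batch D t i b @^-1` A) = law pb i A,
      forall t i b (A : set (sample pb i)), measurable A ->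
        Pr (batch' D t i b @^-1` A) = law pb i A &
      independent_draws].

Definition history (t : nat) : set (set Omega) :=
  <<s \bigcup_(k in [set k | (draw_time k < t)%N]) draw_events k >>.

Definition adapted (h : nat -> Omega -> R) : Prop :=
  forall t, (t <= T)%N -> forall A : set R, measurable A ->
    history t (h t @^-1` A).

(* [s t i] is the subgradient of [psi i] at [y t i] that defines the Bregman
   divergence of step [t]. *)
Record trajectory := Trajectory {
  primal : nat -> Omega -> 'cV[R]_d;
  dual : nat -> 'I_n -> Omega -> 'cV[R]_m;
  dual_subgrad : nat -> 'I_n -> Omega -> 'cV[R]_m
}.
Variable tr : trajectory.
Let x := primal tr.
Let y := dual tr.
Let s := dual_subgrad tr.

Definition batch_inner (t : 'I_T) (i : 'I_n) (w : Omega) (u : 'cV[R]_d)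
    : 'cV[R]_m := B%:R^-1 *: \sum_b sinner pb i u (batch D t i b w).

(* At [t = 0] the predecessor [t.-1] is [0], which encodes x_{-1} = x_0. *)
Definition gtilde (t : 'I_T) (i : 'I_n) (w : Omega) : 'cV[R]_m :=
  batch_inner t i w (x t w)
  + theta *: (batch_inner t i w (x t w) - batch_inner t i w (x t.-1 w)).

Definition dual_value (t : 'I_T) (i : 'I_n) (w : Omega) (v : 'cV[R]_m)
    : \bar R :=
  ((dot v (gtilde t i w))%:E - conjugate (outer pb i) v
   - tau%:E * bregman (psi i) v (y t i w) (s t i w))%E.

Definition gradient_estimate (t : 'I_T) (w : Omega) : 'cV[R]_d :=
  S%:R^-1 *: \sum_(i in outer_batch D t w)
    (B%:R^-1 *: \sum_b sjac pb i (x t w) (batch' D t i b w))^T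
      *m y t.+1 i w.

Definition primal_value (t : 'I_T) (w : Omega) (u : 'cV[R]_d) : \bar R :=
  ((dot (gradient_estimate t w) u)%:E + reg pb u
   + (eta / 2 * l2norm (u - x t w) ^+ 2)%:E)%E.

Record alexr_run : Prop := AlexrRun {
  run_draws : proper_draws;
  run_x0 : forall w, x 0 w = x0;
  run_y0 : forall i w, y 0 i w = y0 i;
  run_s0 : forall i w, s 0 i w = s0 i;
  run_x_adapted : forall k, adapted (fun t w => x t w k 0);
  run_y_adapted : forall i k, adapted (fun t w => y t i w k 0);
  run_s_adapted : forall i k, adapted (fun t w => s t i w k 0);
  run_subgrad : forall (t : 'I_T) i w, i \in outer_batch D t w ->
    esubgradient (psi i) (y t.+1 i w) (s t.+1 i w);
  run_dual : forall (t : 'I_T) i w, i \in outer_batch D t w ->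
    ydom pb i (y t.+1 i w) /\
    forall v, ydom pb i v ->
      (dual_value t i w v <= dual_value t i w (y t.+1 i w))%E;
  run_dual_idle : forall (t : 'I_T) i w, i \notin outer_batch D t w ->
    y t.+1 i w = y t i w /\ s t.+1 i w = s t i w;
  run_primal : forall (t : 'I_T) w,
    xdom pb (x t.+1 w) /\
    forall u, xdom pb u ->
      (primal_value t w (x t.+1 w) <= primal_value t w u)%E
}.

(* Among the subgradients of [psi i] at the new dual iterate, the selected one
   is the multiplier in the first-order optimality condition of the dual step,
   0 \in d(f_i^* - rho psi_i)(y_{t+1}) + (tau + rho) s_{t+1} - gtilde - tau s_t,
   with normal vectors of the dual domain absorbed in the first summand.  This
   holds automatically when [psi i] is differentiable.  For [psi_i = f_i^*]
   (and [rho = 1]) it holds for the moving average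
   s_{t+1} = (tau s_t + gtilde) / (1 + tau). *)
Definition optimal_subgradients : Prop :=
  forall (t : 'I_T) i w, i \in outer_batch D t w ->
  relative_subgradient (ydom pb i) (psi i) rho (conjugate (outer pb i))
    (y t.+1 i w)
    (gtilde t i w + tau *: s t i w - (tau + rho) *: s t.+1 i w).

End algorithm.
Arguments draws {R d m n} pb B T {dO} Omega.
Arguments trajectory R d m n {dO} Omega.

Section complexity.
Context {R : realType} {d m : nat}.

(* Everything that is fixed before the target accuracy is. *)
Record alexr_setting (N : 'cV[R]_m -> R)
    (Cg Cf sigma0 sigma1 delta Lf mupsi rho : R)
    (n S B : nat) (mu : R) (pb : fcco R d m n)
    (psi : 'I_n -> 'cV[R]_m -> \bar R)
    (x0 : 'cV[R]_d) (y0 s0 : 'I_n -> 'cV[R]_m) (xs : 'cV[R]_d) : Prop :=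
  AlexrSetting {
    set_outer_size : (0 < S <= n)%N;
    set_inner_size : (0 < B)%N;
    set_mu : 0 < mu;
    set_oracle : well_posed_oracle pb;
    set_reg : assumption_reg pb mu;
    set_inner : assumption_inner pb N Cg;
    set_outer : assumption_outer pb N Cf;
    set_dual : dual_domains pb;
    set_noise : assumption_noise pb N sigma0 sigma1 delta;
    set_smooth : forall i, smooth_outer (dual_norm N) Lf (outer pb i);
    set_dgf : distance_generating pb N mupsi rho psi;
    set_x0 : xdom pb x0;
    set_y0 : forall i, ydom pb i (y0 i);
    set_s0 : forall i, esubgradient (psi i) (y0 i) (s0 i);
    set_min : minimizer pb xs
  }.

(* For [theta = 1 - O(eps)] and all small [eps], ALEXR reaches accuracy [eps]
   after at most [K * rate * eps^-1 * ln(eps^-1)^k] iterations.  Here [c] and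
   [eps0] may depend on the whole problem. *)
Definition alexr_reaches (K : R) (k : nat) (rate : R) (rho : R)
    (n S B : nat) (mu : R) (pb : fcco R d m n)
    (psi : 'I_n -> 'cV[R]_m -> \bar R)
    (x0 : 'cV[R]_d) (y0 s0 : 'I_n -> 'cV[R]_m) (xs : 'cV[R]_d) : Prop :=
  exists c eps0 : R, 0 < eps0 /\
  forall eps : R, 0 < eps < eps0 ->
  exists (theta : R) (T : nat),
    [/\ 0 < theta < 1, 1 - theta <= c * eps,
        T%:R <= K * rate * eps^-1 * ln eps^-1 ^+ k &
        forall (dO : measure_display) (Omega : measurableType dO)
          (Pr : probability Omega R) (D : draws pb B T Omega)
          (tr : trajectory R d m n Omega),
          let eta := mu * theta / (1 - theta) in
          let tau := S%:R / (n%:R * (1 - theta)) in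
          alexr_run psi x0 y0 s0 S eta tau theta Pr D tr ->
          optimal_subgradients psi tau theta rho D tr ->
          ((mu / 2)%:E * 'E_Pr[(fun w => l2norm (primal tr T w - xs) ^+ 2)%R]
             <= eps%:E)%E].

End complexity.

(* Main.v *)
(* All norms are compared with the Euclidean one, at the price of a constant A
   that depends only on the norm.  Let ys be dual optima at xs.  The optimality of
   the primal step, the saddle-point inequality
     r(x_+) - r(xs) >= - (1/n) sum_i ys_i . (g_i(x_+) - g_i(xs)),
   and the three-point inequality of the dual step, averaged over the outer
   batch, add up to a descent inequality along each path for
     (eta + mu)/2 |x - xs|^2 + (tau + rho/2)/S sum_i U(ys_i, y_i) + c1 |x - x_-|^2.
   The noise terms paired with the old dual iterates have mean zero, and the
   remaining ones are absorbed, by Young's inequality, by the proximal terms; the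
   extrapolation only costs a multiple of |x - x_-|^2, because 1/eta is small.
   What is left is the drift of sum_i y_i . J_i (x_+ - x) over the batch against
   its mean over all blocks.  For smooth g it is an average over a uniform batch
   of vectors of total variance delta^2, whence delta^2/(S eta); without
   smoothness it is at most a constant times |x_+ - x|, whence a constant over
   eta.  In expectation the potential contracts by 1 - kap (1 - theta), with
   kap = min(1/2, rho/4), and 1 - theta is taken proportional to eps/rate. *)
From HB Require Import structures.
From mathcomp Require Import all_boot all_order all_algebra fingroup perm.
From mathcomp Require Import all_classical all_reals all_analysis.
From mathcomp Require Import measurable_realfun ring lra.
Require Import Defs.

Set Implicit Arguments.
Unset Strict Implicit.
Unset Printing Implicit Defensive.

Import Order.TTheory GRing.Theory Num.Theory.
Import numFieldNormedType.Exports.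

Local Open Scope classical_set_scope.
Local Open Scope ring_scope.

(** The obstacle is that the new dual iterates depend on the outer batch and on the fresh
    mini-batches at once. The descent inequality is therefore pathwise, and expectations are taken
    only of quantities that do not depend on the current outer batch: mini-batches are drawn for
    every block, so noise terms exist for sampled and idle blocks alike, and the batch enters as a
    finite average over its values. Conditional expectations are replaced by integrating one draw
    against a product measure, all other draws being frozen.

    The rate comes from [1 / tau = n (1 - theta) / S] and [1 / eta <= 2 (1 - theta) / mu]: the value
    noise, of size [1 / B], is weighted by the former, the Jacobian noise, of size [1 / B], and the
    drift by the latter. Jacobian noise also multiplies [|x - xs|^2]; strong convexity absorbs this
    once [1 - theta] is small against [mu / n], one of the reasons why the threshold on [eps]
    depends on the whole problem. *)

Lemma ler_sqrW {R : realDomainType} (a b : R) : 0 <= a -> a <= b -> a ^+ 2 <= b ^+ 2.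
Proof. by move=> a0 ab; rewrite ler_sqr ?nnegrE// (le_trans a0). Qed.

(** * Euclidean norm *)

Section euclidean.
Context {R : realType}.

Lemma dotC p (u v : 'cV[R]_p) : dot u v = dot v u.
Proof. by apply: eq_bigr => k _; rewrite mulrC. Qed.

Lemma dotDl p (u v w : 'cV[R]_p) : dot (u + v) w = dot u w + dot v w.
Proof. by rewrite -big_split; apply: eq_bigr => k _; rewrite mxE mulrDl. Qed.

Lemma dotZl p a (u v : 'cV[R]_p) : dot (a *: u) v = a * dot u v.
Proof. by rewrite mulr_sumr; apply: eq_bigr => k _; rewrite mxE mulrA. Qed.

Lemma dotDr p (u v w : 'cV[R]_p) : dot w (u + v) = dot w u + dot w v.
Proof. by rewrite dotC dotDl !(dotC w). Qed.

Lemma dotZr p a (u v : 'cV[R]_p) : dot v (a *: u) = a * dot v u.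
Proof. by rewrite dotC dotZl dotC. Qed.

Lemma dotNl p (u v : 'cV[R]_p) : dot (- u) v = - dot u v.
Proof. by rewrite -scaleN1r dotZl mulN1r. Qed.

Lemma dotNr p (u v : 'cV[R]_p) : dot u (- v) = - dot u v.
Proof. by rewrite dotC dotNl dotC. Qed.

Lemma dotBl p (u v w : 'cV[R]_p) : dot (u - v) w = dot u w - dot v w.
Proof. by rewrite dotDl dotNl. Qed.

Lemma dotBr p (u v w : 'cV[R]_p) : dot w (u - v) = dot w u - dot w v.
Proof. by rewrite dotDr dotNr. Qed.

Lemma dot0l p (u : 'cV[R]_p) : dot 0 u = 0.
Proof. by rewrite -(scale0r 0) dotZl mul0r. Qed.

Lemma dot0r p (u : 'cV[R]_p) : dot u 0 = 0.
Proof. by rewrite dotC dot0l. Qed.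

Lemma dot_suml p I (r : seq I) (P : pred I) (F : I -> 'cV[R]_p) v :
  dot (\sum_(i <- r | P i) F i) v = \sum_(i <- r | P i) dot (F i) v.
Proof.
by elim/big_rec2: _ => [|i a b _ <-]; [exact: dot0l|rewrite dotDl].
Qed.

Lemma dot_sumr p I (r : seq I) (P : pred I) (F : I -> 'cV[R]_p) v :
  dot v (\sum_(i <- r | P i) F i) = \sum_(i <- r | P i) dot v (F i).
Proof. by rewrite dotC dot_suml; apply: eq_bigr => i _; rewrite dotC. Qed.

Lemma dot_mulmx p q (M : 'M[R]_(p, q)) u v : dot u (M *m v) = dot (M^T *m u) v.
Proof.
rewrite /dot; under eq_bigr do rewrite mxE mulr_sumr.
rewrite exchange_big; apply: eq_bigr => j _ /=; rewrite mxE mulr_suml.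
by apply: eq_bigr => i _; rewrite mxE; ring.
Qed.

Lemma dot_ge0 p (u : 'cV[R]_p) : 0 <= dot u u.
Proof. by apply: sumr_ge0 => k _; rewrite -expr2 sqr_ge0. Qed.

Lemma dot_eq0 p (u : 'cV[R]_p) : dot u u = 0 -> u = 0.
Proof.
move/eqP; rewrite psumr_eq0 => [/allP u0|k _]; last by rewrite -expr2 sqr_ge0.
apply/colP => k; rewrite mxE; apply/eqP.
by rewrite -sqrf_eq0 expr2; apply: u0; rewrite mem_index_enum.
Qed.

Lemma l2norm_sqr p (u : 'cV[R]_p) : l2norm u ^+ 2 = dot u u.
Proof. by rewrite sqr_sqrtr// dot_ge0. Qed.

Lemma l2norm_ge0 p (u : 'cV[R]_p) : 0 <= l2norm u.
Proof. exact: sqrtr_ge0. Qed.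

Lemma l2norm0 p : l2norm (0 : 'cV[R]_p) = 0.
Proof. by rewrite /l2norm dot0l sqrtr0. Qed.

Lemma l2norm_eq0 p (u : 'cV[R]_p) : l2norm u = 0 -> u = 0.
Proof. by move=> u0; apply: dot_eq0; rewrite -l2norm_sqr u0 expr0n. Qed.

Lemma l2normZ p a (u : 'cV[R]_p) : l2norm (a *: u) = `|a| * l2norm u.
Proof.
by rewrite /l2norm dotZl dotZr mulrA -expr2 sqrtrM ?sqr_ge0// sqrtr_sqr.
Qed.

Lemma l2normN p (u : 'cV[R]_p) : l2norm (- u) = l2norm u.
Proof. by rewrite -scaleN1r l2normZ normrN1 mul1r. Qed.

Lemma dot_young p (c : R) (u v : 'cV[R]_p) : 0 < c ->
  dot u v <= c / 2 * dot u u + (2 * c)^-1 * dot v v.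
Proof.
move=> c0; have := dot_ge0 (c *: u - v).
rewrite dotBl !dotBr !dotZl !dotZr (dotC v u) => h.
rewrite -(ler_pM2l (mulr_gt0 (ltr0n _ 2) c0)) mulrDr.
rewrite (mulrA _ (_^-1)) mulfV ?mul1r; first by lra.
by rewrite gt_eqF// mulr_gt0.
Qed.

Lemma dot_l2norm p (u v : 'cV[R]_p) : dot u v <= l2norm u * l2norm v.
Proof.
have [/l2norm_eq0->|u0] := eqVneq (l2norm u) 0; first by rewrite dot0l l2norm0 mul0r.
have [/l2norm_eq0->|v0] := eqVneq (l2norm v) 0; first by rewrite dot0r l2norm0 mulr0.
have up : 0 < l2norm u by rewrite lt_neqAle eq_sym u0 l2norm_ge0.
have vp : 0 < l2norm v by rewrite lt_neqAle eq_sym v0 l2norm_ge0.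
apply: le_trans (dot_young u v (divr_gt0 vp up)) _.
rewrite -!l2norm_sqr le_eqVlt; apply/orP; left; apply/eqP; field.
by rewrite u0 v0.
Qed.

Lemma normr_dot p (u v : 'cV[R]_p) : `|dot u v| <= l2norm u * l2norm v.
Proof. by rewrite ler_norml dot_l2norm lerNl -dotNl -(l2normN u) dot_l2norm. Qed.

Lemma l2normD p (u v : 'cV[R]_p) : l2norm (u + v) <= l2norm u + l2norm v.
Proof.
rewrite -ler_sqr ?nnegrE ?addr_ge0 ?l2norm_ge0//.
rewrite sqrrD !l2norm_sqr dotDl !dotDr (dotC v u).
by have := dot_l2norm u v; lra.
Qed.

Lemma l2norm_sum p I (r : seq I) (P : pred I) (F : I -> 'cV[R]_p) :
  l2norm (\sum_(i <- r | P i) F i) <= \sum_(i <- r | P i) l2norm (F i).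
Proof.
elim/big_ind2: _ => [|a x b y ax b_y|//]; first by rewrite l2norm0.
by rewrite (le_trans (l2normD _ _))// lerD.
Qed.

Lemma sqr_coord_le p (u : 'cV[R]_p) k : u k 0 ^+ 2 <= dot u u.
Proof.
rewrite /dot (bigD1 k)//= expr2 lerDl.
by apply: sumr_ge0 => j _; rewrite -expr2 sqr_ge0.
Qed.

Lemma coord_le_l2norm p (u : 'cV[R]_p) k : `|u k 0| <= l2norm u.
Proof.
rewrite -ler_sqr ?nnegrE ?normr_ge0 ?l2norm_ge0// l2norm_sqr.
by rewrite -normrX ger0_norm ?sqr_ge0// sqr_coord_le.
Qed.

Lemma col_sum_delta p (u : 'cV[R]_p) : u = \sum_k u k 0 *: delta_mx k 0.
Proof.
apply/colP => k; rewrite summxE (bigD1 k)//= !mxE !eqxx mulr1 big1 ?addr0//.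
by move=> j jk; rewrite !mxE eq_sym (negbTE jk) mulr0.
Qed.

(** The square of the Frobenius norm, without the root: second moments of the Jacobian noise are
    then sums over entries. *)
Definition frobenius p q (M : 'M[R]_(p, q)) : R := \sum_i \sum_j M i j ^+ 2.

Lemma frobenius_ge0 p q (M : 'M[R]_(p, q)) : 0 <= frobenius M.
Proof. by apply: sumr_ge0 => i _; apply: sumr_ge0 => j _; rewrite sqr_ge0. Qed.

Lemma frobenius_tr p q (M : 'M[R]_(p, q)) : frobenius M^T = frobenius M.
Proof.
rewrite /frobenius exchange_big; apply: eq_bigr => i _.
by apply: eq_bigr => j _; rewrite mxE.
Qed.

Lemma dot_mulmx_frobenius p q (M : 'M[R]_(p, q)) v :
  dot (M *m v) (M *m v) <= frobenius M * dot v v.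
Proof.
rewrite /frobenius mulr_suml; apply: ler_sum => i _; rewrite -expr2.
pose w := (row i M)^T; have -> : (M *m v) i 0 = dot w v.
  by rewrite mxE; apply: eq_bigr => j _; rewrite !mxE.
have -> : \sum_j M i j ^+ 2 = dot w w.
  by apply: eq_bigr => j _; rewrite !mxE expr2.
rewrite -!l2norm_sqr -exprMn -[leLHS]ger0_norm ?sqr_ge0// normrX.
by rewrite ler_sqr ?nnegrE ?normr_ge0 ?normr_dot// mulr_ge0// l2norm_ge0.
Qed.

End euclidean.

(** * Equivalence of an arbitrary norm, its dual and its operator norm with Euclidean quantities *)

Section norm_equivalence.
Context {R : realType} {p : nat} (N : 'cV[R]_p -> R).
Hypothesis normN : is_norm N.

Lemma is_normZ a u : N (a *: u) = `|a| * N u. Proof. by case: normN. Qed.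

Lemma is_normD u v : N (u + v) <= N u + N v. Proof. by case: normN. Qed.

Lemma is_norm0 : N 0 = 0.
Proof. by rewrite -(scale0r 0) is_normZ normr0 mul0r. Qed.

Lemma is_normN u : N (- u) = N u.
Proof. by rewrite -scaleN1r is_normZ normrN1 mul1r. Qed.

Lemma is_norm_ge0 u : 0 <= N u.
Proof.
have := is_normD u (- u); rewrite subrr is_norm0 is_normN.
by rewrite -mulr2n pmulrn_lge0.
Qed.

Lemma is_norm_sum I (r : seq I) (F : I -> 'cV[R]_p) :
  N (\sum_(i <- r) F i) <= \sum_(i <- r) N (F i).
Proof.
elim/big_ind2: _ => [|a x b y ax b_y|//]; first by rewrite is_norm0.
by rewrite (le_trans (is_normD _ _))// lerD.
Qed.

Lemma is_norm_dist u v : `|N u - N v| <= N (u - v).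
Proof.
rewrite ler_norml lerBrDl lerBlDl.
have := is_normD (v - u) u; rewrite subrK -opprB is_normN.
by have := is_normD (u - v) v; rewrite subrK; lra.
Qed.

Lemma is_norm_le_l2 : exists2 A, 0 < A & forall u, N u <= A * l2norm u.
Proof.
exists (1 + \sum_k N (delta_mx k 0)).
  by rewrite ltr_pwDl// sumr_ge0// => k _; exact: is_norm_ge0.
move=> u; rewrite {1}(col_sum_delta u); apply: le_trans (is_norm_sum _ _) _.
rewrite mulrDl mul1r; apply: ler_wpDl; first exact: l2norm_ge0.
rewrite mulr_suml; apply: ler_sum => k _; rewrite is_normZ mulrC.
by rewrite ler_wpM2l ?is_norm_ge0 ?coord_le_l2norm.
Qed.

Lemma l2_le_mx_norm (u : 'rV[R]_p) : l2norm u^T <= p%:R * `|u|.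
Proof.
rewrite {1}(col_sum_delta u^T); apply: le_trans (l2norm_sum _ _ _) _.
apply: (@le_trans _ _ (\sum_(k < p) `|u|)); last first.
  by rewrite sumr_const card_ord mulr_natl.
apply: ler_sum => k _; rewrite l2normZ.
have -> : l2norm (delta_mx k 0 : 'cV[R]_p) = 1.
  rewrite /l2norm /dot (bigD1 k)//= !mxE !eqxx mulr1 big1 ?addr0 ?sqrtr1//.
  by move=> j jk; rewrite !mxE (negbTE jk) mul0r.
rewrite mulr1 mxE [leRHS]/Num.norm/= mx_normrE.
by apply: (le_bigmax _ (fun ij : 'I_1 * 'I_p => `|u ij.1 ij.2|) (0, k)).
Qed.

(* A norm is continuous, hence bounded below on the compact sup-norm sphere. *)
Lemma l2_le_is_norm : exists2 A, 0 < A & forall u, l2norm u <= A * N u.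
Proof.
have [A A0 NA] := is_norm_le_l2.
pose h (v : 'rV[R]_p) := N v^T.
have hc : continuous h.
  move=> v; apply/(@cvgrPdist_lt R R^o _ (nbhs v)) => e e0; apply/(@nbhs_normP R 'rV[R]_p).
  exists ((A * p.+1%:R)^-1 * e) => /=.
    by rewrite mulr_gt0// invr_gt0 mulr_gt0.
  move=> w /= vw; apply: le_lt_trans (is_norm_dist _ _) _.
  rewrite -linearB/=; apply: le_lt_trans (NA _) _.
  apply: (@le_lt_trans _ _ (A * (p%:R * `|v - w|))).
    by rewrite ler_pM2l// l2_le_mx_norm.
  apply: (@le_lt_trans _ _ (A * p.+1%:R * `|v - w|)).
    by rewrite mulrA ler_wpM2r// ler_pM2l// ler_nat.
  by rewrite -ltr_pdivlMl ?mulr_gt0.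
pose Sph := [set v : 'rV[R]_p | `|v| = 1].
have cS : compact Sph.
  apply: bounded_closed_compact.
    by exists 1; split => // x x1 v /= ->; exact: ltW.
  have -> : Sph = (fun v : 'rV[R]_p => `|v|) @^-1` [set 1] by [].
  apply: (@preimage_closed _ _ (fun v : 'rV[R]_p => `|v|)) => // v _.
  exact: norm_continuous.
(* An empty sphere means dimension 0, where every vector vanishes. *)
have [S0|/set0P S0] := eqVneq Sph set0.
  exists 1 => // u; suff -> : u = 0 by rewrite l2norm0 is_norm0 mulr0.
  apply: contrapT => u0; have uT0 : u^T != 0.
    by apply/eqP => uT; apply: u0; rewrite -(trmxK u) uT trmx0.
  have : Sph (`|u^T|^-1 *: u^T).
    by rewrite /Sph/= normrZ normfV normr_id mulVf// normr_eq0.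
  by rewrite S0.
have [|c cS' hmin] := @compact_EVT_min _ R h Sph S0 cS.
  by apply: continuous_subspaceT.
have {}cS' : `|c| = 1 by move: cS'; rewrite inE.
have hc0 : 0 < h c.
  rewrite lt_neqAle is_norm_ge0 andbT eq_sym; apply/eqP => h0.
  have : c^T = 0 by case: normN => + _ _; exact.
  by move=> /(congr1 trmx); rewrite trmxK trmx0 => c0; move: cS'; rewrite c0 normr0; lra.
(* [p] compares the Euclidean norm with the sup norm and [h c] is the minimum of [N] on the sup-norm
   sphere; the successor makes positivity immediate. *)
exists (p.+1%:R / h c); first by rewrite divr_gt0.
move=> u; have [->|u0] := eqVneq u 0; first by rewrite l2norm0 is_norm0 mulr0.
have uT0 : 0 < `|u^T|.
  by rewrite normr_gt0; apply: contra u0 => /eqP uT; rewrite -(trmxK u) uT trmx0.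
have hu : h c * `|u^T| <= N u.
  have : h c <= h (`|u^T|^-1 *: u^T).
    by apply: hmin; rewrite inE /Sph/= normrZ normfV normr_id mulVf// gt_eqF.
  rewrite /h linearZ/= trmxK is_normZ normfV normr_id.
  by rewrite ler_pdivlMl// mulrC.
rewrite -[u in leLHS]trmxK; apply: le_trans (l2_le_mx_norm _) _.
rewrite mulrAC ler_pdivlMr// -mulrA [`|_| * _]mulrC.
by rewrite ler_pM// ?mulr_ge0 ?ler_nat// ltW.
Qed.

End norm_equivalence.

(** The bound [M] is what gives the real [sup] its meaning: on an unbounded set it would be a
    default value. *)
Lemma sup_image_ge {R : realType} {T : Type} (E : set T) (f : T -> R) M t :
  (forall s, E s -> f s <= M) -> E t -> f t <= sup [set f s | s in E].
Proof.
move=> fM Et; apply: ub_le_sup; last by exists t.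
by exists M => _ [s Es <-]; exact: fM.
Qed.

Lemma sup_image_le {R : realType} {T : Type} (E : set T) (f : T -> R) M t :
  (forall s, E s -> f s <= M) -> E t -> sup [set f s | s in E] <= M.
Proof.
move=> fM Et; apply: ge_sup; first by exists (f t), t.
by move=> _ [s Es <-]; exact: fM.
Qed.

(** One constant serves all comparisons: [A0] for the vector norms, and [p * A0 ^+ 2] for the
    Frobenius norm, because each of the [p] columns of [M] is the image of a basis vector whose
    [N]-norm is at most [A0]. *)
Lemma norm_constants {R : realType} {p : nat} (N : 'cV[R]_p -> R) :
  is_norm N -> exists A,
  [/\ 1 <= A, forall u, N u <= A * l2norm u, forall u, l2norm u <= A * N u,
      forall u, dual_norm N u <= A * l2norm u &
      forall u, l2norm u <= A * dual_norm N u] /\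
  forall q (M : 'M[R]_(q, p)), frobenius M <= A * op_norm N M ^+ 2.
Proof.
move=> nN; have [A1 A10 NA1] := is_norm_le_l2 nN.
have [A2 A20 NA2] := l2_le_is_norm nN.
pose A0 := 1 + A1 + A2.
have A0ge1 : 1 <= A0 by rewrite /A0; lra.
have A0gt0 : 0 < A0 by lra.
have N0 u : N u <= A0 * l2norm u.
  by apply: le_trans (NA1 u) _; rewrite ler_wpM2r ?l2norm_ge0// /A0; lra.
have N1 u : l2norm u <= A0 * N u.
  by apply: le_trans (NA2 u) _; rewrite ler_wpM2r ?is_norm_ge0// /A0; lra.
have unit_ball v : N v <= 1 -> l2norm v <= A0.
  by move=> v1; apply: le_trans (N1 v) _; rewrite -[leRHS]mulr1 ler_pM2l.
have ball0 : [set v | N v <= 1] 0 by rewrite /= is_norm0.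
have dualub u v : N v <= 1 -> dot v u <= A0 * l2norm u.
  move=> v1; apply: le_trans (dot_l2norm _ _) _.
  by rewrite ler_wpM2r ?l2norm_ge0 ?unit_ball.
have dual0 u : 0 <= dual_norm N u.
  have := @sup_image_ge _ _ _ (fun v => dot v u) _ 0 (dualub u) ball0.
  by rewrite dot0l.
have opub q (M : 'M[R]_(q, p)) v : N v <= 1 ->
    l2norm (M *m v) <= Num.sqrt (frobenius M) * A0.
  move=> v1; rewrite -ler_sqr ?nnegrE ?l2norm_ge0 ?mulr_ge0 ?sqrtr_ge0 ?(ltW A0gt0)//.
  rewrite l2norm_sqr exprMn sqr_sqrtr ?frobenius_ge0//.
  apply: le_trans (dot_mulmx_frobenius _ _) _.
  rewrite ler_wpM2l ?frobenius_ge0// -l2norm_sqr.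
  by rewrite ler_sqr ?nnegrE ?l2norm_ge0 ?unit_ball ?(ltW A0gt0).
exists (A0 + p%:R * A0 ^+ 2); set A := A0 + _.
have A0A : A0 <= A by rewrite lerDl mulr_ge0 ?sqr_ge0.
have mono (a b : R) : 0 <= b -> a <= A0 * b -> a <= A * b.
  by move=> b0 /le_trans; apply; rewrite ler_wpM2r.
split.
  split=> [|u|u|u|u].
  - exact: le_trans A0A.
  - by apply: mono; rewrite ?l2norm_ge0.
  - by apply: mono; rewrite ?is_norm_ge0.
  - apply: mono; first exact: l2norm_ge0.
    by apply: (sup_image_le _ ball0) => v; exact: dualub.
  - apply: mono.
      exact: dual0.
    have [u0|u0] := eqVneq (l2norm u) 0.
      by rewrite u0 mulr_ge0 ?(ltW A0gt0).
    have up : 0 < l2norm u by rewrite lt_neqAle eq_sym u0 l2norm_ge0.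
    have Np : 0 < N u.
      by rewrite -(pmulr_rgt0 _ A0gt0); exact: lt_le_trans (N1 u).
    (* The vector [u] itself, normalized, is the test vector in the supremum defining the dual
       norm. *)
    have : dot ((N u)^-1 *: u) u <= dual_norm N u.
      apply: (sup_image_ge (f := fun v => dot v u) (dualub u)) => /=.
      by rewrite is_normZ// ger0_norm ?invr_ge0 ?(ltW Np)// mulVf// gt_eqF.
    rewrite dotZl -l2norm_sqr ler_pdivrMl// => h.
    rewrite -(ler_pM2l up) -expr2; apply: le_trans h _.
    by rewrite mulrA ler_wpM2r// mulrC.
move=> q M; have op0 : 0 <= op_norm N M.
  have := @sup_image_ge _ _ _ (fun v => l2norm (M *m v)) _ 0 (opub q M) ball0.
  by rewrite mulmx0 l2norm0.
have col_le j : \sum_i M i j ^+ 2 <= A0 ^+ 2 * op_norm N M ^+ 2.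
  pose e : 'cV[R]_p := delta_mx j 0.
  have -> : \sum_i M i j ^+ 2 = l2norm (M *m e) ^+ 2.
    rewrite l2norm_sqr; apply: eq_bigr => i _.
    by rewrite /e -colE mxE expr2.
  have e1 : l2norm e = 1.
    rewrite /l2norm /dot (bigD1 j)//= !mxE !eqxx mulr1 big1 ?addr0 ?sqrtr1//.
    by move=> k jk; rewrite !mxE (negbTE jk) mul0r.
  have Np : 0 < N e.
    by rewrite -(pmulr_rgt0 _ A0gt0); apply: lt_le_trans (N1 e); rewrite e1.
  rewrite -exprMn ler_sqr ?nnegrE ?l2norm_ge0 ?mulr_ge0// ?(ltW A0gt0)//.
  have : l2norm (M *m ((N e)^-1 *: e)) <= op_norm N M.
    apply: (sup_image_ge (f := fun v => l2norm (M *m v)) (opub q M)) => /=.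
    by rewrite is_normZ// ger0_norm ?invr_ge0 ?(ltW Np)// mulVf// gt_eqF.
  rewrite -scalemxAr l2normZ ger0_norm ?invr_ge0 ?(ltW Np)// ler_pdivrMl//.
  move=> /le_trans; apply; rewrite ler_wpM2r//.
  by have := N0 e; rewrite e1 mulr1.
rewrite /frobenius exchange_big/=.
apply: le_trans (ler_sum _ (fun j _ => col_le j)) _.
rewrite sumr_const card_ord -mulr_natl mulrA ler_wpM2r ?sqr_ge0//.
by rewrite /A lerDr ltW.
Qed.

(** Let [t] tend to 0. This replaces differentiation along a segment in the optimality arguments
    below. *)
Lemma le_of_all_slopes {R : realType} (a b c : R) :
  (forall t, 0 < t < 1 -> a <= b + t * c) -> a <= b.
Proof.
move=> h; rewrite leNgt; apply/negP => ab.
have c0 : 0 <= `|c| by [].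
have [|] := leP c 0 => [c_le0|c_gt0].
  by have := h (1 / 2) ltac:(lra); nra.
(* Chosen so that [t * c] stays below half of [a - b]. *)
pose t := (a - b) / (2 * (a - b + c)).
have d0 : 0 < 2 * (a - b + c) by lra.
have ht : t * (2 * (a - b + c)) = a - b by rewrite /t mulfVK// gt_eqF.
have t01 : 0 < t < 1.
  by rewrite /t divr_gt0 ?ltr_pdivrMr//=; lra.
by have := h t t01; nra.
Qed.

(** * Convexity and the proximal steps *)

Section convexity.
Context {R : realType} {p : nat}.
Implicit Types (D : set 'cV[R]_p) (h : 'cV[R]_p -> \bar R) (u v : 'cV[R]_p).

Lemma convex_set_segment D u v (t : R) :
  convex_set (D : set (convex_lmodType 'cV[R]_p)) ->
  D u -> D v -> 0 < t < 1 -> D (t *: u + (1 - t) *: v).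
Proof.
move=> cD Du Dv /andP[t0 t1].
have := cD u v (Itv01 (ltW t0) (ltW t1)); rewrite !inE; exact.
Qed.

(** Insert a point of the segment from [v] to [u] into both the strong convexity inequality and the
    subgradient inequality at [v], divide by its parameter [t], and let [t] tend to 0. *)
Lemma bregman_ge D N (c : R) h u v s :
  estrongly_convex D N c h -> D u -> D v ->
  (forall w, (-oo < h w)%E) -> h u \is a fin_num -> esubgradient h v s ->
  c / 2 * N (u - v) ^+ 2 <= fine (h u) - fine (h v) - dot s (u - v).
Proof.
move=> sc Du Dv hN fu [fv sub].
apply: (@le_of_all_slopes _ _ _ (c / 2 * N (u - v) ^+ 2)) => t t01.
have /andP[t0 t1] := t01.
have h1 := sc u v t Du Dv t01.
have h2 := sub (t *: u + (1 - t) *: v).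
have e : t *: u + (1 - t) *: v - v = t *: (u - v).
  by apply/colP => k; rewrite !mxE; ring.
rewrite e dotZr in h2.
have fw : h (t *: u + (1 - t) *: v) \is a fin_num.
  move: h1 (hN (t *: u + (1 - t) *: v)); rewrite -(fineK fu) -(fineK fv).
  rewrite -!EFinM -EFinD; case: (h (t *: u + (1 - t) *: v)) => //=.
move: h1 h2; rewrite -(fineK fu) -(fineK fv) -(fineK fw).
rewrite -!EFinM -!EFinD !lee_fin.
set a := fine (h u); set b := fine (h v); set q := N _ ^+ 2.
set g := dot _ _ => h1 h2.
have : t * (c / 2 * (1 - t) * q) <= t * (a - b - g) by nra.
by rewrite ler_pM2l//=; nra.
Qed.

End convexity.

Section proximal_step.
Context {R : realType} {p : nat} (X : set 'cV[R]_p) (r : 'cV[R]_p -> \bar R).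
Variable mu : R.
Hypothesis convexX : convex_set (X : set (convex_lmodType 'cV[R]_p)).
Hypothesis convex_r : econvex X (fun x => (r x - (mu / 2 * l2norm x ^+ 2)%:E)%E).
Hypothesis r_gtNy : forall x, X x -> (-oo < r x)%E.

(** The convexity defect of the squared Euclidean norm is an identity, so convexity of
    [r - mu/2 |.|^2] turns into a strong convexity inequality for [r] without loss. *)
Lemma dot_segment (u v x : 'cV[R]_p) (t : R) :
  let w := t *: u + (1 - t) *: v in
  dot (w - x) (w - x) = t * dot (u - x) (u - x) + (1 - t) * dot (v - x) (v - x)
    - t * (1 - t) * dot (u - v) (u - v).
Proof.
move=> w; have -> : w - x = t *: (u - x) + (1 - t) *: (v - x).
  by apply/colP => k; rewrite !mxE; ring.
have -> : u - v = (u - x) - (v - x) by apply/colP => k; rewrite !mxE; ring.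
move: (u - x) (v - x) => a b.
by rewrite !(dotDl, dotDr, dotZl, dotZr, dotNl, dotNr) (dotC b a); ring.
Qed.

Lemma strongly_convex_fine u v t : X u -> X v -> 0 < t < 1 ->
  r u \is a fin_num -> r v \is a fin_num ->
  r (t *: u + (1 - t) *: v) \is a fin_num /\
  fine (r (t *: u + (1 - t) *: v)) + mu / 2 * (t * (1 - t)) * dot (u - v) (u - v)
    <= t * fine (r u) + (1 - t) * fine (r v).
Proof.
move=> Xu Xv t01 fu fv; set w := t *: u + _.
have Xw : X w by exact: convex_set_segment.
have := convex_r Xu Xv t01; rewrite -/w -(fineK fu) -(fineK fv).
rewrite -!EFinB -!EFinM -!EFinD => h.
have fw : r w \is a fin_num.
  by move: (r_gtNy Xw) h; case: (r w).
split=> //; move: h; rewrite -(fineK fw) -EFinB lee_fin !l2norm_sqr /=.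
by have := dot_segment u v 0 t; rewrite /= !subr0 -/w => ->; nra.
Qed.

(** The function minimized by the primal step is strongly convex with modulus [eta + mu], hence its
    value at [xs] exceeds its minimum by at least [(eta + mu) / 2] times the squared distance to the
    minimizer [xp]. *)
Lemma proximal_inequality (eta : R) G x xp xs :
  X xp -> X xs -> r xs \is a fin_num ->
  (forall u, X u ->
    (dot G xp)%:E + r xp + (eta / 2 * l2norm (xp - x) ^+ 2)%:E <=
    (dot G u)%:E + r u + (eta / 2 * l2norm (u - x) ^+ 2)%:E)%E ->
  r xp \is a fin_num /\
  dot G (xp - xs) + fine (r xp) + eta / 2 * dot (xp - x) (xp - x)
    + (eta + mu) / 2 * dot (xp - xs) (xp - xs)
  <= fine (r xs) + eta / 2 * dot (xs - x) (xs - x).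
Proof.
move=> Xp Xs fs opt.
have fp : r xp \is a fin_num.
  have := opt _ Xs; rewrite -(fineK fs) -!EFinD.
  by move: (r_gtNy Xp); case: (r xp).
split=> //; apply: (@le_of_all_slopes _ _ _
  ((eta + mu) / 2 * dot (xp - xs) (xp - xs))) => t t01.
have /andP[t0 t1] := t01.
have [fw hw] := strongly_convex_fine Xs Xp t01 fs fp.
have := opt _ (convex_set_segment convexX Xs Xp t01).
rewrite -(fineK fw) -(fineK fp) -!EFinD lee_fin !l2norm_sqr dot_segment.
move: hw; set w := fine (r (_ + _)).
rewrite (dotDr (t *: xs)) !dotZr (dotBr xp xs) -[xp - xs]opprB dotNl dotNr opprK /=.
set a := dot (xs - xp) _; set b := dot (xp - x) _; set c := dot (xs - x) _.
set e := fine (r xs); set f := fine (r xp); set g := dot G xp; set g' := dot G xs.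
move=> hw h; rewrite -(ler_pM2l t0); nra.
Qed.

End proximal_step.

(* The three-point identity for Bregman divergences turns the optimality
   condition of the dual step into this inequality, valid for every selection of
   subgradients that satisfies it. *)
Lemma dual_step_inequality {R : realType} {m : nat} (Y : set 'cV[R]_m)
    (h psi : 'cV[R]_m -> \bar R) (rho tau : R) gt y yp s sp v :
  (forall u, -oo < h u)%E ->
  psi y \is a fin_num -> psi yp \is a fin_num -> psi v \is a fin_num ->
  h v \is a fin_num -> Y v ->
  relative_subgradient Y psi rho h yp (gt + tau *: s - (tau + rho) *: sp) ->
  let U a b q := fine (psi a) - fine (psi b) - dot q (a - b) in
  h yp \is a fin_num /\
  fine (h yp) - fine (h v) + dot gt (v - yp)
    <= tau * U v y s - (tau + rho) * U v yp sp - tau * U yp y s.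
Proof.
move=> hN fy fyp fv hv Yv /(_ v Yv).
rewrite -(fineK fyp) -(fineK fv) -(fineK hv) -!EFinM -EFinD => rel /=.
(* An infinite [h yp] would make the left side of the subgradient inequality infinite against a
   finite right side. This is how the updated dual iterates get into the domain of the conjugate. *)
have hyp : h yp \is a fin_num.
  by move: (hN yp) rel; case: (h yp) => //=; rewrite addye ?ltry// addye.
split=> //; move: rel; rewrite -(fineK hyp) -!EFinD lee_fin /=.
rewrite !(dotDl, dotDr, dotZl, dotZr, dotNl, dotNr, dotBl, dotBr); lra.
Qed.

Lemma scaled_bounded_le0 {R : realType} (a M : R) :
  (forall c, 0 < c -> c * a <= M) -> a <= 0.
Proof.
move=> h; rewrite leNgt; apply/negP => a0.
have := h ((`|M| + 1) / a); rewrite divfK ?gt_eqF// => /(_ _)/wrap[].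
  by rewrite divr_gt0// ltr_pwDr.
by have := ler_norm M; lra.
Qed.

(** * The domain of the conjugate, and optimal dual variables *)

Section conjugate.
Context {R : realType} {m : nat} (f : 'cV[R]_m -> R).

Lemma conjugate_ge v u : ((dot v u - f u)%:E <= conjugate f v)%E.
Proof. by apply: ereal_sup_ubound; exists u. Qed.

Lemma conjugate_gtNy v : (-oo < conjugate f v)%E.
Proof. exact: lt_le_trans (ltNyr _) (conjugate_ge v 0). Qed.

Lemma conjugate_fine_ge v u : conjugate f v \is a fin_num ->
  dot v u - f u <= fine (conjugate f v).
Proof. by move=> fv; rewrite -lee_fin fineK// conjugate_ge. Qed.

(** Along the ray [c *: v] the expression under the supremum grows at least like
    [c * (|v|^2 - L * |v|)], up to a constant, and a finite conjugate forbids growth. *)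
Lemma conjugate_dom_bounded L v : 0 <= L ->
  (forall u u', `|f u - f u'| <= L * l2norm (u - u')) ->
  conjugate f v \is a fin_num -> l2norm v <= L.
Proof.
move=> L0 lipf fv; have [->//|v0] := eqVneq (l2norm v) 0.
have vp : 0 < l2norm v by rewrite lt_neqAle eq_sym v0 l2norm_ge0.
have : l2norm v ^+ 2 - L * l2norm v <= 0.
  apply: (@scaled_bounded_le0 _ _ (fine (conjugate f v) + f 0)) => c c0.
  have := conjugate_fine_ge (c *: v) fv.
  have := lipf (c *: v) 0; rewrite subr0 l2normZ (gtr0_norm c0).
  move=> /(le_trans (ler_norm _)); rewrite dotZr -l2norm_sqr; lra.
by rewrite expr2 -mulrBl pmulr_lle0// subr_le0.
Qed.

(** Test the conjugate along [- c] times the [k]-th basis vector: there [f] stays below [f 0], so a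
    negative coordinate of [v] would make the supremum infinite. *)
Lemma conjugate_dom_ge0 v k :
  (forall u u' : 'cV[R]_m, (forall k, u k 0 <= u' k 0) -> f u <= f u') ->
  conjugate f v \is a fin_num -> 0 <= v k 0.
Proof.
move=> incf fv; rewrite -oppr_le0.
apply: (@scaled_bounded_le0 _ _ (fine (conjugate f v) + f 0)) => c c0.
have := conjugate_fine_ge ((- c) *: delta_mx k 0) fv.
have -> : dot v (- c *: delta_mx k 0) = c * - v k 0.
  rewrite dotZr /dot (bigD1 k)//= !mxE !eqxx mulr1 big1 ?addr0; first by ring.
  by move=> j jk; rewrite !mxE (negbTE jk) mulr0.
have : f (- c *: delta_mx k 0) <= f 0.
  apply: incf => j; rewrite !mxE mulNr oppr_le0 mulr_ge0 ?(ltW c0)//.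
lra.
Qed.

Section dual_optimum.
Variables (y us : 'cV[R]_m).
Hypothesis fy : conjugate f y \is a fin_num.
Hypothesis fus : f us = dot y us - fine (conjugate f y).

(** Equality in the Fenchel-Young inequality makes [us] a subgradient of the conjugate at [y]. *)
Lemma dual_optimum_conjugate v : conjugate f v \is a fin_num ->
  dot (v - y) us <= fine (conjugate f v) - fine (conjugate f y).
Proof.
by move=> fv; have := conjugate_fine_ge us fv; rewrite fus dotBl; lra.
Qed.

(* Differentiability of [f] identifies the maximizing dual variable with the
   gradient. *)
Lemma dual_optimum_upper (L : R) :
  (forall u u', `|f u - f u' - 'd f u' (u - u')| <= L * dot (u - u') (u - u')) ->
  forall u, f u <= f us + dot y (u - us) + L * dot (u - us) (u - us).
Proof.
move=> sm.
have le_diff h : dot y h <= 'd f us h.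
  apply: (@le_of_all_slopes _ _ _ (L * dot h h)) => t /andP[t0 _].
  have e : us + t *: h - us = t *: h by rewrite addrAC subrr add0r.
  have := sm (us + t *: h) us; rewrite e dotZl dotZr.
  rewrite linearZ/= => /(le_trans (ler_norm _)) h1.
  have := conjugate_fine_ge (us + t *: h) fy; rewrite dotDr dotZr => h2.
  rewrite -(ler_pM2l t0); move: h1 h2 fus; rewrite /GRing.scale/=.
  set a := f (_ + _); set b := fine _; set c := dot y us; set i := dot y h.
  set q := 'd f us h; set z := dot h h; move=> h1 h2 h3; nra.
have diffE h : 'd f us h = dot y h.
  apply/le_anti; rewrite le_diff andbT.
  by have := le_diff (- h); rewrite dotNr linearN lerN2.
move=> u; have := sm u us; rewrite diffE => /(le_trans (ler_norm _)); lra.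
Qed.

End dual_optimum.

End conjugate.

(** * The assumptions on the problem in Euclidean form, and the saddle-point inequality *)

Section euclidean_setting.
Context {R : realType} {d m : nat} (N : 'cV[R]_m -> R).
Context (Cg Cf sigma0 sigma1 delta Lf mupsi rho : R) (n S B : nat) (mu : R).
Context (pb : fcco R d m n) (psi : 'I_n -> 'cV[R]_m -> \bar R).
Context (x0 : 'cV[R]_d) (y0 s0 : 'I_n -> 'cV[R]_m) (xs : 'cV[R]_d).
Context (A : R).
Hypotheses (Cg0 : 0 < Cg) (Cf0 : 0 < Cf) (Lf0 : 0 < Lf) (mupsi0 : 0 < mupsi).
Hypothesis st : alexr_setting N Cg Cf sigma0 sigma1 delta Lf mupsi rho
  S B mu pb psi x0 y0 s0 xs.
Hypotheses (A1 : 1 <= A) (l2_le_N : forall u, l2norm u <= A * N u)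
  (dual_le_l2 : forall u, dual_norm N u <= A * l2norm u)
  (l2_le_dual : forall u, l2norm u <= A * dual_norm N u).

Let X := xdom pb.
Let g := inner pb.
Let J := jac pb.
Let f := outer pb.
Let h i := conjugate (f i).
Let r := reg pb.

Let A0 : 0 < A. Proof. by move: A1; lra. Qed.

Lemma dual_norm_ge0 u : 0 <= dual_norm N u.
Proof.
by rewrite -(pmulr_rge0 _ A0); apply: le_trans (l2_le_dual u); exact: l2norm_ge0.
Qed.

Lemma outer_lipschitz i u u' : `|f i u - f i u'| <= A * Cf * l2norm (u - u').
Proof.
have [_ lip _] := set_outer st; apply: le_trans (lip i u u') _.
by rewrite (mulrC A) -mulrA ler_wpM2l ?(ltW Cf0).
Qed.

Lemma inner_lipschitz i x x' : X x -> X x' ->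
  l2norm (g i x - g i x') <= A * Cg * l2norm (x - x').
Proof.
move=> Xx Xx'; have [_ lip _ _ _] := set_inner st.
apply: le_trans (l2_le_dual _) _; rewrite -mulrA ler_wpM2l ?(ltW A0)//.
exact: lip.
Qed.

Lemma jac_lipschitz i x x' : X x -> X x' ->
  l2norm (J i x *m (x' - x)) <= A * Cg * l2norm (x' - x).
Proof.
move=> Xx Xx'; have [_ _ _ _ lip] := set_inner st.
apply: le_trans (l2_le_dual _) _; rewrite -mulrA ler_wpM2l ?(ltW A0)//.
exact: lip.
Qed.

Lemma dual_dom_bounded i v : h i v \is a fin_num -> l2norm v <= A * Cf.
Proof.
apply: conjugate_dom_bounded; first by rewrite mulr_ge0 ?(ltW A0) ?(ltW Cf0).
exact: outer_lipschitz.
Qed.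

(* Where [g_i] is not linear, the dual variables in the domain of [f_i^*] have
   nonnegative coordinates, which preserve the subgradient inequality. *)
Lemma inner_subgradient i x x' v : h i v \is a fin_num -> X x -> X x' ->
  dot v (g i x) + dot v (J i x *m (x' - x)) <= dot v (g i x').
Proof.
move=> fv Xx Xx'; have [_ _ _ sub _] := set_inner st.
have [_ _ inc] := set_outer st.
have [lin|nlin] := pselect (linear_on X (g i) (J i)).
  by rewrite (lin x x' Xx Xx') dotDr.
rewrite -dotDr; apply: ler_sum => k _; apply: ler_wpM2l.
  by apply: conjugate_dom_ge0 fv; exact: inc.
by have := sub i x Xx x' Xx' k; rewrite !mxE.
Qed.

(** The subgradient inequalities at the intermediate point towards its two ends, weighted by [t] and
    [1 - t], add up to convexity: the Jacobian terms cancel. *)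
Lemma inner_segment i x x' v (t : R) : h i v \is a fin_num -> X x -> X x' ->
  0 < t < 1 ->
  dot v (g i (t *: x + (1 - t) *: x') - g i x') <= t * dot v (g i x - g i x').
Proof.
move=> fv Xx Xx' t01; have /andP[t0 t1] := t01.
have [_ cX _ _ _] := set_reg st.
have Xw := convex_set_segment cX Xx Xx' t01.
have := inner_subgradient fv Xw Xx; have := inner_subgradient fv Xw Xx'.
set w := _ + _ in Xw *.
have -> : x' - w = (- t) *: (x - x') by apply/colP => k; rewrite !mxE; ring.
have -> : x - w = (1 - t) *: (x - x') by apply/colP => k; rewrite !mxE; ring.
by rewrite -!scalemxAr !dotZr !dotBr; nra.
Qed.

Lemma outer_smooth i u u' :
  `|f i u - f i u' - 'd (f i) u' (u - u')|
    <= Lf / 2 * A ^+ 2 * dot (u - u') (u - u').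
Proof.
have [_ sm] := set_smooth st i; apply: le_trans (sm u u') _.
rewrite -(mulrA (Lf / 2)) ler_wpM2l//; first by rewrite divr_ge0// ltW.
rewrite -l2norm_sqr -exprMn ler_sqr ?nnegrE ?dual_norm_ge0//.
by rewrite mulr_ge0 ?l2norm_ge0// ltW.
Qed.

Lemma reg_gtNy x : X x -> (-oo < r x)%E.
Proof. by have [_ _ [rN _] _ _] := set_reg st; exact: rN. Qed.

Lemma minimizer_dom : X xs.
Proof. by have [] := set_min st. Qed.

Lemma reg_minimizer_fin : r xs \is a fin_num.
Proof.
have [_ _ [_ [x Xx rx]] _ _] := set_reg st; have [_ /(_ _ Xx)] := set_min st.
rewrite /objective; move: rx (reg_gtNy minimizer_dom); rewrite -/r.
by case: (r x) => [a||]//= _; case: (r xs).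
Qed.

Lemma dual_optima : exists ys : 'I_n -> 'cV[R]_m, forall i,
  [/\ ydom pb i (ys i), h i (ys i) \is a fin_num &
      f i (g i xs) = dot (ys i) (g i xs) - fine (h i (ys i))].
Proof.
have P i : exists v, [/\ ydom pb i v, h i v \is a fin_num &
    f i (g i xs) = dot v (g i xs) - fine (h i v)].
  have [_ _ /(_ (g i xs))[[v Yv fE] _]] := set_dual st i.
  exists v; have fv : h i v \is a fin_num.
    by move: fE; rewrite -/f -/(h i); case: (h i v).
  by split => //; move: fE; rewrite -/f -/(h i) -(fineK fv) -EFinB => -[].
by have [ys ysP] := choice P; exists ys.
Qed.

Section saddle_point.
Variable ys : 'I_n -> 'cV[R]_m.
Hypothesis ysP : forall i,
  [/\ ydom pb i (ys i), h i (ys i) \is a fin_num &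
      f i (g i xs) = dot (ys i) (g i xs) - fine (h i (ys i))].

(* [xs] minimizes the Lagrangian at the optimal dual variables: along a segment
   from [xs] the smoothness error of [f_i] is quadratic in the step. *)
Lemma saddle_point x : X x -> r x \is a fin_num ->
  fine (r xs) <= fine (r x) + n%:R^-1 * \sum_i dot (ys i) (g i x - g i xs).
Proof.
move=> Xx fx; have Xs := minimizer_dom; have fs := reg_minimizer_fin.
have [_ cX _ _ cr] := set_reg st.
(* [t ^+ 2 * K] bounds the smoothness error of every [f_i] at [g_i(w)]: the factor of [outer_smooth]
   times the squared Lipschitz bound of [g_i] over a step of length [t |x - xs|]. *)
pose K := Lf / 2 * A ^+ 2 * (A * Cg) ^+ 2 * dot (x - xs) (x - xs).
have K0 : 0 <= K.
  by rewrite /K !mulr_ge0 ?dot_ge0 ?invr_ge0// ltW.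
apply: (@le_of_all_slopes _ _ _ K) => t t01; have /andP[t0 t1] := t01.
have Xw := convex_set_segment cX Xx Xs t01.
have [fw rw] := strongly_convex_fine cX cr reg_gtNy Xx Xs t01 fx fs.
have [_ /(_ _ Xw)] := set_min st.
rewrite -/r in fw rw *.
rewrite /objective -/r -(fineK fs) -(fineK fw) -!EFinD lee_fin.
move: rw fw Xw; set w := t *: x + _ => rw fw Xw opt.
have fi i : f i (g i w) <= f i (g i xs) + t * dot (ys i) (g i x - g i xs)
    + t ^+ 2 * K.
  have [_ fy fE] := ysP i.
  apply: le_trans (dual_optimum_upper fy fE (@outer_smooth i) (g i w)) _.
  apply: lerD; first by rewrite lerD2l inner_segment.
  rewrite /K -!(mulrA (Lf / 2 * A ^+ 2)) (mulrCA (t ^+ 2)).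
  rewrite ler_wpM2l//; first by rewrite mulr_ge0 ?sqr_ge0// divr_ge0// ltW.
  have := inner_lipschitz i Xw Xs.
  have -> : w - xs = t *: (x - xs) by apply/colP => k; rewrite !mxE; ring.
  move=> /(ler_sqrW (l2norm_ge0 _)); rewrite l2normZ gtr0_norm//.
  rewrite !exprMn !l2norm_sqr => /le_trans; apply.
  by rewrite le_eqVlt; apply/orP; left; apply/eqP; ring.
have n0 : 0 < n%:R :> R.
  by have /andP[S0 Sn] := set_outer_size st; rewrite ltr0n (leq_trans S0).
have avg : n%:R^-1 * \sum_i f i (g i w) <= n%:R^-1 * \sum_i f i (g i xs)
    + t * (n%:R^-1 * \sum_i dot (ys i) (g i x - g i xs)) + t ^+ 2 * K.
  rewrite -(ler_pM2l n0) !mulrDr mulVKf ?gt_eqF// mulVKf ?gt_eqF//.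
  rewrite (mulrCA n%:R t) mulVKf ?gt_eqF//.
  apply: le_trans (ler_sum _ (fun i _ => fi i)) _.
  by rewrite !big_split/= sumr_const card_ord -mulr_sumr mulr_natl.
move: avg opt rw; rewrite -/f -/g.
set a := n%:R^-1 * _; set b := n%:R^-1 * _; set c := n%:R^-1 * _.
have := dot_ge0 (x - xs); set q := dot _ _ => q0 avg opt rw.
have mu0 := set_mu st.
have zq : 0 <= mu / 2 * (t * (1 - t)) * q.
  by rewrite !mulr_ge0 ?(ltW t0) ?(ltW mu0) ?invr_ge0// subr_ge0 ltW.
have {zq} rw' : fine (r w) <= t * fine (r x) + (1 - t) * fine (r xs) by lra.
by rewrite -(ler_pM2l t0); nra.
Qed.

End saddle_point.

Lemma bregman_lower i u v s : ydom pb i u -> ydom pb i v ->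
  psi i u \is a fin_num -> esubgradient (psi i) v s ->
  mupsi / (2 * A ^+ 2) * dot (u - v) (u - v)
    <= fine (psi i u) - fine (psi i v) - dot s (u - v).
Proof.
move=> Yu Yv fu sub; have [psiN _ sc _] := set_dgf st i.
apply: le_trans (bregman_ge sc Yu Yv psiN fu sub).
rewrite invfM mulrA -mulrA ler_wpM2l ?divr_ge0 ?(ltW mupsi0)//.
rewrite ler_pdivrMl ?exprn_gt0// -exprMn -l2norm_sqr ler_sqr ?nnegrE//.
  exact: l2norm_ge0.
by apply: le_trans (l2_le_N _); exact: l2norm_ge0.
Qed.

End euclidean_setting.

(** * One step along a path *)

Section one_step.
Context {R : realType} {d m n : nat}.
Variables (X : set 'cV[R]_d) (dom : 'I_n -> set 'cV[R]_m).
Variables (g : 'I_n -> 'cV[R]_d -> 'cV[R]_m) (J : 'I_n -> 'cV[R]_d -> 'M[R]_(m, d)).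
Variables (F G c : R).
Hypothesis c0 : 0 < c.
Hypothesis g_lip : forall i x x', X x -> X x' ->
  l2norm (g i x - g i x') <= G * l2norm (x - x').
Hypothesis g_sub : forall i x x' v, dom i v -> X x -> X x' ->
  dot v (g i x) + dot v (J i x *m (x' - x)) <= dot v (g i x').
Hypothesis dom_bound : forall i v, dom i v -> l2norm v <= F.

Variables (eta mu tau rho theta : R).
Hypotheses (eta0 : 0 < eta) (tau0 : 0 < tau) (rho0 : 0 < rho).
Hypothesis theta01 : 0 <= theta <= 1.
Variables (xs xm x xp : 'cV[R]_d).
Hypotheses (Xs : X xs) (Xm : X xm) (Xx : X x).
Variables (ys y yp nu : 'I_n -> 'cV[R]_m) (Jt : 'I_n -> 'M[R]_(m, d)).
Variables (Uo Un Ud : 'I_n -> R).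

Let a := dot (x - xs) (x - xs).
Let a' := dot (xp - xs) (xp - xs).
Let b := dot (x - xm) (x - xm).
Let b' := dot (xp - x) (xp - x).
Let q i := dot (ys i - yp i) (ys i - yp i).
Let E i := Jt i - J i x.

Let dot_lip p p' (k L : R) (u v : 'cV[R]_p) (w : 'cV[R]_p') : 0 < k -> dot v v <= L * dot w w ->
  dot u v <= k / 2 * dot u u + (2 * k)^-1 * L * dot w w.
Proof.
move=> k0 vw; apply: le_trans (dot_young u v k0) _.
by rewrite lerD2l -mulrA ler_wpM2l// invr_ge0 mulr_ge0// ltW.
Qed.

(** The dual step inequality is combined with the subgradient inequality for [yp . g] at [x] towards
    [xs], and [Jt] is split into [J] plus the error [E]. The noise keeps its pairing with the old
    iterate [y] on the left; every pairing with a difference of iterates goes through Young's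
    inequality. *)
Lemma block_descent i :
  dom i (yp i) -> c * q i <= Un i ->
  c * dot (yp i - y i) (yp i - y i) <= Ud i ->
  dot (yp i - ys i) (g i xs)
    + dot (g i x + theta *: (g i x - g i xm) + nu i) (ys i - yp i)
    <= tau * Uo i - (tau + rho) * Un i - tau * Ud i ->
  dot (ys i) (g i x - g i xs) + dot (yp i) (J i x *m (xp - x))
    + (dot (nu i) (ys i - y i) + dot (y i) (E i *m (x - xs)))
    + (tau + rho) * Un i
  <= tau * Uo i + dot (yp i) (Jt i *m (xp - xs))
    + rho * c / 8 * q i + 2 * G ^+ 2 / (rho * c) * b + eta / 8 * b'
    + ((2 * tau * c)^-1 * dot (nu i) (nu i)
       + (2 * tau * c)^-1 * (frobenius (E i) * a)
       + 2 * F ^+ 2 / eta * frobenius (E i)).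
Proof.
move=> dy hq hd hD.
have rc0 : 0 < rho * c by rewrite mulr_gt0.
have tc0 : 0 < tau * c by rewrite mulr_gt0.
have [t0 t1] := andP theta01.
(* The extrapolation meets the new dual error; the share [rho * c / 8 * q i] is paid later out of
   the extra [rho * Un i] on the left. *)
have y1 : dot (yp i - ys i) (theta *: (g i x - g i xm))
    <= rho * c / 8 * q i + 2 * G ^+ 2 / (rho * c) * b.
  have k0 : 0 < rho * c / 4 by rewrite divr_gt0.
  have lip : dot (theta *: (g i x - g i xm)) (theta *: (g i x - g i xm))
      <= G ^+ 2 * dot (x - xm) (x - xm).
    rewrite dotZl dotZr mulrA -expr2 -!l2norm_sqr -(exprMn _ G).
    apply: (@le_trans _ _ (l2norm (g i x - g i xm) ^+ 2)).
      by rewrite ler_piMl ?sqr_ge0// -(expr1n _ 2) ler_sqrW.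
    by rewrite ler_sqrW ?l2norm_ge0 ?g_lip.
  have := dot_lip (yp i - ys i) k0 lip.
  rewrite -[yp i - ys i]opprB !dotNl dotNr opprK -/(q i) -/b.
  move=> h; apply: le_trans h _; rewrite le_eqVlt; apply/orP; left; apply/eqP.
  by field; rewrite !gt_eqF.
(* This bound and the next use up half each of [tau * Ud i], the proximal term of the dual step. *)
have y2 : dot (yp i - y i) (nu i) <=
    tau * c / 2 * dot (yp i - y i) (yp i - y i)
    + (2 * tau * c)^-1 * dot (nu i) (nu i).
  by have := dot_young (yp i - y i) (nu i) tc0; rewrite mulrA.
have y3 : - dot (yp i - y i) (E i *m (x - xs)) <=
    tau * c / 2 * dot (yp i - y i) (yp i - y i)
    + (2 * tau * c)^-1 * (frobenius (E i) * a).
  rewrite -dotNl; have := @dot_lip _ _ (tau * c) (frobenius (E i)) (- (yp i - y i))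
    (E i *m (x - xs)) (x - xs) tc0 (dot_mulmx_frobenius _ _).
  by rewrite !dotNl !dotNr opprK -/a !mulrA.
have y4 : - dot (yp i) (E i *m (xp - x)) <=
    eta / 8 * b' + 2 * F ^+ 2 / eta * frobenius (E i).
  rewrite dot_mulmx -dotNr.
  have e4 : 0 < 4 / eta by rewrite divr_gt0.
  have := @dot_lip _ _ (4 / eta) 1 ((E i)^T *m yp i) (- (xp - x)) (- (xp - x)) e4.
  rewrite mul1r lexx => /(_ isT) h; apply: le_trans h _.
  rewrite dotNl dotNr opprK -/b' addrC; apply: lerD.
    rewrite le_eqVlt; apply/orP; left; apply/eqP; field.
    by rewrite gt_eqF.
  apply: (@le_trans _ _ (4 / eta / 2 * (frobenius (E i) * F ^+ 2))).
    apply: ler_wpM2l; first by rewrite !divr_ge0// ltW.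
    apply: le_trans (dot_mulmx_frobenius _ _) _; rewrite frobenius_tr.
    rewrite ler_wpM2l ?frobenius_ge0// -l2norm_sqr ler_sqrW ?l2norm_ge0//.
    exact: dom_bound dy.
  rewrite le_eqVlt; apply/orP; left; apply/eqP; field.
  by rewrite gt_eqF.
have := g_sub dy Xx Xs.
have -> : xs - x = - (x - xs) by rewrite opprB.
rewrite mulmxN dotNr => sub.
have JE : dot (yp i) (Jt i *m (xp - xs)) =
    dot (yp i) (J i x *m (x - xs)) + dot (yp i) (J i x *m (xp - x))
    + dot (yp i) (E i *m (xp - x)) + dot (yp i - y i) (E i *m (x - xs))
    + dot (y i) (E i *m (x - xs)).
  have -> : Jt i = J i x + E i by rewrite /E addrC subrK.
  have -> : xp - xs = (x - xs) + (xp - x) by rewrite [RHS]addrC addrA subrK.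
  move: (x - xs) (xp - x) => u v.
  by rewrite mulmxDl !mulmxDr !dotDr dotBl; ring.
have hd' : tau * (c * dot (yp i - y i) (yp i - y i)) <= tau * Ud i.
  by rewrite ler_pM2l.
rewrite JE; move: hD y1 y2 y3 y4 sub hd'.
rewrite (dotC _ (ys i - yp i)) (dotC (nu i) (ys i - y i)).
rewrite !(dotBl, dotBr, dotDr); lra.
Qed.

Variables (S : nat) (Bt : {set 'I_n}).
Hypotheses (S0 : (0 < S)%N) (cardB : #|Bt| = S).

Let avg (f : 'I_n -> R) := S%:R^-1 * \sum_(i in Bt) f i.

Let avgD f f' : avg (fun i => f i + f' i) = avg f + avg f'.
Proof. by rewrite /avg big_split mulrDr. Qed.

Let avgZ k f : avg (fun i => k * f i) = k * avg f.
Proof. by rewrite /avg -mulr_sumr mulrCA. Qed.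

Let avg_cst k : avg (fun=> k) = k.
Proof.
by rewrite /avg sumr_const cardB -[k *+ S]mulr_natl mulKf// pnatr_eq0 -lt0n.
Qed.

Let avg_le f f' : (forall i, i \in Bt -> f i <= f' i) -> avg f <= avg f'.
Proof.
by move=> ff'; rewrite ler_wpM2l ?invr_ge0 ?ler0n//; exact: ler_sum.
Qed.

Variables (W cs : R).

(** The part that disappears in expectation along a run: uniform sampling equalizes the first two
    averages, and the noise in the last one is paired with quantities of the past. *)
Let M := avg (fun i => dot (ys i) (g i x - g i xs))
  - n%:R^-1 * \sum_i dot (ys i) (g i x - g i xs)
  + avg (fun i => dot (nu i) (ys i - y i) + dot (y i) (E i *m (x - xs))).

Let V i := (2 * tau * c)^-1 * dot (nu i) (nu i)
  + (2 * tau * c)^-1 * (frobenius (E i) * a)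
  + 2 * F ^+ 2 / eta * frobenius (E i).

(** The budget is exact. Of the [rho * Un] gained by the dual step, [rho / 2] stays in the
    potential, and the two terms [rho * c / 8 * avg q], from extrapolation and from drift, cost at
    most [rho / 4] because [c * q <= Un]. Of the [eta / 2 * b'] gained by the primal step, [eta / 8]
    pays for the Jacobian noise, [eta / 4] for the drift, and the last [eta / 8] for [cs] and for
    the move term kept in the potential. *)
Lemma one_step_descent :
  (forall i, i \in Bt -> dom i (yp i)) ->
  (forall i, i \in Bt -> c * q i <= Un i) ->
  (forall i, i \in Bt -> c * dot (yp i - y i) (yp i - y i) <= Ud i) ->
  (forall i, i \in Bt -> dot (yp i - ys i) (g i xs)
      + dot (g i x + theta *: (g i x - g i xm) + nu i) (ys i - yp i)
    <= tau * Uo i - (tau + rho) * Un i - tau * Ud i) ->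
  dot (S%:R^-1 *: \sum_(i in Bt) (Jt i)^T *m yp i) (xp - xs) + eta / 2 * b'
    + (eta + mu) / 2 * a'
    <= eta / 2 * a + n%:R^-1 * \sum_i dot (ys i) (g i xp - g i xs) ->
  - (W / eta + (eta / 4 + cs) * b' + rho * c / 8 * avg q)
    <= avg (fun i => dot (yp i) (J i x *m (xp - x)))
       - n%:R^-1 * \sum_i dot (ys i) (g i xp - g i x) ->
  cs + 4 * G ^+ 2 / (rho * c) <= eta / 8 ->
  (eta + mu) / 2 * a' + avg (fun i => (tau + rho / 2) * Un i)
    + 4 * G ^+ 2 / (rho * c) * b'
  <= eta / 2 * a + avg (fun i => tau * Uo i) + 2 * G ^+ 2 / (rho * c) * b
     + W / eta - M + avg V.
Proof.
move=> dy hq hd hD prox drift eta_large.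
have hU : rho / 4 * (c * avg q) <= rho / 4 * avg Un.
  rewrite ler_wpM2l//; first by rewrite divr_ge0// ltW.
  by rewrite -avgZ; exact: avg_le.
have Un0 : 0 <= rho / 4 * avg Un.
  rewrite mulr_ge0//; first by rewrite divr_ge0// ltW.
  rewrite mulr_ge0 ?invr_ge0// sumr_ge0// => i /hq; apply: le_trans.
  by rewrite mulr_ge0 ?dot_ge0// ltW.
have := avg_le (fun i iB =>
  block_descent (dy i iB) (hq i iB) (hd i iB) (hD i iB)).
rewrite !avgD !avgZ !avg_cst.
have -> : avg (fun i => dot (yp i) (Jt i *m (xp - xs))) =
    dot (S%:R^-1 *: \sum_(i in Bt) (Jt i)^T *m yp i) (xp - xs).
  rewrite dotZl dot_suml /avg; congr (_ * _).
  by apply: eq_bigr => i _; rewrite dot_mulmx.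
have nE : n%:R^-1 * \sum_i dot (ys i) (g i xp - g i xs) =
    n%:R^-1 * \sum_i dot (ys i) (g i xp - g i x)
    + n%:R^-1 * \sum_i dot (ys i) (g i x - g i xs).
  rewrite -mulrDr -big_split; congr (_ * _); apply: eq_bigr => i _ /=.
  by rewrite -dotDr addrA subrK.
have b'0 : (cs + 4 * G ^+ 2 / (rho * c)) * b' <= eta / 8 * b'.
  by rewrite ler_wpM2r ?dot_ge0.
move: prox drift hU b'0 Un0; rewrite nE /M !avgD.
lra.
Qed.

End one_step.

(** * Measurability and independence *)

Section freezing.
Local Open Scope ereal_scope.
Context {d d' : measure_display} {T : measurableType d} {Z : measurableType d'}.
Context {R : realType} (P : probability T R) (Q : probability Z R).
Variables (G : set (set T)) (V : T -> Z).
Hypothesis G_measurable : <<s G >> `<=` measurable.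
Hypothesis mV : measurable_fun setT V.
Hypothesis indep : forall A B, <<s G >> A -> measurable B ->
  P (A `&` V @^-1` B) = P A * Q B.

(** [T] with the coarser sigma-algebra generated by [G]: measurability on [O * Z] says that the
    first argument enters only through what is independent of [V]. *)
Let O := g_sigma_algebraType G.

Let id_measurable : measurable_fun setT (id : T -> O).
Proof. by move=> _ A mA; rewrite setTI; exact: G_measurable. Qed.

Let idm : {mfun T >-> O} :=
  HB.pack (id : T -> O) (isMeasurableFun.Build _ _ _ _ _ id_measurable).

Let pair_measurable : @measurable_fun _ _ T (O * Z)%type setT (fun w => (w, V w)).
Proof. exact: (measurable_fun_pair id_measurable mV). Qed.

Let pairm : {mfun T >-> (O * Z)%type} :=
  HB.pack (fun w => (w, V w) : O * Z)
    (isMeasurableFun.Build _ _ _ _ _ pair_measurable).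

(** By independence the joint law of [w], seen through [O], and [V w] is a product measure; Tonelli
    then integrates [V] out while [w] is frozen. *)
Lemma ge0_freezing (f : O * Z -> \bar R) :
  measurable_fun setT f -> (forall p, 0 <= f p) ->
  \int[P]_w f (w, V w) = \int[P]_w \int[Q]_z f (w, z).
Proof.
move=> mf f0.
have -> : \int[P]_w f (w, V w) = \int[distribution P pairm]_p f p.
  by rewrite ge0_integral_distribution.
have -> : \int[P]_w \int[Q]_z f (w, z)
    = \int[distribution P idm]_w \int[Q]_z f (w, z).
  rewrite ge0_integral_distribution//.
    exact: (measurable_fun_fubini_tonelli_F (m2 := Q) f mf f0).
  by move=> w; exact: integral_ge0.
rewrite -[RHS](fubini_tonelli1 (m1 := distribution P idm) (m2 := Q) f mf f0).
apply: eq_measure_integral => A mA _.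
exact/esym/product_measure_unique.
Qed.

Lemma freezing_mean0 (f : O * Z -> R) :
  measurable_fun setT f ->
  (forall w, Q.-integrable setT (fun z => (f (w, z))%:E)) ->
  (forall w, \int[Q]_z f (w, z) = 0)%R ->
  P.-integrable setT (fun w => (f (w, V w))%:E) ->
  (\int[P]_w f (w, V w) = 0)%R.
Proof.
move=> mf intQ int0 intP.
have mEf : measurable_fun setT (EFin \o f) by exact/measurable_EFinP.
have posE w : (fun z => (EFin \o f)^\+ (w, z)) = (fun z => (f (w, z))%:E)^\+.
  by apply/funext => z; rewrite !funeposE.
have negE w : (fun z => (EFin \o f)^\- (w, z)) = (fun z => (f (w, z))%:E)^\-.
  by apply/funext => z; rewrite !funenegE.
(* Positive and negative parts are frozen separately; for each fixed [w] their integrals in [z]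
   agree since their difference is the vanishing mean. *)
have pos : \int[P]_w (EFin \o f)^\+ (w, V w) = \int[P]_w (EFin \o f)^\- (w, V w).
  rewrite !ge0_freezing//; [|exact: measurable_funeneg|exact: measurable_funepos].
  apply: eq_integral => w _; rewrite posE negE.
  have fin := integrable_fin_num measurableT
    (integrable_funeneg measurableT (intQ w)).
  have : \int[Q]_z (f (w, z))%:E = 0.
    by rewrite -[LHS]fineK ?integrable_fin_num//; congr EFin; exact: int0.
  by rewrite integralE => int0'; rewrite -[LHS](subeK _ fin) int0' add0e.
have fin := integrable_fin_num measurableT (integrable_funeneg measurableT intP).
rewrite /Rintegral integralE.
have -> : (fun w => (f (w, V w))%:E)^\- = (fun w => (EFin \o f)^\- (w, V w)).
  by apply/funext => w; rewrite !funenegE.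
have -> : (fun w => (f (w, V w))%:E)^\+ = (fun w => (EFin \o f)^\+ (w, V w)).
  by apply/funext => w; rewrite !funeposE.
rewrite pos subee//; move: fin; congr (_ \is a fin_num).
by apply: eq_integral => w _; rewrite !funenegE.
Qed.

End freezing.

Section borel_vectors.
Context {R : realType} {p : nat}.

Let borel := g_sigma_algebraType (@open 'cV[R]_p).

Let rbox (c : 'cV[rat]_p * rat) : set 'cV[R]_p :=
  [set v | forall k, `|v k 0 - ratr (c.1 k 0)| < ratr c.2].

Let open_rbox (U : set 'cV[R]_p) :
  open U -> U = \bigcup_c [set v | rbox c `<=` U /\ rbox c v].
Proof.
move=> oU; apply/seteqP; split=> [v Uv|v [c _ [cU cv]]]; last exact: cU.
have /nbhs_ballP[e /= e0 eU] := open_nbhs_nbhs (conj oU Uv).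
have [r] := rat_in_itvoo (divr_gt0 e0 (ltr0n R 2)); rewrite in_itv/= => /andP[r0 re].
have /choice[q qP] : forall k, exists q : rat, `|v k 0 - ratr q| < ratr r :> R.
  move=> k; have [q] := @rat_in_itvoo R (v k 0) (v k 0 + ratr r) ltac:(lra).
  rewrite in_itv/= => /andP[q1 q2]; exists q.
  by rewrite ltr_norml; lra.
exists (\col_k q k, r) => //; split=> [u /= ur|k /=]; last by rewrite mxE.
apply: eU; split=> // i j; rewrite ord1 /ball/=.
have := ur i; have := qP i; rewrite mxE !ltr_norml => /andP[h1 h2] /andP[h3 h4].
by apply/andP; split; lra.
Qed.

(** Open sets are countable unions of boxes with rational centre and radius, and the preimage of a
    box is a finite intersection of conditions on single coordinates. *)
Lemma borel_measurable_coord {d} {T : measurableType d} (f : T -> 'cV[R]_p) :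
  (forall k, measurable_fun setT (fun w => f w k 0)) ->
  measurable_fun setT (f : T -> borel).
Proof.
move=> mf; apply: (@measurability _ _ _ borel _ _ (@open 'cV[R]_p)) => //.
move=> _ [U oU <-]; rewrite setTI (open_rbox oU) preimage_bigcup.
apply: countable_bigcupT_measurable => // c.
have [cU|cU] := pselect (rbox c `<=` U); last first.
  by rewrite (_ : _ @^-1` _ = set0)//; apply/seteqP; split=> w //= [].
have -> : f @^-1` [set v | rbox c `<=` U /\ rbox c v] = f @^-1` rbox c.
  by apply/seteqP; split=> w //= [].
have -> : f @^-1` rbox c =
    \bigcap_(k in [set: 'I_p])
      (fun w => `|f w k 0 - ratr (c.1 k 0)|) @^-1` `]-oo, ratr c.2[.
  by apply/seteqP; split=> w /= h k => [_|]; have := h k; rewrite /= in_itv/=; [|exact].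
apply: fin_bigcap_measurable => // k _; rewrite -[X in measurable X]setTI.
by apply: measurableT_comp => //; exact: measurable_funB.
Qed.

Lemma open_borel (U : set 'cV[R]_p) : open U -> measurable (U : set borel).
Proof. exact: sub_sigma_algebra. Qed.

Lemma closed_borel (U : set 'cV[R]_p) : closed U -> measurable (U : set borel).
Proof.
move=> cU; rewrite -[U]setCK; apply: measurableC; apply: open_borel.
exact: closed_openC.
Qed.

Lemma lower_semicontinuous_borel (f : 'cV[R]_p -> \bar R) :
  lower_semicontinuous f -> measurable_fun setT (f : borel -> \bar R).
Proof.
move=> /lower_semicontinuousP lf.
apply: (measurability _ (ErealGenOInfty.measurableE R)) => _ [_ [a ->] <-].
by rewrite setTI preimage_itvoy; apply: open_borel; exact: lf.
Qed.

End borel_vectors.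

(** * Independence of one draw from all the others *)

Section independent_draws.
Context {R : realType} {d m n : nat}.
Variables (pb : fcco R d m n) (S B T : nat).
Context {dO : measure_display} {Omega : measurableType dO}.
Variable Pr : probability Omega R.
Variable D : draws pb B T Omega.
Hypothesis proper : proper_draws S Pr D.

Definition other_draws (k0 : @draw_index n B T) : set (set Omega) :=
  \bigcup_(k in [set k | k != k0]) draw_events D k.

Let events_measurable k A : draw_events D k A -> measurable A.
Proof. by have [h _ _ _ _] := proper; exact: h. Qed.

Let events_setT k : draw_events D k setT.
Proof.
case: k => [t|[[[t i] c] b]] /=; first by exists setT => //; rewrite preimage_setT.
by exists setT; [exact: measurableT|rewrite preimage_setT setTI].
Qed.

Let events_setI k A A' :
  draw_events D k A -> draw_events D k A' -> draw_events D k (A `&` A').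
Proof.
case: k => [t|[[[t i] c] b]] /= [E mE <-] [E' mE' <-].
  by exists (E `&` E') => //; rewrite preimage_setI.
by exists (E `&` E'); [exact: measurableI|rewrite preimage_setI setIACA setIid].
Qed.

Lemma other_draws_measurable k0 : <<s other_draws k0 >> `<=` measurable.
Proof.
apply: smallest_sub; first exact: sigma_algebra_measurable.
by move=> A [k _]; exact: events_measurable.
Qed.

(** A pi-system argument. Intersections of one event per draw, trivial at [k0], are stable under
    intersection, generate the other draws, and satisfy the product formula by hypothesis; the
    finite measures [A |-> Pr (A and E)] and [Pr E * Pr] agree on them, hence on the generated
    sigma-algebra. *)
Lemma other_draws_independent k0 A E :
  <<s other_draws k0 >> A -> draw_events D k0 E ->
  (Pr (A `&` E) = Pr A * Pr E)%E.
Proof.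
move=> sA dE; have mE := events_measurable dE.
pose Pi := [set A | exists F : @draw_index n B T -> set Omega,
  [/\ forall k, draw_events D k (F k), F k0 = setT & A = \bigcap_k F k]].
have PiT : Pi setT.
  by exists (fun=> setT); split=> //; rewrite bigcap_const//; exists k0.
have PiI : setI_closed Pi.
  move=> _ _ [F [dF F0 ->]] [F' [dF' F'0 ->]].
  exists (fun k => F k `&` F' k); split=> [k||]; first exact: events_setI.
    by rewrite F0 F'0 setIid.
  by rewrite bigcapI.
have Pi_measurable : Pi `<=` measurable.
  move=> _ [F [dF _ ->]]; apply: fin_bigcap_measurable => // k _.
  exact: events_measurable (dF k).
have indepPi A' : Pi A' -> (Pr (A' `&` E) = Pr A' * Pr E)%E.
  move=> [F [dF F0 ->]]; have [_ _ _ _ ind] := proper.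
  pose F' k := if k == k0 then E else F k.
  have -> : \bigcap_k F k `&` E = \bigcap_k F' k.
    apply/seteqP; split=> [w [wF wE] k _|w wF'].
      by rewrite /F'; case: eqP => // _; exact: wF.
    split=> [k _|]; last by have := wF' k0 I; rewrite /F' eqxx.
    have := wF' k I; rewrite /F'; case: eqP => // -> _.
    by rewrite F0.
  rewrite !ind//; last by move=> k; rewrite /F'; case: eqP => [->|].
  rewrite -[Pr E]fineK ?fin_num_measure// -EFinM; congr EFin.
  rewrite (bigD1 k0)//= [in RHS](bigD1 k0)//= F0 probability_setT mul1r /F' eqxx.
  rewrite mulrC; congr (_ * _); apply: eq_bigr => k /negbTE -> //.
have sub : other_draws k0 `<=` Pi.
  move=> A' [k kk0 dA']; exists (fun j => if j == k then A' else setT); split.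
  - by move=> j; case: eqP => [->|_].
  - by rewrite eq_sym (negbTE kk0).
  - apply/seteqP; split=> [w wA' j _|w /(_ k I)]; last by rewrite eqxx.
    by case: eqP.
have sA' : <<s Pi >> A by exact: sub_smallest2r sA.
pose e := NngNum (fine_ge0 (measure_ge0 Pr E)).
have eE : (e%:num%:E = Pr E)%E by rewrite /= fineK ?fin_num_measure.
have : mrestr Pr mE A = mscale e Pr A.
  apply: (g_sigma_algebra_measure_unique Pi Pi_measurable (fun=> setT)) => //.
  - by rewrite bigcup_const//; exists 0%N.
  - move=> A' PA'; transitivity (Pr A' * Pr E)%E; first exact: indepPi.
    by rewrite muleC -[in LHS]eE.
  - move=> _; exact: (le_lt_trans
      (probability_le1 Pr (measurableI _ _ measurableT mE)) (ltry _)).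
by move=> h; rewrite muleC -[in RHS]eE; exact: h.
Qed.

End independent_draws.

(** * Integrable real functions on a probability space *)

Section real_integrable.
Context {d : measure_display} {T : measurableType d} {R : realType}.
Variable P : probability T R.
Implicit Types f g : T -> R.

Definition rintegrable f := P.-integrable setT (EFin \o f).

Lemma rintegrable_measurable f : rintegrable f -> measurable_fun setT f.
Proof. by move=> /measurable_int /measurable_EFinP. Qed.

Lemma rintegrable_cst k : rintegrable (fun=> k).
Proof. exact: finite_measure_integrable_cst. Qed.

Lemma rintegrableD f g : rintegrable f -> rintegrable g ->
  rintegrable (fun w => f w + g w).
Proof. exact: integrableD. Qed.

Lemma rintegrableZ k f : rintegrable f -> rintegrable (fun w => k * f w).
Proof. exact: integrableZl. Qed.

Lemma rintegrableN f : rintegrable f -> rintegrable (fun w => - f w).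
Proof.
by move=> /(rintegrableZ (-1)); under eq_fun do rewrite mulN1r.
Qed.

Lemma rintegrableB f g : rintegrable f -> rintegrable g ->
  rintegrable (fun w => f w - g w).
Proof. by move=> fi /rintegrableN; exact: rintegrableD. Qed.

Lemma rintegrable_sum I (s : seq I) (Q : pred I) (h : I -> T -> R) :
  (forall i, Q i -> rintegrable (h i)) ->
  rintegrable (fun w => \sum_(i <- s | Q i) h i w).
Proof.
move=> hi; elim: s => [|i s ih].
  by under eq_fun do rewrite big_nil; exact: rintegrable_cst.
have [Qi|/negbTE Qi] := boolP (Q i).
  under eq_fun do rewrite big_cons Qi.
  by apply: rintegrableD => //; exact: hi.
by under eq_fun do rewrite big_cons Qi.
Qed.

Lemma rintegrable_le f g : measurable_fun setT f ->
  (forall w, `|f w| <= g w) -> rintegrable g -> rintegrable f.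
Proof.
move=> mf fg; apply: le_integrable => //; first exact/measurable_EFinP.
by move=> w _; rewrite lee_fin (le_trans (fg w))// ler_norm.
Qed.

Lemma rintegrable_sqr f : measurable_fun setT f ->
  rintegrable (fun w => f w ^+ 2) -> rintegrable f.
Proof.
move=> mf fi; apply: (rintegrable_le mf) (rintegrableD (rintegrable_cst 1) fi).
by move=> w; rewrite ler_norml; nra.
Qed.

Lemma rintegrable_prod f g : measurable_fun setT f -> measurable_fun setT g ->
  rintegrable (fun w => f w ^+ 2) -> rintegrable (fun w => g w ^+ 2) ->
  rintegrable (fun w => f w * g w).
Proof.
move=> mf mg fi gi; apply: rintegrable_le (rintegrableD fi gi).
  exact: measurable_funM.
by move=> w; rewrite ler_norml; nra.
Qed.

Lemma rintegrable_bounded_mul f g k : measurable_fun setT f ->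
  (forall w, `|f w| <= k) -> rintegrable g -> rintegrable (fun w => f w * g w).
Proof.
move=> mf fk gi; apply: rintegrable_le (rintegrableZ k (integrable_abse gi)).
  by apply: measurable_funM => //; exact: rintegrable_measurable.
by move=> w; rewrite normrM ler_wpM2r.
Qed.

Lemma expectD f g : rintegrable f -> rintegrable g ->
  \int[P]_w (f w + g w) = \int[P]_w f w + \int[P]_w g w.
Proof. exact: RintegralD. Qed.

Lemma expectB f g : rintegrable f -> rintegrable g ->
  \int[P]_w (f w - g w) = \int[P]_w f w - \int[P]_w g w.
Proof. exact: RintegralB. Qed.

Lemma expectZ k f : rintegrable f ->
  \int[P]_w (k * f w) = k * \int[P]_w f w.
Proof. exact: RintegralZl. Qed.

Lemma expect_cst k : \int[P]_(w in setT) k = k.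
Proof.
rewrite Rintegral_cst//; have /(congr1 fine)/= -> := probability_setT P.
by rewrite mulr1.
Qed.

Lemma expect_sum I (s : seq I) (Q : pred I) (h : I -> T -> R) :
  (forall i, Q i -> rintegrable (h i)) ->
  \int[P]_w (\sum_(i <- s | Q i) h i w) = \sum_(i <- s | Q i) \int[P]_w h i w.
Proof.
move=> hi; elim: s => [|i s ih].
  by rewrite big_nil; under eq_Rintegral do rewrite big_nil; rewrite expect_cst.
rewrite big_cons; have [Qi|/negbTE Qi] := boolP (Q i).
  under eq_Rintegral do rewrite big_cons Qi.
  by rewrite expectD ?ih//; [exact: hi|exact: rintegrable_sum].
by under eq_Rintegral do rewrite big_cons Qi.
Qed.

Lemma expect_le f g : rintegrable f -> rintegrable g ->
  (forall w, f w <= g w) -> \int[P]_w f w <= \int[P]_w g w.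
Proof. by move=> fi gi fg; apply: le_Rintegral. Qed.

Lemma expect_EFin f : rintegrable f ->
  (\int[P]_w (f w)%:E = (\int[P]_w f w)%:E)%E.
Proof. by move=> fi; rewrite /Rintegral fineK// integrable_fin_num. Qed.

Lemma rintegrable_ge0 f (k : R) : measurable_fun setT f ->
  (forall w, 0 <= f w) -> (\int[P]_w (f w)%:E <= k%:E)%E ->
  rintegrable f /\ \int[P]_w f w <= k.
Proof.
move=> mf f0 fk; have fi : rintegrable f.
  apply/integrableP; split; first exact/measurable_EFinP.
  under eq_integral do rewrite /= ger0_norm//.
  by rewrite (le_lt_trans fk)// ltry.
by split=> //; rewrite -lee_fin -expect_EFin.
Qed.

End real_integrable.

(** The integral of a nonnegative function is a supremum over simple functions below it, hence
    monotone whatever the measurability. This matters for the noise assumption, whose integrands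
    contain [dual_norm] and [op_norm] and are not assumed measurable. *)
Lemma ge0_le_integral_nonmeasurable {d} {T : measurableType d} {R : realType}
    (mu : {measure set T -> \bar R}) (f g : T -> \bar R) :
  (forall w, 0 <= f w)%E -> (forall w, f w <= g w)%E ->
  (\int[mu]_w f w <= \int[mu]_w g w)%E.
Proof.
move=> f0 fg; have g0 w : (0 <= g w)%E by exact: le_trans (fg w).
rewrite !ge0_integralTE//; apply: le_ereal_sup => _ [h hf <-].
by exists h => // w; exact: le_trans (fg w).
Qed.

Lemma measurable_fun_Rintegral {d d'} {T : measurableType d}
    {Z : measurableType d'} {R : realType} (Q : probability Z R)
    (f : T * Z -> R) :
  measurable_fun setT f -> measurable_fun setT (fun w => \int[Q]_z f (w, z)).
Proof.
move=> mf; have mEf : measurable_fun setT (EFin \o f) by exact/measurable_EFinP.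
apply: (measurableT_comp (fine_measurable measurableT)).
have -> : (fun w => \int[Q]_z (f (w, z))%:E)%E
    = (fun w => (fubini_F Q (EFin \o f)^\+ w - fubini_F Q (EFin \o f)^\- w)%E).
  apply/funext => w; rewrite integralE /fubini_F; congr (_ - _)%E.
    by apply: eq_integral => z _; rewrite !funeposE.
  by apply: eq_integral => z _; rewrite !funenegE.
apply: emeasurable_funB.
  by apply: (measurable_fun_fubini_tonelli_F (m2 := Q)) => //; exact: measurable_funepos.
by apply: (measurable_fun_fubini_tonelli_F (m2 := Q)) => //; exact: measurable_funeneg.
Qed.

(** From [(a - b)^2 <= 2 a^2 + 2 b^2] and [(1 + theta)^2 <= 4]. *)
Lemma sqr_extrapolation_le {R : realDomainType} (theta p q : R) :
  0 <= theta <= 1 ->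
  ((1 + theta) * p - theta * q) ^+ 2 <= 8 * p ^+ 2 + 2 * q ^+ 2.
Proof.
move=> /andP[t0 t1].
have h1 : ((1 + theta) * p) ^+ 2 <= 4 * p ^+ 2.
  by rewrite exprMn ler_wpM2r ?sqr_ge0//; nra.
have h2 : (theta * q) ^+ 2 <= q ^+ 2.
  by rewrite exprMn ler_piMl ?sqr_ge0//; nra.
move: h1 h2; move: (_ * p) (theta * q) => p' q' h1 h2.
by have := sqr_ge0 (p' + q'); nra.
Qed.

Lemma measurable_id_sigma {T : pointedType} (G G' : set (set T)) :
  G' `<=` <<s G >> ->
  measurable_fun setT (id : g_sigma_algebraType G -> g_sigma_algebraType G').
Proof.
move=> G'G; apply: (@measurability _ _ _ (g_sigma_algebraType G') _ _ G') => //.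
by move=> _ [A GA <-]; rewrite setTI; exact: G'G.
Qed.

(** * The past, single draws, and averaging over the outer batch *)

Section draws.
Context {R : realType} {d m n : nat}.
Variables (pb : fcco R d m n) (S B T : nat).
Context {dO : measure_display} {Omega : measurableType dO}.
Variable Pr : probability Omega R.
Variable D : draws pb B T Omega.
Hypothesis proper : proper_draws S Pr D.

Definition past t : set (set Omega) :=
  \bigcup_(k in [set k | (draw_time k < t)%N]) draw_events D k.

Definition draw (t : 'I_T) i (c : bool) (b : 'I_B) : Omega -> sample pb i :=
  if c then batch' D t i b else batch D t i b.

Lemma past_le (s t : nat) : (s <= t)%N -> past s `<=` <<s past t >>.
Proof.
move=> st A [k /= ks dA]; apply: sub_sigma_algebra; exists k => //=.
exact: leq_trans ks st.
Qed.

Lemma past_other (t : nat) k : (t <= draw_time k)%N ->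
  past t `<=` <<s other_draws D k >>.
Proof.
move=> tk A [j /= jt dA]; apply: sub_sigma_algebra; exists j => //=.
by apply: contraTneq jt => ->; rewrite -leqNgt.
Qed.

Lemma past_measurable t : past t `<=` measurable.
Proof. by move=> A [k _]; have [h _ _ _ _] := proper; exact: h. Qed.

Lemma measurable_draw_other t i c b k : inr (t, i, c, b) != k ->
  measurable_fun setT
    (draw t i c b : g_sigma_algebraType (other_draws D k) -> sample pb i).
Proof.
move=> kk _ A mA; rewrite setTI; apply: sub_sigma_algebra.
exists (inr (t, i, c, b)) => //=; exists A => //.
by rewrite setTI /draw; case: c {kk}.
Qed.

Lemma measurable_draw t i c b : measurable_fun setT (draw t i c b).
Proof.
move=> _ A mA; have [h _ _ _ _] := proper; apply: (h (inr (t, i, c, b))).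
by exists A => //; rewrite /draw; case: c.
Qed.

Lemma draw_law t i c b A : measurable A ->
  Pr (draw t i c b @^-1` A) = law pb i A.
Proof.
move=> mA; have [_ _ h h' _] := proper; rewrite /draw; case: c.
  exact: h'.
exact: h.
Qed.

Lemma draw_independent t i c b A E :
  <<s other_draws D (inr (t, i, c, b)) >> A -> measurable E ->
  (Pr (A `&` draw t i c b @^-1` E) = Pr A * law pb i E)%E.
Proof.
move=> sA mE; rewrite (other_draws_independent proper sA) ?draw_law//.
by exists E => //; rewrite setTI /draw; case: c {sA}.
Qed.

Lemma past_sigma_measurable t : <<s past t >> `<=` measurable.
Proof.
by apply: smallest_sub; [exact: sigma_algebra_measurable|exact: past_measurable].
Qed.

Lemma measurable_past t {d'} {U : measurableType d'} (f : Omega -> U) :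
  measurable_fun setT (f : g_sigma_algebraType (past t) -> U) ->
  measurable_fun setT f.
Proof.
by move=> mf _ A mA; have := mf measurableT _ mA; exact: past_sigma_measurable.
Qed.

Lemma measurable_other k {d'} {U : measurableType d'} (f : Omega -> U) :
  measurable_fun setT (f : g_sigma_algebraType (other_draws D k) -> U) ->
  measurable_fun setT f.
Proof.
move=> mf _ A mA; have := mf measurableT _ mA.
exact: (other_draws_measurable proper).
Qed.

Section outer_batch.
Variable t : 'I_T.

Let O := g_sigma_algebraType (other_draws D (inl t)).

Definition batch_prob (A : {set 'I_n}) : R :=
  if #|A| == S then ('C(n, S)%:R)^-1 else 0.

Let hit A (w : Omega) : bool := outer_batch D t w == A.

Let hit_event A (E : set bool) : draw_events D (inl t) (hit A @^-1` E).
Proof. by exists [set C | E (C == A)]. Qed.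

Let measurable_hit A : measurable_fun setT (hit A).
Proof.
by move=> _ E mE; rewrite setTI; have [h _ _ _ _] := proper; apply: h (hit_event A E).
Qed.

Let hitm A : {mfun Omega >-> bool} :=
  HB.pack (hit A) (isMeasurableFun.Build _ _ _ _ _ (measurable_hit A)).

Let measurable_nat_of_bool : measurable_fun setT (fun b : bool => b%:R : R).
Proof. by []. Qed.

Let measurable_hitR A : measurable_fun setT (fun w => (hit A w)%:R : R).
Proof. exact: (measurableT_comp measurable_nat_of_bool (measurable_hit A)). Qed.

Let rintegrable_hit A : rintegrable Pr (fun w => (hit A w)%:R).
Proof.
apply: rintegrable_le (rintegrable_cst Pr 1) => // w.
by case: (hit A w); rewrite ?normr1 ?normr0.
Qed.

Let expect_hit A : \int[Pr]_w ((hit A w)%:R : R) = batch_prob A.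
Proof.
have [_ h _ _ _] := proper; rewrite /batch_prob.
transitivity (fine (Pr (outer_batch D t @^-1` [set A]))); last by rewrite h.
congr fine; rewrite -[in RHS](setIT (_ @^-1` _)) -integral_indic//.
  apply: eq_integral => w _; rewrite indicE.
  suff -> : (w \in outer_batch D t @^-1` [set A]) = hit A w by [].
  by apply/idP/eqP; rewrite inE.
have [h' _ _ _ _] := proper; apply: (h' (inl t)).
by exists [set A].
Qed.

(** Summing over the finitely many values [A] of the batch leaves products of the indicator of [A]
    with [F A]; the latter is a function of the other draws, so each expectation factorizes. *)
Lemma expect_outer_batch (F : {set 'I_n} -> Omega -> R) :
  (forall A, rintegrable Pr (F A)) ->
  (forall A, measurable_fun setT (F A : O -> R)) ->
  rintegrable Pr (fun w => F (outer_batch D t w) w) /\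
  \int[Pr]_w F (outer_batch D t w) w = \sum_A batch_prob A * \int[Pr]_w F A w.
Proof.
move=> Fi mF.
have FE : (fun w => F (outer_batch D t w) w) = (fun w => \sum_A (hit A w)%:R * F A w).
  apply/funext => w; rewrite (bigD1 (outer_batch D t w))//= /hit eqxx mul1r.
  rewrite big1 ?addr0// => A /negbTE; rewrite eq_sym => ->.
  by rewrite mul0r.
have hFi A : rintegrable Pr (fun w => (hit A w)%:R * F A w).
  apply: (rintegrable_bounded_mul (k := 1)) => // w.
  by case: (hit A w); rewrite ?normr1 ?normr0.
split; first by rewrite FE; exact: rintegrable_sum.
rewrite FE expect_sum//; apply: eq_bigr => A _.
(* The indicator is centred so that [freezing_mean0] applies; the vanishing of the mean is the
   factorization sought. *)
pose f (p : O * bool) : R := (p.2%:R - batch_prob A) * F A p.1.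
have mf : measurable_fun setT f.
  apply: measurable_funM; last exact: (measurableT_comp (mF A) measurable_fst).
  apply: measurable_funB => //.
  exact: (measurableT_comp measurable_nat_of_bool measurable_snd).
have intQ w : rintegrable (distribution Pr (hitm A)) (fun b : bool => f (w, b)).
  apply: rintegrable_le (rintegrable_cst _ (`|f (w, true)| + `|f (w, false)|)).
    by [].
  by case; rewrite ?lerDl ?lerDr.
have intQ0 w : \int[distribution Pr (hitm A)]_b f (w, b) = 0.
  have nb : rintegrable (distribution Pr (hitm A)) (fun b : bool => b%:R : R).
    apply: rintegrable_le (rintegrable_cst _ 1) => //.
    by case; rewrite ?normr1 ?normr0.
  rewrite /f/=; under eq_Rintegral do rewrite mulrC.
  rewrite expectZ; last by apply: rintegrableB => //; exact: rintegrable_cst.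
  rewrite expectB//; last exact: rintegrable_cst.
  rewrite expect_cst; have -> : \int[distribution Pr (hitm A)]_b (b%:R : R) = batch_prob A.
    rewrite -expect_hit; congr fine; rewrite integral_distribution//.
    exact: rintegrable_hit.
  by rewrite subrr mulr0.
have ind E (E' : set bool) : <<s other_draws D (inl t) >> E -> measurable E' ->
    (Pr (E `&` hit A @^-1` E') = Pr E * distribution Pr (hitm A) E')%E.
  by move=> sE _; rewrite (other_draws_independent proper sE (hit_event A E')).
have fi : rintegrable Pr (fun w => f (w, hit A w)).
  rewrite /f/=; under eq_fun do rewrite mulrBl.
  by apply: rintegrableB => //; exact: rintegrableZ.
have := freezing_mean0 (other_draws_measurable proper (k0 := inl t))
  (measurable_hit A) ind mf intQ intQ0 fi.
rewrite /f/=; under eq_Rintegral do rewrite mulrBl.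
rewrite expectB//; last exact: rintegrableZ.
by rewrite expectZ// => /eqP; rewrite subr_eq0 => /eqP.
Qed.

End outer_batch.
End draws.

(** * Mean and variance of mini-batch averages *)

Section minibatch.
Context {R : realType} {d m n : nat}.
Variables (pb : fcco R d m n) (S B T : nat).
Context {dO : measure_display} {Omega : measurableType dO}.
Variable Pr : probability Omega R.
Variable D : draws pb B T Omega.
Hypothesis proper : proper_draws S Pr D.
Hypothesis B0 : (0 < B)%N.
Variables (t : 'I_T) (i : 'I_n) (c : bool).

Let Past := g_sigma_algebraType (past D t).
Let Z b := draw D t i c b.

Variables (phi : Omega -> sample pb i -> R) (V : Omega -> R).
Hypothesis mphi :
  measurable_fun setT (fun p : Past * sample pb i => phi p.1 p.2).
Hypothesis phi_mean0 : forall w, \int[law pb i]_z phi w z = 0.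
Hypothesis phi_sqr :
  forall w, (\int[law pb i]_z (phi w z ^+ 2)%:E <= (V w)%:E)%E.
Hypothesis Vi : rintegrable Pr V.

Let mphi_other k : (t <= draw_time k)%N -> measurable_fun setT
  (fun p : g_sigma_algebraType (other_draws D k) * sample pb i => phi p.1 p.2).
Proof.
move=> tk; pose O := g_sigma_algebraType (other_draws D k).
have mfst : @measurable_fun _ _ (O * sample pb i)%type Past setT fst.
  have mid := measurable_id_sigma (past_other (D := D) tk).
  exact: (measurableT_comp mid measurable_fst).
exact: (measurableT_comp mphi (measurable_fun_pair mfst measurable_snd)).
Qed.

Lemma measurable_draw_phi b k : inr (t, i, c, b) != k -> (t <= draw_time k)%N ->
  measurable_fun setT ((fun w => phi w (Z b w))
    : g_sigma_algebraType (other_draws D k) -> R).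
Proof.
move=> bk tk; have mZ := measurable_draw_other (D := D) bk.
exact: (measurableT_comp (mphi_other tk)
  (measurable_fun_pair (@measurable_id _ _ setT) mZ)).
Qed.

Let mphi_draw b : measurable_fun setT (fun w => phi w (Z b w)).
Proof. exact: (measurable_other proper (measurable_draw_phi (k := inl t) _ _)). Qed.

Let phi_sections w : rintegrable (law pb i) (phi w).
Proof.
have mw : measurable_fun setT (phi w).
  have mcst := @measurable_cst _ _ (sample pb i) Past setT w.
  exact: (measurableT_comp mphi (measurable_fun_pair mcst (@measurable_id _ _ setT))).
apply: (rintegrable_sqr mw).
have mw2 : measurable_fun setT (fun z => phi w z ^+ 2) by exact: measurable_funX.
exact: (rintegrable_ge0 mw2 (fun z => sqr_ge0 _) (phi_sqr w)).1.
Qed.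

Let mZ b : measurable_fun setT (Z b).
Proof. exact: (measurable_draw proper). Qed.

Let indZ b A E : <<s other_draws D (inr (t, i, c, b)) >> A -> measurable E ->
  (Pr (A `&` Z b @^-1` E) = Pr A * law pb i E)%E.
Proof. by move=> sA mE; rewrite /Z (draw_independent proper sA mE). Qed.

Let phi_draw_sqr b : rintegrable Pr (fun w => phi w (Z b w) ^+ 2) /\
  \int[Pr]_w (phi w (Z b w) ^+ 2) <= \int[Pr]_w V w.
Proof.
apply: rintegrable_ge0; [exact: measurable_funX|by move=> w; exact: sqr_ge0|].
pose k : @draw_index n B T := inr (t, i, c, b).
have mf : measurable_fun setT
    (fun p : g_sigma_algebraType (other_draws D k) * sample pb i =>
       (phi p.1 p.2 ^+ 2)%:E).
  by apply/measurable_EFinP; apply: measurable_funX; exact: mphi_other.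
rewrite (ge0_freezing (other_draws_measurable proper (k0 := k))
  (mZ b) (@indZ b) mf)/=; last first.
  by move=> p; rewrite lee_fin sqr_ge0.
rewrite -expect_EFin//; apply: ge0_le_integral_nonmeasurable => // w.
by apply: integral_ge0 => z _; rewrite lee_fin sqr_ge0.
Qed.

Let phi_draw_int b : rintegrable Pr (fun w => phi w (Z b w)).
Proof. exact: rintegrable_sqr (mphi_draw b) (phi_draw_sqr b).1. Qed.

Let phi_draw_mean0 b : \int[Pr]_w phi w (Z b w) = 0.
Proof.
pose k : @draw_index n B T := inr (t, i, c, b).
exact: (freezing_mean0 (other_draws_measurable proper (k0 := k))
  (mZ b)
  (@indZ b)
  (mphi_other (k := k) (leqnn _)) phi_sections phi_mean0 (phi_draw_int b)).
Qed.

Let phi_draw_prod b b' : rintegrable Pr (fun w => phi w (Z b w) * phi w (Z b' w)).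
Proof. by apply: rintegrable_prod => //; exact: (phi_draw_sqr _).1. Qed.

(** With every draw but [b'] frozen, the first factor is a constant and the second has mean zero. *)
Let phi_draw_orthogonal b b' : b != b' ->
  \int[Pr]_w (phi w (Z b w) * phi w (Z b' w)) = 0.
Proof.
move=> bb'; pose k : @draw_index n B T := inr (t, i, c, b').
have bk : inr (t, i, c, b) != k by apply: contra bb' => /eqP[->].
pose f (p : g_sigma_algebraType (other_draws D k) * sample pb i) : R :=
  phi p.1 (Z b p.1) * phi p.1 p.2.
have mf : measurable_fun setT f.
  apply: measurable_funM; last exact: mphi_other.
  exact: (measurableT_comp (measurable_draw_phi bk (leqnn _)) measurable_fst).
apply: (freezing_mean0 (other_draws_measurable proper (k0 := k))
  (mZ b')
  (@indZ b') mf) => [w|w|].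
- exact: (rintegrableZ (phi w (Z b w)) (phi_sections w)).
- by rewrite /f/= (expectZ (phi w (Z b w)) (phi_sections w)) phi_mean0 mulr0.
- exact: phi_draw_prod.
Qed.

Definition batch_mean w := B%:R^-1 * \sum_b phi w (Z b w).

Lemma batch_mean_measurable :
  measurable_fun setT
    (batch_mean : g_sigma_algebraType (other_draws D (inl t)) -> R).
Proof.
apply: measurable_funM => //; apply: measurable_sum => b.
exact: measurable_draw_phi.
Qed.

Lemma batch_mean_integrable : rintegrable Pr batch_mean.
Proof. by apply: rintegrableZ; exact: rintegrable_sum. Qed.

Lemma batch_mean_mean0 : \int[Pr]_w batch_mean w = 0.
Proof.
rewrite expectZ; last exact: rintegrable_sum.
by rewrite expect_sum// big1 ?mulr0.
Qed.

Let batch_mean_sqrE : (fun w => batch_mean w ^+ 2) =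
  (fun w => B%:R^-1 ^+ 2 * \sum_b \sum_b' phi w (Z b w) * phi w (Z b' w)).
Proof.
apply/funext => w; rewrite exprMn; congr (_ * _).
by rewrite expr2 mulr_suml; apply: eq_bigr => b _; rewrite mulr_sumr.
Qed.

Lemma batch_mean_sqr_integrable : rintegrable Pr (fun w => batch_mean w ^+ 2).
Proof.
rewrite batch_mean_sqrE; apply: rintegrableZ; apply: rintegrable_sum => b _.
by apply: rintegrable_sum => b' _.
Qed.

(** Only the [B] diagonal products survive, against the factor [B^-2]. *)
Lemma batch_mean_variance :
  \int[Pr]_w (batch_mean w ^+ 2) <= B%:R^-1 * \int[Pr]_w V w.
Proof.
have -> : \int[Pr]_w (batch_mean w ^+ 2) =
    B%:R^-1 ^+ 2 * \sum_b \int[Pr]_w (phi w (Z b w) ^+ 2).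
  rewrite batch_mean_sqrE expectZ; last first.
    by apply: rintegrable_sum => b _; exact: rintegrable_sum.
  congr (_ * _); rewrite expect_sum => [|b _]; last exact: rintegrable_sum.
  apply: eq_bigr => b _; rewrite expect_sum// (bigD1 b)//= big1 ?addr0//.
  by move=> b' bb'; rewrite phi_draw_orthogonal// eq_sym.
rewrite expr2 -mulrA ler_wpM2l ?invr_ge0//.
rewrite ler_pdivrMl ?ltr0n//.
apply: le_trans (ler_sum _ (fun b _ => (phi_draw_sqr b).2)) _.
by rewrite sumr_const card_ord mulr_natl.
Qed.

End minibatch.

(** * Sampling a subset of fixed size uniformly, without replacement *)

Section uniform_batches.
Context {R : realType} {n S : nat}.
Hypothesis Sn : (0 < S <= n)%N.

Local Notation prob := (batch_prob (R := R) S).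

Let S0 : S%:R != 0 :> R. Proof. by rewrite pnatr_eq0 -lt0n; case/andP: Sn. Qed.

Let n0 : n%:R != 0 :> R.
Proof.
by rewrite pnatr_eq0 -lt0n; case/andP: Sn => Sp SN; exact: leq_trans Sp SN.
Qed.

Lemma batch_prob_ge0 (A : {set 'I_n}) : 0 <= prob A.
Proof. by rewrite /batch_prob; case: ifP; rewrite ?invr_ge0. Qed.

Lemma batch_prob_sum1 : \sum_(A : {set 'I_n}) prob A = 1.
Proof.
rewrite /batch_prob -big_mkcond/= sumr_const.
have -> : #|[pred A : {set 'I_n} | #|A| == S]| = 'C(n, S).
  by rewrite -[in RHS](card_ord n) -card_draws; apply: eq_card => A; rewrite !inE.
rewrite -[_^-1 *+ _]mulr_natr mulVf// pnatr_eq0 -lt0n bin_gt0.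
by case/andP: Sn.
Qed.

Let prob_imset (s : {perm 'I_n}) (A : {set 'I_n}) : prob (s @: A) = prob A.
Proof. by rewrite /batch_prob card_imset//; exact: perm_inj. Qed.

Let sum_imset (s : {perm 'I_n}) (F : {set 'I_n} -> R) :
  \sum_(A : {set 'I_n}) F (s @: A) = \sum_A F A.
Proof.
rewrite [RHS](reindex_inj (h := fun A : {set 'I_n} => s @: A))//=.
exact: (imset_inj (@perm_inj _ s)).
Qed.

(** Inclusion probabilities of one block and, in [incl2], of a pair. Invariance under permutations
    determines the first, and shows that the second is the same for all pairs of distinct blocks. *)
Let incl i := \sum_(A : {set 'I_n}) prob A * (i \in A)%:R.
Let incl2 i j := \sum_(A : {set 'I_n}) prob A * (i \in A)%:R * (j \in A)%:R.

Let mem_perm (s : {perm 'I_n}) (A : {set 'I_n}) i : (i \in s @: A) = (s^-1 i \in A)%g.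
Proof. by rewrite -{1}[i](permKV s) mem_imset//; exact: perm_inj. Qed.

Let incl_perm (s : {perm 'I_n}) i : incl (s i) = incl i.
Proof.
rewrite /incl -(sum_imset s); apply: eq_bigr => A _.
by rewrite prob_imset mem_perm permK.
Qed.

Let incl2_perm (s : {perm 'I_n}) i j : incl2 (s i) (s j) = incl2 i j.
Proof.
rewrite /incl2 -(sum_imset s); apply: eq_bigr => A _.
by rewrite prob_imset !mem_perm !permK.
Qed.

(** Transpositions make all inclusion probabilities equal, and they add up to the expected size [S]
    of the batch. *)
Let inclE i : incl i = S%:R / n%:R.
Proof.
have incl_eq j : incl j = incl i.
  by rewrite -[RHS](incl_perm (tperm i j)) tpermL.
have : \sum_j incl j = S%:R.
  transitivity (S%:R * \sum_(A : {set 'I_n}) prob A); last first.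
    by rewrite batch_prob_sum1 mulr1.
  rewrite /incl exchange_big/= mulr_sumr.
  apply: eq_bigr => A _; transitivity (prob A * #|A|%:R).
    rewrite -sum1_card natr_sum mulr_sumr [RHS]big_mkcond.
    by apply: eq_bigr => j _; case: (j \in A); rewrite ?mulr0.
  rewrite /batch_prob; case: eqP => [->|_]; last by rewrite mul0r mulr0.
  by rewrite mulrC.
under eq_bigr do rewrite incl_eq; rewrite sumr_const card_ord => <-.
by rewrite -[incl i *+ n]mulr_natl mulrAC mulfV// mul1r.
Qed.

Let incl2_ge0 i j : 0 <= incl2 i j.
Proof. by apply: sumr_ge0 => A _; rewrite !mulr_ge0 ?batch_prob_ge0. Qed.

Let incl2C i j : incl2 i j = incl2 j i.
Proof. by apply: eq_bigr => A _; rewrite mulrAC. Qed.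

Let incl2_moveR i j l : i != j -> i != l -> incl2 i l = incl2 i j.
Proof.
by move=> ij il; rewrite -(incl2_perm (tperm j l) i j) tpermL tpermD// eq_sym.
Qed.

Let incl2_const : exists2 r, 0 <= r & forall i j, i != j -> incl2 i j = r.
Proof.
have [[[i j] /= ij]|no_pair] := pselect (exists p : 'I_n * 'I_n, p.1 != p.2).
  exists (incl2 i j) => // k l kl.
  have [li|li] := eqVneq l i.
    by rewrite incl2C li; apply: incl2_moveR; rewrite // -li eq_sym.
  rewrite -(incl2_moveR ij (l := l)) 1?eq_sym// [RHS]incl2C incl2C.
  by apply: incl2_moveR; rewrite // eq_sym.
(* Without two distinct blocks any value will do. *)
exists 0 => // i j ij; exfalso; apply: no_pair; by exists (i, j).
Qed.

Lemma batch_average_mean (c : 'I_n -> R) :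
  \sum_(A : {set 'I_n}) prob A * (S%:R^-1 * \sum_(i in A) c i) = n%:R^-1 * \sum_i c i.
Proof.
transitivity (S%:R^-1 * \sum_i incl i * c i).
  under [in RHS]eq_bigr do rewrite mulr_suml.
  rewrite exchange_big/= mulr_sumr; apply: eq_bigr => A _.
  rewrite mulrCA; congr (_ * _); rewrite mulr_sumr big_mkcond.
  by apply: eq_bigr => i _; case: (i \in A); rewrite ?mulr1 ?mulr0 ?mul0r.
under eq_bigr do rewrite inclE; rewrite -mulr_sumr mulrA.
by congr (_ * _); rewrite mulrA mulVf// mul1r.
Qed.

(** With a common pair probability [r], the double sum is [S/n - r] times the sum of squares plus
    [r] times the square of the sum. The latter is zero, and [r >= 0] gives the bound known from
    independent sampling. *)
Lemma batch_average_variance p (z : 'I_n -> 'cV[R]_p) : \sum_i z i = 0 ->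
  \sum_(A : {set 'I_n}) prob A * dot (S%:R^-1 *: \sum_(i in A) z i)
                      (S%:R^-1 *: \sum_(i in A) z i)
  <= S%:R^-1 * (n%:R^-1 * \sum_i dot (z i) (z i)).
Proof.
move=> z0; have [r r0 rE] := incl2_const.
have -> : \sum_(A : {set 'I_n}) prob A * dot (S%:R^-1 *: \sum_(i in A) z i)
    (S%:R^-1 *: \sum_(i in A) z i)
    = S%:R^-1 ^+ 2 * \sum_i \sum_j incl2 i j * dot (z i) (z j).
  transitivity (S%:R^-1 ^+ 2 * \sum_(A : {set 'I_n}) \sum_i \sum_j
      prob A * (i \in A)%:R * (j \in A)%:R * dot (z i) (z j)).
    rewrite mulr_sumr; apply: eq_bigr => A _.
    rewrite dotZl dotZr (mulrA S%:R^-1) -expr2 mulrCA; congr (_ * _).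
    rewrite dot_suml mulr_sumr big_mkcond; apply: eq_bigr => i _.
    case: (i \in A); last by rewrite big1// => j _; rewrite mulr0 !mul0r.
    rewrite dot_sumr mulr_sumr big_mkcond; apply: eq_bigr => j _.
    by case: (j \in A); rewrite !mulr1 ?mulr0 ?mul0r.
  congr (_ * _); rewrite exchange_big; apply: eq_bigr => i _.
  rewrite exchange_big; apply: eq_bigr => j _.
  by rewrite /incl2 mulr_suml.
have -> : \sum_i \sum_j incl2 i j * dot (z i) (z j)
    = (S%:R / n%:R - r) * \sum_i dot (z i) (z i).
  transitivity (\sum_i ((S%:R / n%:R - r) * dot (z i) (z i)
      + r * dot (z i) (\sum_j z j))).
    apply: eq_bigr => i _; rewrite dot_sumr.
    rewrite (bigD1 i)//= [in RHS](bigD1 i)//= mulrDr.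
    have -> : incl2 i i = S%:R / n%:R.
      rewrite -(inclE i); apply: eq_bigr => A _.
      by case: (i \in A); rewrite ?mulr1 ?mulr0.
    rewrite mulrBl addrA subrK; congr (_ + _).
    rewrite [RHS]mulr_sumr; apply: eq_bigr => j ji.
    by rewrite rE// eq_sym.
  rewrite z0; under eq_bigr do rewrite dot0r mulr0 addr0.
  by rewrite [RHS]mulr_sumr.
have s0 : 0 <= \sum_i dot (z i) (z i) by apply: sumr_ge0 => i _; exact: dot_ge0.
apply: (@le_trans _ _ (S%:R^-1 ^+ 2 * (S%:R / n%:R * \sum_i dot (z i) (z i)))).
  by rewrite ler_wpM2l ?sqr_ge0// ler_wpM2r// lerBlDr lerDl.
rewrite le_eqVlt; apply/orP; left; apply/eqP; field.
by rewrite S0 n0.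
Qed.

End uniform_batches.

(** The factor [k] is moved to the measurable side [f], because [h] is not assumed measurable and
    only monotonicity is at hand for its integral. *)
Lemma ge0_expect_scale {d} {Z : measurableType d} {R : realType}
    (Q : probability Z R) (f h : Z -> R) (k s : R) :
  0 < k -> measurable_fun setT f -> (forall z, 0 <= f z) ->
  (forall z, f z <= k * h z) -> (\int[Q]_z (h z)%:E <= s%:E)%E ->
  rintegrable Q f /\ \int[Q]_z f z <= k * s.
Proof.
move=> k0 mf f0 fh hs; apply: rintegrable_ge0 => //.
have fE : (\int[Q]_z (f z)%:E = k%:E * \int[Q]_z (k^-1 * f z)%:E)%E.
  rewrite -ge0_integralZl//.
  - apply: eq_integral => z _.
    by rewrite -EFinM mulrA mulfV ?mul1r// gt_eqF.
  - by apply/measurable_EFinP; exact: measurable_funM.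
  - by move=> z _; rewrite lee_fin mulr_ge0// invr_ge0 ltW.
  - by rewrite lee_fin ltW.
rewrite fE EFinM lee_pmul2l ?lte_fin//.
apply: le_trans hs; apply: ge0_le_integral_nonmeasurable => z.
  by rewrite lee_fin mulr_ge0// invr_ge0 ltW.
by rewrite lee_fin ler_pdivrMl.
Qed.

(** * Second moments of the oracle noise, entry by entry *)

Section oracle_moments.
Context {R : realType} {d m n : nat} (N : 'cV[R]_m -> R).
Context (sigma0 sigma1 delta : R) (pb : fcco R d m n) (A : R).
Hypothesis oracle : well_posed_oracle pb.
Hypothesis noise : assumption_noise pb N sigma0 sigma1 delta.
Hypotheses (A1 : 1 <= A) (l2_le_dual : forall u, l2norm u <= A * dual_norm N u)
  (frob_le_op : forall q (M : 'M[R]_(q, m)), frobenius M <= A * op_norm N M ^+ 2).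
Variables (i : 'I_n) (x : 'cV[R]_d).
Hypothesis Xx : xdom pb x.

Let A0 : 0 < A. Proof. exact: lt_le_trans A1. Qed.

Definition inner_noise k z := sinner pb i x z k 0 - inner pb i x k 0.

Definition jac_noise k j z := sjac pb i x z k j - jac pb i x k j.

Let sinner_int k : rintegrable (law pb i) (fun z => sinner pb i x z k 0).
Proof. by have [_ _ h _] := oracle i; exact: h. Qed.

Let sjac_int k j : rintegrable (law pb i) (fun z => sjac pb i x z k j).
Proof. by have [_ _ _ h] := oracle i; exact: h. Qed.

Lemma inner_noise_mean0 k : \int[law pb i]_z inner_noise k z = 0.
Proof.
rewrite /inner_noise expectB//; last exact: rintegrable_cst.
by rewrite expect_cst /inner mxE subrr.
Qed.

Lemma jac_noise_mean0 k j : \int[law pb i]_z jac_noise k j z = 0.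
Proof.
rewrite /jac_noise expectB//; last exact: rintegrable_cst.
by rewrite expect_cst /jac mxE subrr.
Qed.

Lemma inner_noise_integrable k : rintegrable (law pb i) (inner_noise k).
Proof. by apply: rintegrableB => //; exact: rintegrable_cst. Qed.

Lemma jac_noise_integrable k j : rintegrable (law pb i) (jac_noise k j).
Proof. by apply: rintegrableB => //; exact: rintegrable_cst. Qed.

Lemma inner_noise_sqr k :
  rintegrable (law pb i) (fun z => inner_noise k z ^+ 2) /\
  \int[law pb i]_z (inner_noise k z ^+ 2) <= A ^+ 2 * sigma0 ^+ 2.
Proof.
have [h _ _] := noise; apply: (ge0_expect_scale _ _ _ _ (h i x Xx)).
- by rewrite exprn_gt0.
- by apply: measurable_funX; exact: rintegrable_measurable (inner_noise_integrable k).
- by move=> z; exact: sqr_ge0.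
move=> z; rewrite -exprMn.
apply: le_trans (ler_sqrW (l2norm_ge0 _) (l2_le_dual _)).
rewrite l2norm_sqr; apply: le_trans (sqr_coord_le _ k).
have -> : (inner pb i x - sinner pb i x z) k 0 = - inner_noise k z.
  by rewrite /inner_noise opprB mxE [X in _ + X]mxE.
by rewrite sqrrN.
Qed.

Lemma jac_noise_sqr k j :
  rintegrable (law pb i) (fun z => jac_noise k j z ^+ 2) /\
  \int[law pb i]_z (jac_noise k j z ^+ 2) <= A * sigma1 ^+ 2.
Proof.
have [_ h _] := noise; apply: (ge0_expect_scale _ _ _ _ (h i x Xx)) => //.
- by apply: measurable_funX; exact: rintegrable_measurable (jac_noise_integrable k j).
- by move=> z; exact: sqr_ge0.
move=> z; apply: le_trans (frob_le_op _).
rewrite /frobenius (bigD1 j)//= (bigD1 k)//= -addrA.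
have -> : ((jac pb i x)^T - (sjac pb i x z)^T) j k = - jac_noise k j z.
  by rewrite /jac_noise opprB mxE [X in X + _]mxE [X in _ + X]mxE [X in - X]mxE.
rewrite sqrrN lerDl addr_ge0//; apply: sumr_ge0 => *.
  exact: sqr_ge0.
by apply: sumr_ge0 => *; exact: sqr_ge0.
Qed.

End oracle_moments.
Arguments inner_noise {R d m n pb} i x k z.
Arguments jac_noise {R d m n pb} i x k j z.

Lemma normr_average_le {R : realFieldType} {I : finType} (Q : pred I) (k : nat)
    (a : I -> R) (M : R) : (0 < k)%N -> #|Q| = k ->
  (forall i, Q i -> `|a i| <= M) -> `|k%:R^-1 * \sum_(i | Q i) a i| <= M.
Proof.
move=> k0 Qk aM; rewrite normrM ger0_norm ?invr_ge0//.
rewrite ler_pdivrMl ?ltr0n//; apply: le_trans (ler_norm_sum _ _ _) _.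
by apply: le_trans (ler_sum _ aM) _; rewrite sumr_const Qk mulr_natl.
Qed.

(** Complete the square in [2 F G - eta b / 2]. The summand [0] takes the place of [cs], to match
    the shape of [drift_bound]. *)
Lemma drift_young {R : realFieldType} (F G b eta p q r : R) : 0 < eta -> 0 <= r ->
  - (F * (G * b)) <= p -> q <= F * (G * b) ->
  - (4 * F ^+ 2 * G ^+ 2 / eta + (eta / 4 + 0) * b ^+ 2 + r) <= p - q.
Proof.
move=> eta0 r0 hp hq.
have h : 2 * (F * (G * b)) <= 4 * F ^+ 2 * G ^+ 2 / eta + eta / 4 * b ^+ 2.
  rewrite -subr_ge0.
  have -> : 4 * F ^+ 2 * G ^+ 2 / eta + eta / 4 * b ^+ 2 - 2 * (F * (G * b)) =
      (2 * F * G - eta / 2 * b) ^+ 2 / eta by field; rewrite gt_eqF.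
  by rewrite divr_ge0 ?sqr_ge0// ltW.
by rewrite addr0; lra.
Qed.

(** [err / (1 - q)] is the fixed point of [z |-> q z + err]. The move term is consumed with half of
    the weight [2 * c] stored in the potential, so [q >= 1/2] suffices for it; the noise [v1 * gap]
    is counted in the contraction of the gap. *)
Lemma descent_contraction {R : realFieldType}
    (q P a b k k' c v0 v1 w err gap div mv : R) :
  2^-1 <= q < 1 -> 0 <= gap -> 0 <= div -> 0 <= mv -> 0 <= c ->
  b + v1 <= q * a -> k' <= q * k -> err = v0 + w ->
  a * gap + k * div + 2 * c * mv <= P + err / (1 - q) ->
  b * gap + c * mv + k' * div + (v0 + v1 * gap) + w <= q * P + err / (1 - q).
Proof.
move=> /andP[q2 q1] gap0 div0 mv0 c0 hb hk errE bnd.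
have q0 : 0 <= q by apply: le_trans q2; rewrite invr_ge0.
have e1 : err / (1 - q) = q * (err / (1 - q)) + err.
  have : 1 - q != 0 by rewrite gt_eqF// subr_gt0.
  by move=> ?; field.
have h1 := ler_wpM2r gap0 hb; have h2 := ler_wpM2r div0 hk.
have h3 : c * mv <= q * (2 * c * mv).
  have := ler_wpM2r (mulr_ge0 c0 mv0) q2.
  have -> : q * (2 * c * mv) = 2 * (q * (c * mv)) by ring.
  by rewrite ler_pdivrMl.
have h4 := ler_wpM2l q0 bnd.
move: e1 h4; set z := err / _ => e1; rewrite errE in e1; rewrite !mulrDr; lra.
Qed.

(** * Arithmetic of the step sizes, with [e] for [1 - theta] *)

Section step_sizes.
Context {R : realFieldType}.
Variables (mu theta e S n B rho c : R).
Hypotheses (mu0 : 0 < mu) (S1 : 1 <= S) (n1 : 1 <= n) (B1 : 1 <= B)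
  (rho0 : 0 < rho) (c0 : 0 < c).

Let eta : R := mu * theta / e.
Let tau : R := S / (n * e).

Hypotheses (thetaE : theta = 1 - e) (e0 : 0 < e) (e_half : e * 2 <= 1).

Let S0 : 0 < S. Proof. exact: lt_le_trans S1. Qed.
Let n0 : 0 < n. Proof. exact: lt_le_trans n1. Qed.
Let B0 : 0 < B. Proof. exact: lt_le_trans B1. Qed.
Let e1 : e != 0. Proof. by rewrite gt_eqF. Qed.

(** The reason for this choice of [eta]: it makes [eta = theta * (eta + mu)], so that without noise
    the gap contracts by [theta]. *)
Lemma step_size_mu : eta + mu = mu / e.
Proof. by rewrite /eta thetaE; field. Qed.

Let eta_ge : mu / (2 * e) <= eta.
Proof.
have -> : eta = mu / e - mu by rewrite -step_size_mu addrK.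
rewrite -subr_ge0.
have -> : mu / e - mu - mu / (2 * e) = mu * (1 - e * 2) / (2 * e) by field.
by rewrite divr_ge0// mulr_ge0 ?subr_ge0 ?(ltW mu0) ?(ltW e0).
Qed.

Lemma eta_gt0 : 0 < eta.
Proof. by apply: lt_le_trans eta_ge; rewrite divr_gt0// mulr_gt0. Qed.

Lemma eta_inv_le : eta^-1 <= 2 * e / mu.
Proof.
rewrite -[leRHS]invrK lef_pV2 ?posrE ?eta_gt0 ?invr_gt0 ?divr_gt0 ?mulr_gt0//.
by rewrite invfM invrK mulrC.
Qed.

Lemma eta_large K : e * (16 * K) <= mu -> K <= eta / 8.
Proof.
move=> h; rewrite ler_pdivlMr//; apply: le_trans eta_ge.
by rewrite ler_pdivlMr ?mulr_gt0//; apply: le_trans h; rewrite le_eqVlt;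
  apply/orP; left; apply/eqP; ring.
Qed.

Variable kap : R.
Hypotheses (kap_half : kap <= 2^-1) (kap_rho : kap <= rho / 4) (kap0 : 0 < kap).

(** A step gains [rho / 2] on the fraction [S / n] of the blocks. Against the main part
    [tau / S = 1 / (n * e)] of the weight this is a relative gain of [e * rho / 2]; half of it
    covers [kap <= rho / 4], the other half the part [rho / (2 * S)] of the weight. *)
Lemma dual_contraction : e * n <= 1 ->
  S^-1 * (tau + rho / 2) - n^-1 * (rho / 2)
    <= (1 - kap * e) * (S^-1 * (tau + rho / 2)).
Proof.
move=> en; rewrite -subr_ge0.
have -> : (1 - kap * e) * (S^-1 * (tau + rho / 2))
    - (S^-1 * (tau + rho / 2) - n^-1 * (rho / 2))
  = n^-1 * (rho / 2 - kap - kap * (e * n) * S^-1 * (rho / 2)).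
  by rewrite /tau; field; rewrite !gt_eqF.
apply: mulr_ge0; first by rewrite invr_ge0 ltW.
have Sv : S^-1 <= 1 by rewrite invf_le1.
have Sv0 : 0 < S^-1 by rewrite invr_gt0.
have en0 : 0 < e * n by rewrite mulr_gt0.
have h1 : kap * (e * n) <= 2^-1.
  by rewrite -[leRHS]mulr1 ler_pM// ltW.
have h2 : kap * (e * n) * S^-1 <= 2^-1.
  by rewrite -[leRHS]mulr1 ler_pM// ltW// mulr_gt0.
have h3 : kap * (e * n) * S^-1 * (rho / 2) <= 2^-1 * (rho / 2).
  by rewrite ler_wpM2r// divr_ge0// ltW.
move: h3 kap_rho; lra.
Qed.

Let dual_weight : (2 * tau * c)^-1 = n * e / (2 * c * S).
Proof. by rewrite /tau; field; rewrite !gt_eqF. Qed.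

(** Passing from [eta] to [eta + mu] gains [mu / 2]. At most half of it goes into the rate, since
    [kap <= 1/2], and [mu / 4] is left for the Jacobian noise that multiplies the gap. *)
Lemma primal_contraction V : 0 <= V -> e * (2 * n * V / c) <= mu ->
  eta / 2 + B^-1 * ((2 * tau * c)^-1 * V) <= (1 - kap * e) * ((eta + mu) / 2).
Proof.
move=> V0 h; rewrite step_size_mu dual_weight.
have h1 : B^-1 * (n * e / (2 * c * S) * V) <= mu / 4.
  have -> : B^-1 * (n * e / (2 * c * S) * V) =
      (B^-1 * S^-1) * (e * (2 * n * V / c) / 4).
    by field; rewrite !gt_eqF.
  rewrite -[leRHS]mul1r; apply: ler_pM.
  - by rewrite mulr_ge0// invr_ge0 ltW.
  - by rewrite !mulr_ge0 ?invr_ge0// ltW.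
  - by rewrite -[leRHS]mulr1 ler_pM ?invf_le1 ?invr_ge0// ltW.
  - by rewrite ler_wpM2r.
have -> : (1 - kap * e) * (mu / e / 2) = mu / e / 2 - kap * mu / 2 by field.
have -> : eta / 2 = mu / e / 2 - mu / 2.
  by rewrite -mulrBl -step_size_mu addrK.
have h2 : kap * mu <= 2^-1 * mu by rewrite ler_wpM2r// ltW.
move: h1 h2; lra.
Qed.

(** The weight of the divergences is of order [1 / e], but it is finally divided by that of the gap,
    [mu / (2 * e)]; the bound here is uniform in [e]. *)
Lemma initial_weight : e * (S^-1 * (tau + rho / 2)) <= n^-1 + rho / 2.
Proof.
have -> : e * (S^-1 * (tau + rho / 2)) = n^-1 + (e * S^-1) * (rho / 2).
  by rewrite /tau; field; rewrite !gt_eqF.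
rewrite lerD2l -[leRHS]mul1r ler_wpM2r ?divr_ge0 ?(ltW rho0)//.
rewrite -[leRHS]mulr1 ler_pM ?invf_le1 ?invr_ge0 ?(ltW S0) ?(ltW e0)//.
by move: e_half e0; lra.
Qed.

(** Origin of the rate: [1 / tau = n * e / S] turns the value noise [V0 / B] into [n / (B * S)], and
    [1 / eta <= 2 * e / mu] turns the Jacobian noise [V1 / B] into [1 / (mu * B)] and the drift into
    [W / mu]. All terms carry one factor [e]. *)
Lemma noise_level V0 V1 F W w rate : 0 <= V0 -> 0 <= V1 -> 0 <= W ->
  n / (B * S) <= rate -> (mu * B)^-1 <= rate -> W / mu <= w * rate ->
  B^-1 * ((2 * tau * c)^-1 * V0 + 2 * F ^+ 2 / eta * V1) + W / eta
    <= (V0 / (2 * c) + 4 * F ^+ 2 * V1 + 2 * w) * rate * e.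
Proof.
move=> V00 V10 W0 r1 r2 r3; rewrite dual_weight.
have -> : (V0 / (2 * c) + 4 * F ^+ 2 * V1 + 2 * w) * rate * e =
  V0 / (2 * c) * e * rate + 4 * F ^+ 2 * V1 * e * rate + 2 * e * (w * rate) by ring.
rewrite mulrDr; apply: lerD; first apply: lerD.
- have -> : B^-1 * (n * e / (2 * c * S) * V0) = V0 / (2 * c) * e * (n / (B * S)).
    by field; rewrite !gt_eqF.
  by rewrite ler_wpM2l// mulr_ge0 ?divr_ge0 ?mulr_ge0 ?(ltW c0)// ltW.
- apply: (@le_trans _ _ (4 * F ^+ 2 * V1 * e * (mu * B)^-1)).
    have -> : 4 * F ^+ 2 * V1 * e * (mu * B)^-1 =
        B^-1 * (2 * F ^+ 2 * (2 * e / mu) * V1).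
      by field; rewrite !gt_eqF.
    rewrite ler_wpM2l ?invr_ge0 ?(ltW B0)// ler_wpM2r//.
    by rewrite ler_wpM2l ?eta_inv_le// mulr_ge0// sqr_ge0.
  by rewrite ler_wpM2l// mulr_ge0 ?(ltW e0)// mulr_ge0// mulr_ge0// sqr_ge0.
- apply: (@le_trans _ _ (2 * e * (W / mu))); last first.
    by rewrite ler_wpM2l// mulr_ge0// ltW.
  have -> : 2 * e * (W / mu) = W * (2 * e / mu) by field; rewrite gt_eqF.
  by rewrite ler_wpM2l// eta_inv_le.
Qed.

End step_sizes.

(** * Runs of the algorithm *)

Section run.
Context {R : realType} {d m : nat} (N : 'cV[R]_m -> R).
Context (Cg Cf sigma0 sigma1 delta Lf mupsi rho : R) (n S B : nat) (mu : R).
Context (pb : fcco R d m n) (psi : 'I_n -> 'cV[R]_m -> \bar R).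
Context (x0 : 'cV[R]_d) (y0 s0 : 'I_n -> 'cV[R]_m) (xs : 'cV[R]_d).
Context (A : R).
Hypotheses (Cg0 : 0 < Cg) (Cf0 : 0 < Cf) (Lf0 : 0 < Lf) (mupsi0 : 0 < mupsi)
  (rho0 : 0 < rho).
Hypothesis st : alexr_setting N Cg Cf sigma0 sigma1 delta Lf mupsi rho
  S B mu pb psi x0 y0 s0 xs.
Hypotheses (A1 : 1 <= A) (l2_le_N : forall u, l2norm u <= A * N u)
  (dual_le_l2 : forall u, dual_norm N u <= A * l2norm u)
  (l2_le_dual : forall u, l2norm u <= A * dual_norm N u)
  (frob_le_op : forall q (M : 'M[R]_(q, m)), frobenius M <= A * op_norm N M ^+ 2).
Context (T : nat) (eta tau theta : R).
Hypotheses (eta0 : 0 < eta) (tau0 : 0 < tau) (theta01 : 0 < theta < 1).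
Context {dO : measure_display} {Omega : measurableType dO}.
Context (Pr : probability Omega R) (D : draws pb B T Omega).
Context (tr : trajectory R d m n Omega).
Hypothesis run : alexr_run psi x0 y0 s0 S eta tau theta Pr D tr.
Hypothesis optimal : optimal_subgradients psi tau theta rho D tr.
Context (ys : 'I_n -> 'cV[R]_m).
Hypothesis ysP : forall i,
  [/\ ydom pb i (ys i), conjugate (outer pb i) (ys i) \is a fin_num &
      outer pb i (inner pb i xs) =
        dot (ys i) (inner pb i xs) - fine (conjugate (outer pb i) (ys i))].

Let X := xdom pb.
Let g := inner pb.
Let J := jac pb.
Let x t w := primal tr t w.
Let y t i w := dual tr t i w.
Let s t i w := dual_subgrad tr t i w.
Let proper := run_draws run.
Let A0 : 0 < A. Proof. exact: lt_le_trans A1. Qed.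
Let psiN i v : (-oo < psi i v)%E. Proof. by have [h _ _ _] := set_dgf st i. Qed.
Let Xs : X xs := minimizer_dom st.
Let B0 : (0 < B)%N := set_inner_size st.

Lemma primal_in t w : (t <= T)%N -> X (x t w).
Proof.
case: t => [_|t tT]; first by rewrite /x (run_x0 run); exact: set_x0 st.
by have [] := run_primal run (Ordinal tT) w.
Qed.

Lemma dual_in t i w : (t <= T)%N ->
  ydom pb i (y t i w) /\ esubgradient (psi i) (y t i w) (s t i w).
Proof.
elim: t => [_|t ih tT].
  rewrite /y /s (run_y0 run) (run_s0 run).
  by split; [exact: set_y0 st i|exact: set_s0 st i].
have [iS|iS] := boolP (i \in outer_batch D (Ordinal tT) w).
  split; first by have [] := run_dual run iS.
  exact: run_subgrad run _ _ _ iS.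
have [yE sE] := run_dual_idle run iS.
by rewrite /y /s yE sE; exact: ih (ltnW tT).
Qed.

Lemma psi_optimum_fin i : psi i (ys i) \is a fin_num.
Proof.
have [_ _ _ [dom _]] := set_dgf st i; have [Yy fy _] := ysP i.
rewrite fin_numElt psiN; apply: dom => //.
by move: fy; rewrite fin_numElt => /andP[].
Qed.

Definition divergence t i w : R :=
  fine (psi i (ys i)) - fine (psi i (y t i w)) - dot (s t i w) (ys i - y t i w).

(** The strong convexity modulus of the [psi i] in Euclidean norm, already halved: [A ^+ 2] is the
    price of leaving the norm [N]. *)
Definition cpsi : R := mupsi / (2 * A ^+ 2).

Lemma cpsi_gt0 : 0 < cpsi.
Proof. by rewrite divr_gt0// mulr_gt0// exprn_gt0. Qed.

Lemma divergence_ge t i w : (t <= T)%N ->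
  cpsi * dot (ys i - y t i w) (ys i - y t i w) <= divergence t i w.
Proof.
move=> tT; have [Yy sub] := dual_in i w tT; have [Yys _ _] := ysP i.
exact: (bregman_lower mupsi0 st A1 l2_le_N Yys Yy (psi_optimum_fin i) sub).
Qed.

Lemma divergence_ge0 t i w : (t <= T)%N -> 0 <= divergence t i w.
Proof.
move=> /(divergence_ge i w); apply: le_trans.
by rewrite mulr_ge0 ?dot_ge0// ltW// cpsi_gt0.
Qed.

(** Compactness of the dual domains. The constant serves integrability and does not enter the rate;
    the bound by [Cf] does not cover [y0], at which the conjugate may be infinite. *)
Lemma dual_bounded : exists2 C, 0 < C &
  forall t i w k, (t <= T)%N -> `|y t i w k 0| <= C /\ `|ys i k 0| <= C.
Proof.
have bnd i : exists2 C, 0 < C & forall v k, ydom pb i v -> `|v k 0| <= C.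
  have [/compact_bounded[M [_ hM]] _ _] := set_dual st i.
  exists (`|M| + 1) => [|v k Yv]; first by rewrite ltr_pwDr.
  have : `|v| <= `|M| + 1 by apply: (hM (`|M| + 1)) => //; have := ler_norm M; lra.
  apply: le_trans; rewrite [leRHS]/Num.norm/= mx_normrE.
  by apply: (le_bigmax _ (fun ij : 'I_m * 'I_1 => `|v ij.1 ij.2|) (k, 0)).
have [Cb CbP] := choice (fun i => let: ex_intro2 C C0 h := bnd i in
  ex_intro (fun C => 0 < C /\ forall v k, ydom pb i v -> `|v k 0| <= C) C (conj C0 h)).
exists (1 + \sum_i Cb i).
  by rewrite ltr_pwDl// sumr_ge0// => i _; have [/ltW] := CbP i.
have le_Cb i : Cb i <= 1 + \sum_i Cb i.
  rewrite (bigD1 i)//= addrCA lerDl addr_ge0// sumr_ge0// => j _.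
  by have [/ltW] := CbP j.
move=> t i w k tT; have [_ h] := CbP i.
have [Yy _] := dual_in i w tT; have [Yys _ _] := ysP i.
by split; apply: le_trans (le_Cb i); exact: h.
Qed.

(** * Measurability of the iterates and of the noise with respect to the past *)

Section measurability.
Variables (t t' : nat).
Hypotheses (t't : (t' <= t)%N) (tT : (t <= T)%N).

Let Past := g_sigma_algebraType (past D t).

Let adapted_past (h : nat -> Omega -> R) : adapted D h ->
  measurable_fun setT (h t' : Past -> R).
Proof.
move=> ah; have mh : measurable_fun setT
    (h t' : g_sigma_algebraType (past D t') -> R).
  by move=> _ E mE; rewrite setTI; apply: ah => //; exact: leq_trans tT.
exact: (measurableT_comp mh (measurable_id_sigma (past_le (D := D) t't))).
Qed.

Lemma measurable_primal k : measurable_fun setT ((fun w => x t' w k 0) : Past -> R).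
Proof. exact: (adapted_past (run_x_adapted run k)). Qed.

Lemma measurable_dual i k :
  measurable_fun setT ((fun w => y t' i w k 0) : Past -> R).
Proof. exact: (adapted_past (run_y_adapted run i k)). Qed.

Lemma measurable_subgrad i k :
  measurable_fun setT ((fun w => s t' i w k 0) : Past -> R).
Proof. exact: (adapted_past (run_s_adapted run i k)). Qed.

Lemma measurable_divergence i :
  measurable_fun setT ((fun w => divergence t' i w) : Past -> R).
Proof.
have [_ lsc _ _] := set_dgf st i.
apply: measurable_funB; last first.
  apply: measurable_sum => k; apply: measurable_funM.
    exact: measurable_subgrad.
  have -> : (fun w => (ys i - y t' i w) k 0) = (fun w => ys i k 0 - y t' i w k 0).
    by apply/funext => w; rewrite !mxE.
  by apply: measurable_funB => //; exact: measurable_dual.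
apply: measurable_funB => //.
have my := borel_measurable_coord (fun k => measurable_dual i k).
have mpsi := measurableT_comp (fine_measurable measurableT)
  (measurableT_comp (lower_semicontinuous_borel lsc) my).
exact: mpsi.
Qed.

Lemma measurable_sinner i k : measurable_fun setT
  (fun p : Past * sample pb i => sinner pb i (x t' p.1) p.2 k 0).
Proof.
have [ms _ _ _] := set_oracle st i.
have [cX _ _ _ _] := set_reg st.
have mx := borel_measurable_coord measurable_primal.
have mpair := measurable_fun_pair (measurableT_comp mx measurable_fst)
  (@measurable_snd _ _ Past (sample pb i)).
apply: (measurable_comp _ _ (ms k) mpair).
  by apply: measurableX => //; exact: closed_borel.
by move=> _ [p _ <-]; split=> //=; apply: primal_in; exact: leq_trans tT.
Qed.

Lemma measurable_sjac i k j : measurable_fun setT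
  (fun p : Past * sample pb i => sjac pb i (x t' p.1) p.2 k j).
Proof.
have [_ ms _ _] := set_oracle st i.
have [cX _ _ _ _] := set_reg st.
have mx := borel_measurable_coord measurable_primal.
have mpair := measurable_fun_pair (measurableT_comp mx measurable_fst)
  (@measurable_snd _ _ Past (sample pb i)).
apply: (measurable_comp _ _ (ms k j) mpair).
  by apply: measurableX => //; exact: closed_borel.
by move=> _ [p _ <-]; split=> //=; apply: primal_in; exact: leq_trans tT.
Qed.

Lemma measurable_inner i k :
  measurable_fun setT ((fun w => g i (x t' w) k 0) : Past -> R).
Proof.
have := measurable_fun_Rintegral (law pb i) (@measurable_sinner i k).
by apply: eq_measurable_fun => w _ /=; rewrite /g mxE.
Qed.

Lemma measurable_jac i k j :
  measurable_fun setT ((fun w => J i (x t' w) k j) : Past -> R).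
Proof.
have := measurable_fun_Rintegral (law pb i) (@measurable_sjac i k j).
by apply: eq_measurable_fun => w _ /=; rewrite /J mxE.
Qed.

Lemma measurable_inner_noise i k : measurable_fun setT
  (fun p : Past * sample pb i => inner_noise i (x t' p.1) k p.2).
Proof.
apply: measurable_funB; first exact: measurable_sinner.
exact: (measurableT_comp (@measurable_inner i k) measurable_fst).
Qed.

Lemma measurable_jac_noise i k j : measurable_fun setT
  (fun p : Past * sample pb i => jac_noise i (x t' p.1) k j p.2).
Proof.
apply: measurable_funB; first exact: measurable_sjac.
exact: (measurableT_comp (@measurable_jac i k j) measurable_fst).
Qed.

End measurability.

Let F := A * Cf.
Let G := A * Cg.
Let F0 : 0 <= F. Proof. by rewrite mulr_ge0// ltW. Qed.
Let G0 : 0 <= G. Proof. by rewrite mulr_ge0// ltW. Qed.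

Definition primal_gap t w : R := dot (x t w - xs) (x t w - xs).
Definition primal_move t w : R := dot (x t w - x t.-1 w) (x t w - x t.-1 w).

(** * One step of a run, path by path *)

Section step.
Variable t : 'I_T.

Let tT : (t <= T)%N. Proof. exact: ltnW. Qed.
Let t1T : (t.+1 <= T)%N. Proof. exact: ltn_ord. Qed.
Let tm1T : (t.-1 <= T)%N. Proof. exact: leq_trans (leq_pred t) tT. Qed.

Definition value_noise i w : 'cV[R]_m := gtilde theta D tr t i w
  - (g i (x t w) + theta *: (g i (x t w) - g i (x t.-1 w))).

Definition jac_batch i w : 'M[R]_(m, d) :=
  B%:R^-1 *: \sum_b sjac pb i (x t w) (batch' D t i b w).

Definition jac_error i w : 'M[R]_(m, d) := jac_batch i w - J i (x t w).

(** Known before the outer batch is drawn, so its batch average and its full average have the same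
    expectation. *)
Definition lead i w : R := dot (ys i) (g i (x t w) - g i xs).

(* Pairing the noise with the old dual iterate instead of the new one makes its
   mean given the past vanish; the difference is paid for in [variance]. *)
Definition martingale i w : R := dot (value_noise i w) (ys i - y t i w)
  + dot (y t i w) (jac_error i w *m (x t w - xs)).

Definition variance i w : R :=
  (2 * tau * cpsi)^-1 * dot (value_noise i w) (value_noise i w)
  + (2 * tau * cpsi)^-1 * (frobenius (jac_error i w) * primal_gap t w)
  + 2 * F ^+ 2 / eta * frobenius (jac_error i w).

(* The only place where smooth and non-smooth inner functions differ.  The
   moves of [x] and of the dual iterate that occur here are absorbed by the
   proximal terms. *)
Definition drift_bound (Bt : {set 'I_n}) (W cs : R) w :=
  - (W / eta + (eta / 4 + cs) * primal_move t.+1 w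
     + rho * cpsi / 8 * (S%:R^-1 * \sum_(i in Bt)
         dot (ys i - y t.+1 i w) (ys i - y t.+1 i w)))
  <= S%:R^-1 * \sum_(i in Bt)
       dot (y t.+1 i w) (J i (x t w) *m (x t.+1 w - x t w))
     - n%:R^-1 * \sum_i dot (ys i) (g i (x t.+1 w) - g i (x t w)).

(** The dual step is compared with [ys i], where [g i xs] is a subgradient of the conjugate; this
    replaces the difference of conjugate values by a linear term. *)
Lemma dual_iterate_fin i w : i \in outer_batch D t w ->
  conjugate (outer pb i) (y t.+1 i w) \is a fin_num /\
  dot (y t.+1 i w - ys i) (g i xs)
    + dot (gtilde theta D tr t i w) (ys i - y t.+1 i w)
  <= tau * divergence t i w - (tau + rho) * divergence t.+1 i w
     - tau * (fine (psi i (y t.+1 i w)) - fine (psi i (y t i w))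
              - dot (s t i w) (y t.+1 i w - y t i w)).
Proof.
move=> iS; have [Yys fys fE] := ysP i.
have [_ [fy _]] := dual_in i w tT; have [_ [fyp _]] := dual_in i w t1T.
have [fyp' h] := dual_step_inequality (@conjugate_gtNy _ _ (outer pb i))
  fy fyp (psi_optimum_fin i) fys Yys (optimal iS).
split=> //; apply: le_trans h; rewrite lerD2r.
exact: (dual_optimum_conjugate fE fyp').
Qed.

Lemma pathwise_descent w (W cs : R) :
  #|outer_batch D t w| = S -> drift_bound (outer_batch D t w) W cs w ->
  cs + 4 * G ^+ 2 / (rho * cpsi) <= eta / 8 ->
  (eta + mu) / 2 * primal_gap t.+1 w
    + S%:R^-1 * \sum_(i in outer_batch D t w)
        (tau + rho / 2) * divergence t.+1 i w
    + 4 * G ^+ 2 / (rho * cpsi) * primal_move t.+1 w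
  <= eta / 2 * primal_gap t w
     + S%:R^-1 * \sum_(i in outer_batch D t w) tau * divergence t i w
     + 2 * G ^+ 2 / (rho * cpsi) * primal_move t w + W / eta
     - (S%:R^-1 * \sum_(i in outer_batch D t w) lead i w
        - n%:R^-1 * \sum_i lead i w
        + S%:R^-1 * \sum_(i in outer_batch D t w) martingale i w)
     + S%:R^-1 * \sum_(i in outer_batch D t w) variance i w.
Proof.
move=> cardS drift eta_large.
have [S0 _] := andP (set_outer_size st).
have [_ cX _ _ cr] := set_reg st.
have [t0 t1] := andP theta01.
have theta01' : 0 <= theta <= 1 by rewrite !ltW.
have Xp := primal_in w t1T; have Xx := primal_in w tT.
have Xm := primal_in w tm1T.
have [_ opt] := run_primal run t w.
have [fp prox] := proximal_inequality cX cr (reg_gtNy st) Xp Xs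
  (reg_minimizer_fin st) opt.
have saddle := saddle_point Cg0 Lf0 st A1 dual_le_l2 l2_le_dual ysP Xp fp.
pose dom i : set 'cV[R]_m := [set v | conjugate (outer pb i) v \is a fin_num].
have g_lip i u u' : X u -> X u' -> l2norm (g i u - g i u') <= G * l2norm (u - u').
  exact: (inner_lipschitz st A1 l2_le_dual).
have g_sub i u u' v : dom i v -> X u -> X u' ->
    dot v (g i u) + dot v (J i u *m (u' - u)) <= dot v (g i u').
  exact: (inner_subgradient st).
have dom_le i v : dom i v -> l2norm v <= F.
  exact: (dual_dom_bounded Cf0 st A1 dual_le_l2).
apply: (one_step_descent cpsi_gt0 g_lip g_sub dom_le eta0 tau0 rho0 theta01'
  Xs Xm Xx (ys := ys) (y := fun i => y t i w) (yp := fun i => y t.+1 i w)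
  (nu := fun i => value_noise i w) (Jt := fun i => jac_batch i w)
  (Uo := fun i => divergence t i w) (Un := fun i => divergence t.+1 i w)
  (Ud := fun i => fine (psi i (y t.+1 i w)) - fine (psi i (y t i w))
              - dot (s t i w) (y t.+1 i w - y t i w)) S0 cardS).
- by move=> i iS; have [] := dual_iterate_fin iS.
- by move=> i _; exact: divergence_ge.
- move=> i _; have [Yy sub] := dual_in i w tT.
  have [Yyp [fyp _]] := dual_in i w t1T.
  exact: (bregman_lower mupsi0 st A1 l2_le_N Yyp Yy fyp sub).
- move=> i iS; have [_ h] := dual_iterate_fin iS; apply: le_trans h.
  by rewrite lerD2l /value_noise [_ + (_ - _)]addrC subrK.
(* Adding the proximal and the saddle-point inequalities eliminates the values of the
   regularizer. *)
- move: prox saddle; rewrite /gradient_estimate -/(x t w).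
  rewrite -[xs - x t w]opprB dotNl dotNr opprK => prox saddle.
  rewrite /g; lra.
- exact: drift.
- exact: eta_large.
Qed.

End step.

(** * One step of a run, in expectation *)

Section step_expectation.
Variable t : 'I_T.

Let tT : (t <= T)%N. Proof. exact: ltnW. Qed.
Let tm1t : (t.-1 <= t)%N. Proof. exact: leq_pred. Qed.

Let Past := g_sigma_algebraType (past D t).
Let O := g_sigma_algebraType (other_draws D (inl t)).

(* In particular independent of the outer batch of step [t]. *)
Definition observable (f : Omega -> R) :=
  rintegrable Pr f /\ measurable_fun setT (f : O -> R).

Lemma past_observable f : rintegrable Pr f ->
  measurable_fun setT (f : Past -> R) -> observable f.
Proof.
move=> fi mf; split=> //.
have sub := past_other (D := D) (k := inl t) (leqnn t).
exact: (measurableT_comp mf (measurable_id_sigma sub)).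
Qed.

Lemma observable_cst k : observable (fun=> k).
Proof. by split; [exact: rintegrable_cst|exact: measurable_cst]. Qed.

Lemma observableD f h : observable f -> observable h ->
  observable (fun w => f w + h w).
Proof.
move=> [fi mf] [hi mh]; split; first exact: rintegrableD.
exact: measurable_funD.
Qed.

Lemma observableZ k f : observable f -> observable (fun w => k * f w).
Proof.
move=> [fi mf]; split; first exact: rintegrableZ.
exact: measurable_funM.
Qed.

Lemma observableB f h : observable f -> observable h ->
  observable (fun w => f w - h w).
Proof.
move=> [fi mf] [hi mh]; split; first exact: rintegrableB.
exact: measurable_funB.
Qed.

Lemma observable_sum I (r : seq I) (h : I -> Omega -> R) :
  (forall i, observable (h i)) -> observable (fun w => \sum_(i <- r) h i w).
Proof.
move=> oh; split; first by apply: rintegrable_sum => i _; have [] := oh i.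
by apply: measurable_sum => i; have [] := oh i.
Qed.

Lemma observable_sum_in (K : {set 'I_n}) (h : 'I_n -> Omega -> R) :
  (forall i, observable (h i)) -> observable (fun w => \sum_(i in K) h i w).
Proof.
move=> oh; under eq_fun do rewrite big_mkcond.
by apply: observable_sum => i; case: (i \in K) => //; exact: observable_cst.
Qed.

(** A factor [h] determined by the past is absorbed into [phi], whose variance bound becomes the
    random variable [v * h ^+ 2]. The same statement then covers the bare noise ([h = 1]) and the
    noise multiplied by dual coordinates or by coordinates of [x - xs]. *)
Lemma scaled_batch_mean i c (phi : Omega -> sample pb i -> R) (h : Omega -> R)
    (v : R) :
  let f w := h w * batch_mean D t c phi w in
  measurable_fun setT (fun p : Past * sample pb i => phi p.1 p.2) ->
  (forall w, rintegrable (law pb i) (phi w)) ->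
  (forall w, \int[law pb i]_z phi w z = 0) ->
  (forall w, rintegrable (law pb i) (fun z => phi w z ^+ 2) /\
     \int[law pb i]_z (phi w z ^+ 2) <= v) ->
  measurable_fun setT (h : Past -> R) ->
  rintegrable Pr (fun w => h w ^+ 2) ->
  [/\ observable f, \int[Pr]_w f w = 0, observable (fun w => f w ^+ 2) &
      \int[Pr]_w (f w ^+ 2) <= B%:R^-1 * (v * \int[Pr]_w (h w ^+ 2))].
Proof.
move=> f mphi iphi phi0 phi2 mh h2.
pose phi' w z := h w * phi w z.
have fE : f = batch_mean D t c phi'.
  apply/funext => w; rewrite /f /batch_mean mulrCA; congr (_ * _).
  by rewrite mulr_sumr.
have mphi' : measurable_fun setT (fun p : Past * sample pb i => phi' p.1 p.2).
  apply: measurable_funM => //.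
  exact: (measurableT_comp mh measurable_fst).
have phi'0 w : \int[law pb i]_z phi' w z = 0.
  by rewrite /phi' expectZ// phi0 mulr0.
have phi'2 w : (\int[law pb i]_z (phi' w z ^+ 2)%:E <= (v * h w ^+ 2)%:E)%E.
  have [i2 e2] := phi2 w; rewrite /phi'.
  under eq_integral do rewrite exprMn.
  rewrite expect_EFin; last exact: rintegrableZ.
  by rewrite lee_fin expectZ// mulrC ler_wpM2r ?sqr_ge0.
have Vi : rintegrable Pr (fun w => v * h w ^+ 2) by exact: rintegrableZ.
have mO := batch_mean_measurable c mphi'.
rewrite fE; split.
- by split => //; exact: (batch_mean_integrable proper c mphi' phi'2 Vi).
- exact: (batch_mean_mean0 proper c mphi' phi'0 phi'2 Vi).
- split; last exact: measurable_funX.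
  exact: (batch_mean_sqr_integrable proper c mphi' phi'2 Vi).
- rewrite -expectZ//.
  exact: (batch_mean_variance proper B0 c mphi' phi'0 phi'2 Vi).
Qed.

Let one2 : rintegrable Pr (fun w : Omega => (1 : R) ^+ 2).
Proof. exact: rintegrable_cst. Qed.

Definition value_phi i k w (z : sample pb i) : R :=
  (1 + theta) * inner_noise i (x t w) k z
  - theta * inner_noise i (x t.-1 w) k z.

(** The two evaluations in [gtilde], at the current and at the previous point, share one mini-batch;
    the noise is therefore the batch average of a single function of the sample. *)
Lemma value_noiseE i k w :
  value_noise t i w k 0 = batch_mean D t false (@value_phi i k) w.
Proof.
rewrite /value_noise /gtilde /batch_inner /batch_mean /value_phi.
have coord (a b u v : 'cV[R]_m) :
    (a + theta *: (a - b) - (u + theta *: (u - v))) k 0 =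
    a k 0 + theta * (a k 0 - b k 0) - (u k 0 + theta * (u k 0 - v k 0)).
  by rewrite !mxE.
have avg_coord (h : 'I_B -> 'cV[R]_m) :
    (B%:R^-1 *: \sum_b h b) k 0 = B%:R^-1 * \sum_b h b k 0.
  by rewrite mxE summxE.
rewrite coord !avg_coord.
rewrite /inner_noise -/(x t w) -/(x t.-1 w) /draw.
have Bn0 : B%:R != 0 :> R by rewrite pnatr_eq0 -lt0n.
rewrite sumrB -!mulr_sumr !sumrB !sumr_const card_ord /g.
set u1 := inner pb i (x t w) k 0; set u2 := inner pb i (x t.-1 w) k 0.
rewrite -[u1 *+ B]mulr_natl -[u2 *+ B]mulr_natl.
by field.
Qed.

Lemma jac_errorE i k j w : jac_error t i w k j =
  batch_mean D t true (fun w z => jac_noise i (x t w) k j z) w.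
Proof.
rewrite /jac_error /jac_batch /batch_mean /jac_noise.
rewrite mxE [X in _ + X]mxE [X in X - _]mxE summxE.
have Bn0 : B%:R != 0 :> R by rewrite pnatr_eq0 -lt0n.
rewrite sumrB sumr_const card_ord /J /draw; set u := jac pb i (x t w) k j.
by rewrite -[u *+ B]mulr_natl mulrBr mulKf.
Qed.

(* 10 = 8 + 2, from [sqr_extrapolation_le]. *)
Let V0 : R := 10 * (A ^+ 2 * sigma0 ^+ 2).
Let V1 : R := A * sigma1 ^+ 2.

Let oracle := set_oracle st.
Let noise := set_noise st.
Let theta_le1 : 0 <= theta <= 1. Proof. by case/andP: theta01 => ? ?; rewrite !ltW. Qed.

Let inner_sqr i t' w k (t'T : (t' <= T)%N) := inner_noise_sqr oracle noise A1
  l2_le_dual i (primal_in w t'T) k.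
Let jac_sqr i w k j := jac_noise_sqr oracle noise A1 frob_le_op i
  (primal_in w tT) k j.

Let tm1T : (t.-1 <= T)%N. Proof. exact: leq_trans tm1t tT. Qed.

Lemma value_phi_measurable i k : measurable_fun setT
  (fun p : Past * sample pb i => value_phi k p.1 p.2).
Proof.
apply: measurable_funB; apply: measurable_funM => //.
  exact: measurable_inner_noise.
exact: measurable_inner_noise.
Qed.

Lemma value_phi_integrable i k w : rintegrable (law pb i) (@value_phi i k w).
Proof.
apply: rintegrableB; apply: rintegrableZ.
  exact: (inner_noise_integrable oracle i (primal_in w tT)).
exact: (inner_noise_integrable oracle i (primal_in w tm1T)).
Qed.

Lemma value_phi_mean0 i k w : \int[law pb i]_z (@value_phi i k w z) = 0.
Proof.
have i1 := inner_noise_integrable oracle i (primal_in w tT) k.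
have i2 := inner_noise_integrable oracle i (primal_in w tm1T) k.
rewrite /value_phi expectB; [|exact: rintegrableZ|exact: rintegrableZ].
rewrite !expectZ// (inner_noise_mean0 oracle i (primal_in w tT)).
by rewrite (inner_noise_mean0 oracle i (primal_in w tm1T)) !mulr0 subrr.
Qed.

Lemma value_phi_sqr i k w :
  rintegrable (law pb i) (fun z => @value_phi i k w z ^+ 2) /\
  \int[law pb i]_z (@value_phi i k w z ^+ 2) <= V0.
Proof.
have [i1 e1] := inner_sqr i w k tT; have [i2 e2] := inner_sqr i w k tm1T.
have bnd z : @value_phi i k w z ^+ 2 <= 8 * inner_noise i (x t w) k z ^+ 2
    + 2 * inner_noise i (x t.-1 w) k z ^+ 2.
  exact: sqr_extrapolation_le.
have bi : rintegrable (law pb i) (fun z => 8 * inner_noise i (x t w) k z ^+ 2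
    + 2 * inner_noise i (x t.-1 w) k z ^+ 2).
  by apply: rintegrableD; exact: rintegrableZ.
have vi : rintegrable (law pb i) (fun z => @value_phi i k w z ^+ 2).
  apply: rintegrable_le bi.
    by apply: measurable_funX; exact: (rintegrable_measurable (@value_phi_integrable i k w)).
  by move=> z; rewrite ger0_norm ?sqr_ge0.
split=> //; apply: le_trans (expect_le vi bi bnd) _.
rewrite expectD; [|exact: rintegrableZ|exact: rintegrableZ].
have -> : V0 = 8 * (A ^+ 2 * sigma0 ^+ 2) + 2 * (A ^+ 2 * sigma0 ^+ 2).
  by rewrite /V0; ring.
by rewrite !expectZ// lerD// ler_wpM2l.
Qed.

Let jac_phi_measurable i k j : measurable_fun setT
  (fun p : Past * sample pb i => jac_noise i (x t p.1) k j p.2).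
Proof. exact: measurable_jac_noise. Qed.

Lemma value_batch i k (h : Omega -> R) :
  measurable_fun setT (h : Past -> R) -> rintegrable Pr (fun w => h w ^+ 2) ->
  let f w := h w * value_noise t i w k 0 in
  [/\ observable f, \int[Pr]_w f w = 0, observable (fun w => f w ^+ 2) &
      \int[Pr]_w (f w ^+ 2) <= B%:R^-1 * (V0 * \int[Pr]_w (h w ^+ 2))].
Proof.
move=> mh h2 f; have -> : f = fun w => h w * batch_mean D t false (@value_phi i k) w.
  by apply/funext => w; rewrite /f value_noiseE.
apply: scaled_batch_mean => //.
- exact: value_phi_measurable.
- exact: value_phi_integrable.
- exact: value_phi_mean0.
- exact: value_phi_sqr.
Qed.

Lemma jac_batch_error i k j (h : Omega -> R) :
  measurable_fun setT (h : Past -> R) -> rintegrable Pr (fun w => h w ^+ 2) ->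
  let f w := h w * jac_error t i w k j in
  [/\ observable f, \int[Pr]_w f w = 0, observable (fun w => f w ^+ 2) &
      \int[Pr]_w (f w ^+ 2) <= B%:R^-1 * (V1 * \int[Pr]_w (h w ^+ 2))].
Proof.
move=> mh h2 f; have -> : f = fun w => h w *
    batch_mean D t true (fun w z => jac_noise i (x t w) k j z) w.
  by apply/funext => w; rewrite /f jac_errorE.
apply: scaled_batch_mean => //.
- move=> w; exact: (jac_noise_integrable oracle i (primal_in w tT)).
- by move=> w; exact: (jac_noise_mean0 oracle i (primal_in w tT)).
Qed.

Hypothesis gap_int : rintegrable Pr (primal_gap t).

Let mgap k : measurable_fun setT ((fun w => (x t w - xs) k 0) : Past -> R).
Proof.
have -> : (fun w => (x t w - xs) k 0) = (fun w => x t w k 0 - xs k 0).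
  by apply/funext => w; rewrite !mxE.
by apply: measurable_funB => //; exact: measurable_primal.
Qed.

Let mdual i k : measurable_fun setT ((fun w => y t i w k 0) : Past -> R).
Proof. exact: measurable_dual. Qed.

Let past_real (f : Omega -> R) : measurable_fun setT (f : Past -> R) ->
  measurable_fun setT f.
Proof. exact: (measurable_past proper). Qed.

Let gap_coord_int k : rintegrable Pr (fun w => (x t w - xs) k 0 ^+ 2).
Proof.
apply: rintegrable_le gap_int.
  by apply: measurable_funX; exact: past_real.
by move=> w; rewrite ger0_norm ?sqr_ge0// sqr_coord_le.
Qed.

Lemma gap_observable : observable (primal_gap t).
Proof.
apply: past_observable => //; apply: measurable_sum => k.
by apply: measurable_funM; exact: mgap.
Qed.

(** Coordinatewise it is a finite sum of noise entries with square-integrable factors from the past: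
    the dual iterates are bounded, and the gap is integrable by hypothesis. *)
Lemma martingale_observable i :
  observable (martingale t i) /\ \int[Pr]_w martingale t i w = 0.
Proof.
have [C C0 dC] := dual_bounded.
have bsqr (f : Omega -> R) c : measurable_fun setT (f : Past -> R) ->
    (forall w, `|f w| <= c) -> rintegrable Pr (fun w => f w ^+ 2).
  move=> mf fc; apply: rintegrable_le (rintegrable_cst Pr (c ^+ 2)).
    by apply: measurable_funX; exact: past_real.
  by move=> w; rewrite normrX ler_sqrW.
pose h1 k w := (ys i - y t i w) k 0.
have h1E k : h1 k = fun w => ys i k 0 - y t i w k 0.
  by apply/funext => w; rewrite /h1 !mxE.
have mh1 k : measurable_fun setT (h1 k : Past -> R).
  by rewrite h1E; apply: measurable_funB.
have h1i k : rintegrable Pr (fun w => h1 k w ^+ 2).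
  apply: (@bsqr _ (C + C)) => // w; rewrite h1E.
  have [c1 c2] := dC t i w k tT.
  by apply: le_trans (ler_normB _ _) _; exact: lerD.
pose h2 k j w := y t i w k 0 * (x t w - xs) j 0.
have mh2 k j : measurable_fun setT (h2 k j : Past -> R).
  by apply: measurable_funM => //; exact: mgap.
have h2i k j : rintegrable Pr (fun w => h2 k j w ^+ 2).
  apply: rintegrable_le (rintegrableZ (C ^+ 2) (gap_coord_int j)).
    by apply: measurable_funX; exact: past_real.
  move=> w; rewrite ger0_norm ?sqr_ge0// exprMn ler_wpM2r ?sqr_ge0//.
  have [c1 _] := dC t i w k tT.
  by rewrite -[leLHS]ger0_norm ?sqr_ge0// normrX ler_sqrW.
have mE : martingale t i = fun w => \sum_k h1 k w * value_noise t i w k 0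
    + \sum_k \sum_j h2 k j w * jac_error t i w k j.
  apply/funext => w; congr (_ + _).
    by apply: eq_bigr => k _; rewrite mulrC.
  apply: eq_bigr => k _; rewrite mxE mulr_sumr; apply: eq_bigr => j _.
  by rewrite /h2; ring.
have v1 k := value_batch i k (mh1 k) (h1i k).
have v2 k j := jac_batch_error i k j (mh2 k j) (h2i k j).
have o1 k : observable (fun w => h1 k w * value_noise t i w k 0).
  by have [] := v1 k.
have o2 k j : observable (fun w => h2 k j w * jac_error t i w k j).
  by have [] := v2 k j.
have o1s := observable_sum (index_enum 'I_m) o1.
have o2s := observable_sum (index_enum 'I_m)
  (fun k => observable_sum (index_enum 'I_d) (o2 k)).
rewrite mE; split; first exact: observableD.
rewrite expectD; [|exact: o1s.1|exact: o2s.1].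
rewrite expect_sum => [|k _]; last by have [] := o1 k.
rewrite big1 => [|k _]; last by have [] := v1 k.
rewrite expect_sum => [|k _]; last first.
  by apply: rintegrable_sum => j _; have [] := o2 k j.
rewrite add0r big1// => k _.
rewrite expect_sum => [|j _]; last by have [] := o2 k j.
by rewrite big1// => j _; have [] := v2 k j.
Qed.

(** [a] stands for the expected gap. The middle term is the multiplicative noise, which the
    contraction of the gap has to absorb; [m] and [m * d] count the entries of the value and
    Jacobian noise. *)
Definition variance_bound (a : R) : R :=
  B%:R^-1 * ((2 * tau * cpsi)^-1 * (m%:R * V0)
    + (2 * tau * cpsi)^-1 * (m%:R * d%:R * V1 * a)
    + 2 * F ^+ 2 / eta * (m%:R * d%:R * V1)).

Let expect_one : \int[Pr]_(w in [set: Omega]) ((1 : R) ^+ 2) = 1.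
Proof. by rewrite expr1n expect_cst. Qed.

Let value_noise_second_moment i :
  observable (fun w => dot (value_noise t i w) (value_noise t i w)) /\
  \int[Pr]_w dot (value_noise t i w) (value_noise t i w)
    <= B%:R^-1 * (m%:R * V0).
Proof.
have v k := value_batch i k (@measurable_cst _ _ Past R setT 1) one2.
have -> : (fun w => dot (value_noise t i w) (value_noise t i w)) =
    (fun w => \sum_k (1 * value_noise t i w k 0) ^+ 2).
  by apply/funext => w; apply: eq_bigr => k _; rewrite mul1r expr2.
have o k : observable (fun w => (1 * value_noise t i w k 0) ^+ 2).
  by have [] := v k.
split; first exact: observable_sum.
rewrite expect_sum => [|k _]; last by have [] := o k.
apply: (@le_trans _ _ (\sum_(k < m) B%:R^-1 * (V0 * 1))).
  by apply: ler_sum => k _; have [_ _ _] := v k; rewrite expect_one.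
by rewrite sumr_const card_ord mulr1 -mulrnAr mulr_natl.
Qed.

Let jac_error_second_moment i (h : Omega -> R) :
  measurable_fun setT (h : Past -> R) -> rintegrable Pr (fun w => h w ^+ 2) ->
  observable (fun w => frobenius (jac_error t i w) * h w ^+ 2) /\
  \int[Pr]_w (frobenius (jac_error t i w) * h w ^+ 2)
    <= B%:R^-1 * (m%:R * d%:R * V1 * \int[Pr]_w (h w ^+ 2)).
Proof.
move=> mh h2; have v k j := jac_batch_error i k j mh h2.
have -> : (fun w => frobenius (jac_error t i w) * h w ^+ 2) =
    (fun w => \sum_k \sum_j (h w * jac_error t i w k j) ^+ 2).
  apply/funext => w; rewrite /frobenius mulr_suml; apply: eq_bigr => k _.
  by rewrite mulr_suml; apply: eq_bigr => j _; rewrite exprMn mulrC.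
have o k j : observable (fun w => (h w * jac_error t i w k j) ^+ 2).
  by have [] := v k j.
split; first by do 2 apply: observable_sum => ?.
rewrite expect_sum => [|k _]; last first.
  by apply: rintegrable_sum => j _; have [] := o k j.
apply: (@le_trans _ _ (\sum_(k < m) \sum_(j < d)
    B%:R^-1 * (V1 * \int[Pr]_w (h w ^+ 2)))).
  apply: ler_sum => k _; rewrite expect_sum => [|j _]; last by have [] := o k j.
  by apply: ler_sum => j _; have [_ _ _] := v k j.
have mulrn2 (z : R) p q : z *+ p *+ q = q%:R * (p%:R * z) by rewrite !mulr_natl.
rewrite !sumr_const !card_ord mulrn2.
by rewrite le_eqVlt; apply/orP; left; apply/eqP; ring.
Qed.

Lemma variance_observable i : observable (variance t i) /\
  \int[Pr]_w variance t i w <= variance_bound (\int[Pr]_w primal_gap t w).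
Proof.
have [vo1 e1] := value_noise_second_moment i.
have [vo3 e3] := jac_error_second_moment i (@measurable_cst _ _ Past R setT 1) one2.
have v2 l := jac_error_second_moment i (mgap l) (gap_coord_int l).
have frob_gap : (fun w => frobenius (jac_error t i w) * primal_gap t w) =
    (fun w => \sum_l frobenius (jac_error t i w) * (x t w - xs) l 0 ^+ 2).
  by apply/funext => w; rewrite -mulr_sumr; congr (_ * _).
have o2 : observable (fun w => frobenius (jac_error t i w) * primal_gap t w).
  by rewrite frob_gap; apply: observable_sum => l; have [] := v2 l.
have e2 : \int[Pr]_w (frobenius (jac_error t i w) * primal_gap t w)
    <= B%:R^-1 * (m%:R * d%:R * V1 * \int[Pr]_w primal_gap t w).
  rewrite frob_gap expect_sum => [|l _]; last by have [[]] := v2 l.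
  apply: le_trans (ler_sum _ (fun l _ => (v2 l).2)) _.
  have <- : \sum_l \int[Pr]_w ((x t w - xs) l 0 ^+ 2) = \int[Pr]_w primal_gap t w.
    by rewrite -expect_sum//; apply: eq_Rintegral => w _; apply: eq_bigr.
  by rewrite !mulr_sumr.
have frobE : (fun w => frobenius (jac_error t i w)) =
    (fun w => frobenius (jac_error t i w) * 1 ^+ 2).
  by apply/funext => w; rewrite expr1n mulr1.
have vo3' : observable (fun w => frobenius (jac_error t i w)) by rewrite frobE.
have e3' : \int[Pr]_w frobenius (jac_error t i w) <= B%:R^-1 * (m%:R * d%:R * V1).
  by move: e3; rewrite -frobE expect_one mulr1.
have tc0 : 0 <= (2 * tau * cpsi)^-1.
  by rewrite invr_ge0 mulr_ge0 ?(ltW cpsi_gt0)// mulr_ge0 ?(ltW tau0).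
have fe0 : 0 <= 2 * F ^+ 2 / eta.
  by rewrite divr_ge0 ?(ltW eta0)// mulr_ge0 ?sqr_ge0.
have oV1 := observableZ (2 * tau * cpsi)^-1 vo1.
have oV2 := observableZ (2 * tau * cpsi)^-1 o2.
have oV3 := observableZ (2 * F ^+ 2 / eta) vo3'.
have oV12 := observableD oV1 oV2.
split; first exact: (observableD oV12 oV3).
rewrite /variance expectD; [|exact: oV12.1|exact: oV3.1].
rewrite expectD; [|exact: oV1.1|exact: oV2.1].
rewrite (expectZ _ vo1.1) (expectZ _ o2.1) (expectZ _ vo3'.1).
rewrite /variance_bound !mulrDr; apply: lerD; first apply: lerD.
- by rewrite (mulrCA B%:R^-1) ler_wpM2l.
- by rewrite (mulrCA B%:R^-1) ler_wpM2l.
- by rewrite (mulrCA B%:R^-1) ler_wpM2l.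
Qed.

Lemma lead_observable i : observable (lead t i).
Proof.
have mlead : measurable_fun setT (lead t i : Past -> R).
  apply: measurable_sum => k; apply: measurable_funM => //.
  have -> : (fun w => (g i (x t w) - g i xs) k 0) =
      (fun w => g i (x t w) k 0 - g i xs k 0).
    by apply/funext => w; rewrite [LHS]mxE [X in _ + X]mxE.
  by apply: measurable_funB => //; exact: measurable_inner.
apply: past_observable => //.
apply: rintegrable_le (rintegrableZ (F * G)
  (rintegrableD (rintegrable_cst Pr 1) gap_int)).
  exact: past_real.
move=> w; apply: le_trans (normr_dot _ _) _.
have [_ fy _] := ysP i.
have yF := dual_dom_bounded Cf0 st A1 dual_le_l2 fy.
have gG := inner_lipschitz st A1 l2_le_dual i (primal_in w tT) Xs.
apply: le_trans (ler_pM (l2norm_ge0 _) (l2norm_ge0 _) yF gG) _.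
rewrite mulrA; apply: ler_wpM2l; first exact: mulr_ge0.
rewrite /primal_gap -l2norm_sqr; move: (l2norm _) => r.
apply: (@le_trans _ _ (1 / 2 + r ^+ 2 / 2)); last by have := sqr_ge0 r; nra.
by have := sqr_ge0 (r - 1); nra.
Qed.

Hypothesis div_int : forall i, rintegrable Pr (divergence t i).
Hypothesis move_int : rintegrable Pr (primal_move t).
Variables (W : {set 'I_n} -> Omega -> R) (cs Wbar : R).
Hypothesis W_observable : forall K, observable (W K).
Hypothesis W_expect :
  \sum_K batch_prob S K * \int[Pr]_w W K w <= Wbar.
Hypothesis drift : forall w, #|outer_batch D t w| = S ->
  drift_bound t (outer_batch D t w) (W (outer_batch D t w) w) cs w.
Hypothesis eta_large : cs + 4 * G ^+ 2 / (rho * cpsi) <= eta / 8.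

Let kappa : R := tau + rho / 2.
Let c1 : R := 4 * G ^+ 2 / (rho * cpsi).
Let c2 : R := 2 * G ^+ 2 / (rho * cpsi).
Let sample_size := set_outer_size st.
Let t1T : (t.+1 <= T)%N. Proof. exact: ltn_ord. Qed.

(** What changes when block [i] belongs to the batch. The last term removes the divergence that
    [common] has counted for every block with the weight [kappa]. *)
Let block i w : R := tau * divergence t i w + variance t i w - lead t i w
  - martingale t i w - kappa * divergence t i w.

Let common w : R := eta / 2 * primal_gap t w + c2 * primal_move t w
  + n%:R^-1 * (\sum_i lead t i w) + S%:R^-1 * kappa * (\sum_i divergence t i w).

Let upper (K : {set 'I_n}) w : R :=
  common w + S%:R^-1 * (\sum_(i in K) block i w) + eta^-1 * W K w.

Let potential w : R := (eta + mu) / 2 * primal_gap t.+1 w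
  + S%:R^-1 * kappa * (\sum_i divergence t.+1 i w) + c1 * primal_move t.+1 w.

(** Idle blocks keep their dual iterate and subgradient, so their divergences can be added to both
    sides of the pathwise inequality. This turns sums over a random batch on the left into sums over
    all blocks. *)
Let potential_le w : #|outer_batch D t w| = S ->
  potential w <= upper (outer_batch D t w) w.
Proof.
move=> cardS; have := pathwise_descent cardS (drift cardS) eta_large.
set K := outer_batch D t w; rewrite /potential /upper /common /block.
rewrite -/c1 -/c2 -/kappa.
have split_div : \sum_i divergence t.+1 i w = \sum_(i in K) divergence t.+1 i w
    + \sum_(i | i \notin K) divergence t i w.
  rewrite (bigID (mem K))/=; congr (_ + _); apply: eq_bigr => i iK.
  have [yE sE] := run_dual_idle run iK.
  by rewrite /divergence /y /s yE sE.
have split_div0 : \sum_i divergence t i w = \sum_(i in K) divergence t i w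
    + \sum_(i | i \notin K) divergence t i w by rewrite (bigID (mem K)).
have sum_block (u v l r : 'I_n -> R) a b :
    \sum_(i in K) (a * u i + v i - l i - r i - b * u i) =
    a * (\sum_(i in K) u i) + \sum_(i in K) v i - \sum_(i in K) l i
    - \sum_(i in K) r i - b * (\sum_(i in K) u i).
  by rewrite !sumrB big_split/= -!mulr_sumr.
rewrite split_div split_div0.
rewrite (sum_block (divergence t ^~ w) (variance t ^~ w) (lead t ^~ w)
  (martingale t ^~ w)) -!mulr_sumr.
move: (\sum_(i in K) divergence t.+1 i w) (\sum_(i in K) divergence t i w).
move: (\sum_(i | i \notin K) divergence t i w) (\sum_(i in K) lead t i w).
move: (\sum_i lead t i w) (\sum_(i in K) martingale t i w).
move: (\sum_(i in K) variance t i w) => v mm l lK dn d1 d0.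
move: (primal_gap t.+1 w) (primal_gap t w) (primal_move t.+1 w).
move: (primal_move t w) (W K w) => b ww a1 a0 b1.
move: S%:R^-1 n%:R^-1 c1 c2 kappa => S' n' c1' c2' kappa'.
rewrite [ww / eta]mulrC => h; move: h; rewrite -subr_ge0 => h.
rewrite -subr_ge0; apply: le_trans h _; rewrite le_eqVlt.
by apply/orP; left; apply/eqP; ring.
Qed.

Let past_meas (f : Omega -> R) :
  measurable_fun setT (f : g_sigma_algebraType (past D t.+1) -> R) ->
  measurable_fun setT f.
Proof. exact: (measurable_past proper). Qed.

Let mgap1 : measurable_fun setT (primal_gap t.+1).
Proof.
apply: past_meas; apply: measurable_sum => k.
have e : (fun w => (x t.+1 w - xs) k 0) = (fun w => x t.+1 w k 0 - xs k 0).
  by apply/funext => w; rewrite !mxE.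
by apply: measurable_funM; rewrite e; apply: measurable_funB => //;
  exact: measurable_primal.
Qed.

Let mmove1 : measurable_fun setT (primal_move t.+1).
Proof.
apply: past_meas; apply: measurable_sum => k.
have e : (fun w => (x t.+1 w - x t w) k 0) = (fun w => x t.+1 w k 0 - x t w k 0).
  by apply/funext => w; rewrite !mxE.
by apply: measurable_funM; rewrite e; apply: measurable_funB => //;
  exact: measurable_primal.
Qed.

Let mdiv1 i : measurable_fun setT (divergence t.+1 i).
Proof. by apply: past_meas; exact: measurable_divergence. Qed.

Let mmove : measurable_fun setT (primal_move t : Past -> R).
Proof.
apply: measurable_sum => k.
have e : (fun w => (x t w - x t.-1 w) k 0) = (fun w => x t w k 0 - x t.-1 w k 0).
  by apply/funext => w; rewrite !mxE.
by apply: measurable_funM; rewrite e; apply: measurable_funB => //;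
  exact: measurable_primal.
Qed.

Let gap_obs := gap_observable.
Let move_obs : observable (primal_move t).
Proof. exact: past_observable. Qed.
Let div_obs i : observable (divergence t i).
Proof. by apply: past_observable => //; exact: measurable_divergence. Qed.
Let mart_obs i := (martingale_observable i).1.
Let var_obs i := (variance_observable i).1.

Let block_obs i : observable (block i).
Proof.
apply: observableB; last exact: observableZ.
apply: observableB => //; apply: observableB; last exact: lead_observable.
by apply: observableD => //; exact: observableZ.
Qed.

Let lead_sum_obs : observable (fun w => n%:R^-1 * \sum_i lead t i w).
Proof. by apply: observableZ; apply: observable_sum => i; exact: lead_observable. Qed.

Let div_sum_obs : observable (fun w => S%:R^-1 * kappa * \sum_i divergence t i w).
Proof. by apply: observableZ; exact: observable_sum. Qed.

Let common_obs : observable common.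
Proof.
apply: observableD => //; apply: observableD => //.
by apply: observableD; exact: observableZ.
Qed.

Let upper_obs K : observable (upper K).
Proof.
apply: observableD; last exact: observableZ.
by apply: observableD => //; apply: observableZ; exact: observable_sum_in.
Qed.

Let u i : R := \int[Pr]_w divergence t i w.
Let l i : R := \int[Pr]_w lead t i w.
Let v i : R := \int[Pr]_w variance t i w.

Let expect_block i :
  \int[Pr]_w block i w = tau * u i + v i - l i - kappa * u i.
Proof.
have o1 := observableD (observableZ tau (div_obs i)) (var_obs i).
have o2 := observableB o1 (lead_observable i).
have o3 := observableB o2 (mart_obs i).
rewrite /block (expectB o3.1 (observableZ kappa (div_obs i)).1).
rewrite (expectB o2.1 (mart_obs i).1) (martingale_observable i).2 subr0.
rewrite (expectB o1.1 (lead_observable i).1).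
rewrite (expectD (observableZ tau (div_obs i)).1 (var_obs i).1).
by rewrite !expectZ.
Qed.

Let expect_common : \int[Pr]_w common w =
  eta / 2 * (\int[Pr]_w primal_gap t w) + c2 * (\int[Pr]_w primal_move t w)
  + n%:R^-1 * (\sum_i l i) + S%:R^-1 * kappa * (\sum_i u i).
Proof.
have o1 := observableD (observableZ (eta / 2) gap_obs) (observableZ c2 move_obs).
have o2 := observableD o1 lead_sum_obs.
rewrite /common (expectD o2.1 div_sum_obs.1) (expectD o1.1 lead_sum_obs.1).
rewrite (expectD (observableZ (eta / 2) gap_obs).1 (observableZ c2 move_obs).1).
rewrite (expectZ (eta / 2) gap_obs.1) (expectZ c2 move_obs.1).
have lsi : rintegrable Pr (fun w => \sum_i lead t i w).
  by apply: rintegrable_sum => i _; exact: (lead_observable i).1.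
have dsi : rintegrable Pr (fun w => \sum_i divergence t i w).
  exact: rintegrable_sum.
rewrite (expectZ n%:R^-1 lsi) (expectZ (S%:R^-1 * kappa) dsi).
rewrite (expect_sum _ (h := lead t) (fun i _ => (lead_observable i).1)).
by rewrite (expect_sum _ (h := divergence t) (fun i _ => div_int i)).
Qed.

Let expect_upper K : \int[Pr]_w upper K w = \int[Pr]_w common w
  + S%:R^-1 * (\sum_(i in K) (tau * u i + v i - l i - kappa * u i))
  + eta^-1 * \int[Pr]_w W K w.
Proof.
have o1 := observableZ S%:R^-1 (observable_sum_in K block_obs).
have o2 := observableD common_obs o1.
rewrite /upper (expectD o2.1 (observableZ eta^-1 (W_observable K)).1).
rewrite (expectD common_obs.1 o1.1) expectZ; last first.
  exact: (observable_sum_in K block_obs).1.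
rewrite expect_sum => [|i _]; last exact: (block_obs i).1.
rewrite expectZ; last exact: (W_observable K).1.
by congr (_ + _ * _ + _); apply: eq_bigr => i _; rewrite expect_block.
Qed.

(** Averaging over batches replaces [1/S] times a batch sum by [1/n] times the full sum. The [lead]
    terms then cancel against those in [common], and [tau - kappa = - rho / 2] is the gain on the
    divergences. *)
Let expect_upper_average : \sum_K batch_prob S K * \int[Pr]_w upper K w <=
  eta / 2 * (\int[Pr]_w primal_gap t w) + c2 * (\int[Pr]_w primal_move t w)
  + (S%:R^-1 * kappa - n%:R^-1 * (rho / 2)) * (\sum_i u i)
  + n%:R^-1 * (\sum_i v i) + Wbar / eta.
Proof.
under eq_bigr do rewrite expect_upper !mulrDr.
rewrite !big_split/= -mulr_suml batch_prob_sum1// mul1r.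
rewrite batch_average_mean//.
have -> : \sum_(K : {set 'I_n}) batch_prob S K * (eta^-1 * \int[Pr]_w W K w) =
    eta^-1 * \sum_K batch_prob S K * \int[Pr]_w W K w.
  by rewrite [RHS]mulr_sumr; apply: eq_bigr => K _; rewrite mulrCA.
have hW : eta^-1 * \sum_K batch_prob S K * \int[Pr]_w W K w <= Wbar / eta.
  by rewrite [leRHS]mulrC ler_wpM2l// invr_ge0 ltW.
apply: le_trans (lerD (lexx _) hW) _; rewrite lerD2r expect_common.
rewrite !sumrB big_split/= -!mulr_sumr /kappa le_eqVlt.
apply/orP; left; apply/eqP; move: (\sum_i u i) (\sum_i l i) (\sum_i v i).
by move: n%:R^-1 S%:R^-1 => n' S' a b c; ring.
Qed.

(* The outer batch has size [S] only almost surely. *)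
Let bad : set Omega := outer_batch D t @^-1` [set K : {set 'I_n} | #|K| != S].

Let measurable_bad : measurable bad.
Proof.
have [h _ _ _ _] := proper; apply: (h (inl t)).
by exists [set K : {set 'I_n} | #|K| != S].
Qed.

Let bad0 : Pr bad = 0%E.
Proof.
pose f (K : {set 'I_n}) (w : Omega) : R := (#|K| != S)%:R.
have f_int K : rintegrable Pr (f K) by exact: rintegrable_cst.
have f_meas K : measurable_fun setT (f K : O -> R).
  exact: measurable_cst.
have [fi fE] := expect_outer_batch proper f_int f_meas.
have f0 : \int[Pr]_w f (outer_batch D t w) w = 0.
  rewrite fE big1// => K _; rewrite /f expect_cst /batch_prob.
  by case: eqP => _; rewrite ?mulr0 ?mul0r.
rewrite -[in LHS](setIT bad) -integral_indic//.
rewrite -[RHS](congr1 EFin f0) -expect_EFin//.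
apply: eq_integral => w _; congr EFin; rewrite indicE.
suff -> : (w \in bad) = (#|outer_batch D t w| != S) by [].
by apply/idP/idP => [/set_mem|h]; [|exact/mem_set].
Qed.

Let mu0 : 0 < mu := set_mu st.
Let kappa0 : 0 < kappa. Proof. by rewrite addr_gt0// divr_gt0. Qed.
Let S0 : 0 < S%:R :> R. Proof. by rewrite ltr0n; case/andP: sample_size. Qed.
Let c1_ge0 : 0 <= c1.
Proof.
apply: divr_ge0; first by apply: mulr_ge0 => //; exact: sqr_ge0.
by apply: mulr_ge0; [exact: ltW|exact: ltW cpsi_gt0].
Qed.

Let potential_terms w :
  [/\ 0 <= (eta + mu) / 2 * primal_gap t.+1 w,
      forall i, 0 <= divergence t.+1 i w & 0 <= c1 * primal_move t.+1 w].
Proof.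
split=> [|i|].
- by rewrite mulr_ge0 ?dot_ge0// divr_ge0// addr_ge0// ltW.
- exact: divergence_ge0.
- by rewrite mulr_ge0 ?dot_ge0.
Qed.

Let div_sum_ge0 w : 0 <= S%:R^-1 * kappa * \sum_i divergence t.+1 i w.
Proof.
have [_ h _] := potential_terms w.
rewrite mulr_ge0//; first by rewrite mulr_ge0 ?invr_ge0// ltW.
by apply: sumr_ge0 => i _; exact: h.
Qed.

Let potential_ge0 w : 0 <= potential w.
Proof. by have [h1 _ h3] := potential_terms w; rewrite !addr_ge0. Qed.

Let measurable_potential : measurable_fun setT potential.
Proof.
apply: measurable_funD; last exact: measurable_funM.
apply: measurable_funD; first exact: measurable_funM.
by apply: measurable_funM => //; exact: measurable_sum.
Qed.

Let potential_expect : rintegrable Pr potential /\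
  \int[Pr]_w potential w <= \sum_K batch_prob S K * \int[Pr]_w upper K w.
Proof.
(* The bound holds only for batches of size [S]; the other values have probability 0, so setting [f]
   to 0 there does not change the average. *)
pose f (K : {set 'I_n}) (w : Omega) : R := if #|K| == S then upper K w else 0.
have f_obs K : observable (f K).
  by rewrite /f; case: (#|K| == S) => //; exact: observable_cst.
have [fi fE] := expect_outer_batch proper
  (fun K => (f_obs K).1) (fun K => (f_obs K).2).
have <- : \int[Pr]_w f (outer_batch D t w) w =
    \sum_K batch_prob S K * \int[Pr]_w upper K w.
  rewrite fE; apply: eq_bigr => K _; rewrite /f /batch_prob.
  by case: (#|K| == S); rewrite ?mul0r.
apply: rintegrable_ge0 => //; rewrite -expect_EFin//.
pose good w : R := (#|outer_batch D t w| == S)%:R.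
have mgood : measurable_fun setT good.
  have -> : good = \1_(~` bad).
    apply/funext => w; rewrite indicE /good.
    suff -> : (w \in ~` bad) = (#|outer_batch D t w| == S) by [].
    apply/idP/idP => [/set_mem/=/negP|cardS]; first by rewrite negbK.
    by apply/mem_set => /=; apply/negP; rewrite negbK.
  by apply: measurable_indic; exact: measurableC.
(* The potential is nonnegative but not yet known to be integrable, so the null event is first
   discarded in the extended integral. *)
rewrite (_ : (\int[Pr]_w (potential w)%:E = \int[Pr]_w (good w * potential w)%:E)%E).
  have gi : rintegrable Pr (fun w => good w * potential w).
    apply: (rintegrable_le _ _ fi); first exact: measurable_funM.
    move=> w; rewrite /good /f; case: eqP => [cardS|_]; last first.
      by rewrite mul0r normr0.
    rewrite mul1r ger0_norm ?potential_ge0//.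
    exact: potential_le.
  rewrite !expect_EFin// lee_fin; apply: expect_le => // w.
  rewrite /good /f; case: eqP => [cardS|_]; last by rewrite mul0r.
  by rewrite mul1r potential_le.
apply: ge0_ae_eq_integral => //.
- exact/measurable_EFinP.
- by apply/measurable_EFinP; exact: measurable_funM.
- by move=> w _; rewrite lee_fin potential_ge0.
- by move=> w _; rewrite lee_fin mulr_ge0 ?potential_ge0// /good.
- exists bad; split=> // w /= nw; rewrite /bad/=; apply/negP => /eqP cardS.
  by apply: nw => _; rewrite /good cardS eqxx mul1r.
Qed.

(** Integrability of the new gap, divergences and move is a conclusion: they occur with positive
    weights in a sum of nonnegative terms whose expectation has just been bounded. This feeds the
    induction over the steps. *)
Lemma expected_descent :
  [/\ rintegrable Pr (primal_gap t.+1), forall i, rintegrable Pr (divergence t.+1 i),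
      rintegrable Pr (primal_move t.+1) &
  (eta + mu) / 2 * (\int[Pr]_w primal_gap t.+1 w)
    + S%:R^-1 * (tau + rho / 2) * (\sum_i \int[Pr]_w divergence t.+1 i w)
    + 4 * G ^+ 2 / (rho * cpsi) * (\int[Pr]_w primal_move t.+1 w)
  <= eta / 2 * (\int[Pr]_w primal_gap t w) + 2 * G ^+ 2 / (rho * cpsi) * (\int[Pr]_w primal_move t w)
     + (S%:R^-1 * (tau + rho / 2) - n%:R^-1 * (rho / 2)) * (\sum_i \int[Pr]_w divergence t i w)
     + variance_bound (\int[Pr]_w primal_gap t w) + Wbar / eta].
Proof.
rewrite -/kappa -/c1 -/c2.
have [pi pE] := potential_expect.
have scaled (f : Omega -> R) k : 0 < k -> measurable_fun setT f ->
    (forall w, 0 <= f w) -> (forall w, k * f w <= potential w) -> rintegrable Pr f.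
  move=> k0 mf f0 fp; apply: (rintegrable_le _ _ (rintegrableZ k^-1 pi)) => // w.
  by rewrite ger0_norm// ler_pdivlMl.
have gap_i : rintegrable Pr (primal_gap t.+1).
  apply: (@scaled _ ((eta + mu) / 2)) => // [|w|w].
  - by rewrite divr_gt0// addr_gt0.
  - exact: dot_ge0.
  - by have [_ _ h3] := potential_terms w; rewrite /potential -addrA lerDl addr_ge0.
have div_i i : rintegrable Pr (divergence t.+1 i).
  apply: (@scaled _ (S%:R^-1 * kappa)) => // [|w|w].
  - by rewrite mulr_gt0// invr_gt0.
  - by have [_ h _] := potential_terms w.
  - have [h1 h2 h3] := potential_terms w; rewrite /potential.
    rewrite -addrA addrCA; apply: ler_wpDr; first exact: addr_ge0.
    rewrite ler_wpM2l//; first by rewrite mulr_ge0 ?invr_ge0// ltW.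
    by rewrite (bigD1 i)//= lerDl sumr_ge0.
have c1_gt0 : 0 < c1.
  have G_gt0 : 0 < G by apply: mulr_gt0 => //; exact: lt_le_trans ltr01 A1.
  apply: divr_gt0; first by apply: mulr_gt0 => //; exact: exprn_gt0.
  by apply: mulr_gt0 => //; exact: cpsi_gt0.
have move_i : rintegrable Pr (primal_move t.+1).
  apply: (@scaled _ c1) => // [w|w].
  - exact: dot_ge0.
  - by have [h1 _ _] := potential_terms w; rewrite /potential lerDr addr_ge0.
split=> //.
have n0 : 0 < n%:R :> R.
  by rewrite ltr0n; case/andP: sample_size => Sp SN; exact: leq_trans Sp SN.
have dsi : rintegrable Pr (fun w => \sum_i divergence t.+1 i w).
  exact: rintegrable_sum.
have e1 : rintegrable Pr (fun w => (eta + mu) / 2 * primal_gap t.+1 w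
    + S%:R^-1 * kappa * \sum_i divergence t.+1 i w).
  by apply: rintegrableD; exact: rintegrableZ.
have := le_trans pE expect_upper_average.
rewrite /potential (expectD e1 (rintegrableZ c1 move_i)).
rewrite (expectD (rintegrableZ _ gap_i) (rintegrableZ _ dsi)).
rewrite !expectZ// expect_sum// => h; apply: le_trans h _.
rewrite lerD2r lerD2l.
apply: (@le_trans _ _ (n%:R^-1 * \sum_(i < n) variance_bound (\int[Pr]_w primal_gap t w))).
  rewrite ler_wpM2l ?invr_ge0//; apply: ler_sum => i _.
  exact: (variance_observable i).2.
rewrite sumr_const card_ord -[X in _ * X <= _]mulr_natr mulrCA mulVf ?mulr1//.
by rewrite gt_eqF.
Qed.

End step_expectation.

(** [W] may depend on the batch, and only its average is bounded: in the smooth case the factor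
    [1 / S] appears only after averaging over batches. *)
Definition drift_control (cs Wbar : R) : Prop := forall t : 'I_T,
  exists W : {set 'I_n} -> Omega -> R,
  [/\ forall K, observable t (W K),
      \sum_K batch_prob S K * \int[Pr]_w W K w <= Wbar &
      forall w, #|outer_batch D t w| = S ->
        drift_bound t (outer_batch D t w) (W (outer_batch D t w) w) cs w].

Let S_gt0 : (0 < S)%N. Proof. by case/andP: (set_outer_size st). Qed.
Let n_gt0 : (0 < n)%N.
Proof. by case/andP: (set_outer_size st) => [S0 Sn]; exact: leq_trans Sn. Qed.

(** Either average is at most [F * G * |x_+ - x|], by the bounds on the dual variables and on the
    Jacobians and increments of [g]; nothing cancels, whence no gain from [S]. *)
Lemma nonsmooth_drift : drift_control 0 (4 * F ^+ 2 * G ^+ 2).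
Proof.
move=> t; exists (fun _ _ => 4 * F ^+ 2 * G ^+ 2); split.
- by move=> K; exact: observable_cst.
- under eq_bigr do rewrite expect_cst.
  by rewrite -mulr_suml (batch_prob_sum1 (set_outer_size st)) mul1r.
move=> w cardS; have tT : (t <= T)%N := ltnW (ltn_ord t).
have t1T : (t.+1 <= T)%N := ltn_ord t.
have Xx := primal_in w tT; have Xp := primal_in w t1T.
pose b := l2norm (x t.+1 w - x t w).
have bE : primal_move t.+1 w = b ^+ 2 by rewrite l2norm_sqr.
have dual_pairing i v z : conjugate (outer pb i) v \is a fin_num ->
    l2norm z <= G * b -> `|dot v z| <= F * (G * b).
  move=> fv zb; apply: le_trans (normr_dot _ _) _.
  apply: ler_pM zb; rewrite ?l2norm_ge0//.
  exact: (dual_dom_bounded Cf0 st A1 dual_le_l2 fv).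
have avg1 : `|S%:R^-1 * \sum_(i in outer_batch D t w)
    dot (y t.+1 i w) (J i (x t w) *m (x t.+1 w - x t w))| <= F * (G * b).
  apply: normr_average_le => // i iS.
  have [fy _] := dual_iterate_fin iS; apply: (dual_pairing _ _ _ fy).
  exact: (jac_lipschitz st A1 l2_le_dual).
have avg2 : `|n%:R^-1 * \sum_i dot (ys i) (g i (x t.+1 w) - g i (x t w))|
    <= F * (G * b).
  apply: normr_average_le => // [|i _]; first by rewrite -[RHS]card_ord; exact: eq_card.
  have [_ fy _] := ysP i; apply: (dual_pairing _ _ _ fy).
  exact: (inner_lipschitz st A1 l2_le_dual).
have div0 : 0 <= rho * cpsi / 8 * (S%:R^-1 * \sum_(i in outer_batch D t w)
    dot (ys i - y t.+1 i w) (ys i - y t.+1 i w)).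
  apply: mulr_ge0; first by apply: divr_ge0 => //; apply: mulr_ge0; apply: ltW => //; exact: cpsi_gt0.
  by apply: mulr_ge0; [rewrite invr_ge0|apply: sumr_ge0 => i _; exact: dot_ge0].
rewrite /drift_bound bE.
move: avg1 avg2 div0; rewrite !ler_norml.
set p := S%:R^-1 * _; set q := n%:R^-1 * _; set r := rho * _ / _ * _.
move=> /andP[p1 _] /andP[_ q1] r0.
apply: (@drift_young _ F G b eta) => //.
Qed.

(** * Drift for smooth inner functions *)

Section smooth.
Variable Lg : R.
Hypothesis Lg0 : 0 < Lg.
Hypothesis smooth :
  forall i, smooth_on (xdom pb) (dual_norm N) Lg (inner pb i) (jac pb i).

(** The dual optimum [ys i] is used in place of the new dual iterate: [pull] is then fixed by the
    past, and the variance bound for uniform batches applies to its deviations from the mean. *)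
Let pull t i w : 'cV[R]_d := (J i (x t w))^T *m ys i.
Let mean t w : 'cV[R]_d := n%:R^-1 *: \sum_i pull t i w.
Let dev t i w := pull t i w - mean t w.

Let dev_sum0 t w : \sum_i dev t i w = 0.
Proof.
rewrite sumrB sumr_const card_ord /mean -[X in _ - X]scaler_nat scalerA.
by rewrite mulfV ?scale1r ?subrr// pnatr_eq0 -lt0n.
Qed.

Let dev_sqr t w : (t <= T)%N ->
  n%:R^-1 * \sum_i dot (dev t i w) (dev t i w) <= delta ^+ 2.
Proof.
move=> tT; have [_ _ h] := set_noise st.
have := h _ ys (primal_in w tT) (fun i => let: And3 Yy _ _ := ysP i in Yy).
by under eq_bigr do rewrite l2norm_sqr.
Qed.

Let spread t (K : {set 'I_n}) w : 'cV[R]_d := S%:R^-1 *: \sum_(i in K) dev t i w.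

Let spread_observable (t : 'I_T) K :
  observable t (fun w => dot (spread t K w) (spread t K w)).
Proof.
have tT : (t <= T)%N := ltnW (ltn_ord t).
have mpull i k : measurable_fun setT
    ((fun w => pull t i w k 0) : g_sigma_algebraType (past D t) -> R).
  rewrite (_ : (fun w => _) = fun w => \sum_j J i (x t w) j k * ys i j 0); last first.
    by apply/funext => w; rewrite mxE; apply: eq_bigr => j _; rewrite mxE.
  by apply: measurable_sum => j; apply: measurable_funM => //; exact: measurable_jac.
have mdev i k : measurable_fun setT
    ((fun w => dev t i w k 0) : g_sigma_algebraType (past D t) -> R).
  rewrite (_ : (fun w => _) =
      fun w => pull t i w k 0 - n%:R^-1 * \sum_j pull t j w k 0); last first.
    by apply/funext => w; rewrite !mxE summxE.
  by apply: measurable_funB => //; apply: measurable_funM => //; exact: measurable_sum.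
have mspread k : measurable_fun setT
    ((fun w => spread t K w k 0) : g_sigma_algebraType (past D t) -> R).
  rewrite (_ : (fun w => _) =
      fun w => S%:R^-1 * \sum_j (if j \in K then dev t j w k 0 else 0)); last first.
    by apply/funext => w; rewrite mxE summxE big_mkcond.
  apply: measurable_funM => //; apply: measurable_sum => j.
  by case: (j \in K); [exact: mdev|exact: measurable_cst].
have msq : measurable_fun setT ((fun w => dot (spread t K w) (spread t K w))
    : g_sigma_algebraType (past D t) -> R).
  by apply: measurable_sum => k; exact: measurable_funM.
apply: (past_observable _ msq).
have msq' : measurable_fun setT (fun w => dot (spread t K w) (spread t K w)).
  exact: (measurable_past proper msq).
(* A crude bound, for integrability only: one squared deviation is at most [n] times their average,
   and a number is at most its square plus 1. *)
pose C := S%:R^-1 * \sum_(i in K) (n%:R * delta ^+ 2 + 1).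
have bnd w : dot (spread t K w) (spread t K w) <= C ^+ 2.
  rewrite -l2norm_sqr; apply: ler_sqrW; first exact: l2norm_ge0.
  rewrite /spread l2normZ ger0_norm ?invr_ge0// ler_wpM2l ?invr_ge0//.
  apply: le_trans (l2norm_sum _ _ _) _; apply: ler_sum => i _.
  have h : l2norm (dev t i w) ^+ 2 <= n%:R * delta ^+ 2.
    rewrite -ler_pdivrMl ?ltr0n//; apply: le_trans (dev_sqr w tT).
    rewrite ler_wpM2l ?invr_ge0// l2norm_sqr (bigD1 i)//= lerDl.
    by apply: sumr_ge0 => j _; exact: dot_ge0.
  by move: h; have := sqr_ge0 (l2norm (dev t i w) - 1); nra.
apply: (rintegrable_le msq' _ (rintegrable_cst Pr (C ^+ 2))) => w.
by rewrite ger0_norm ?dot_ge0.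
Qed.

(** The drift splits into three parts: [lag], from the new dual iterate to [ys]; [wob], the
    fluctuation of the batch average of [pull]; and [rem], the second-order error of [g]. The moves
    charged to [lag] and [rem] form [cs], and [wob] leaves [|spread|^2 / eta], whose average over
    batches is at most [delta^2 / S] before the division. *)
Lemma smooth_drift :
  drift_control (F * (A * (Lg / 2)) + 2 * G ^+ 2 / (rho * cpsi))
    (delta ^+ 2 / S%:R).
Proof.
move=> t; have tT : (t <= T)%N := ltnW (ltn_ord t).
have t1T : (t.+1 <= T)%N := ltn_ord t.
exists (fun K w => dot (spread t K w) (spread t K w)); split.
- exact: spread_observable.
- have -> : \sum_K batch_prob S K * \int[Pr]_w dot (spread t K w) (spread t K w)
      = \int[Pr]_w \sum_(K : {set 'I_n})
          batch_prob S K * dot (spread t K w) (spread t K w).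
    rewrite expect_sum => [|K _]; last first.
      by apply: rintegrableZ; exact: (spread_observable t K).1.
    by apply: eq_bigr => K _; rewrite expectZ//; exact: (spread_observable t K).1.
  rewrite -[leRHS](expect_cst Pr); apply: expect_le => [||w].
  + apply: rintegrable_sum => K _; apply: rintegrableZ.
    exact: (spread_observable t K).1.
  + exact: rintegrable_cst.
  apply: le_trans (batch_average_variance (set_outer_size st) (dev_sum0 t w)) _.
  by rewrite mulrC ler_wpM2r ?invr_ge0// dev_sqr.
move=> w cardS; rewrite /drift_bound.
set K := outer_batch D t w in cardS *.
have Xx := primal_in w tT; have Xp := primal_in w t1T.
set h := x t.+1 w - x t w.
have -> : primal_move t.+1 w = dot h h by [].
have rc0 : 0 < rho * cpsi by apply: mulr_gt0 => //; exact: cpsi_gt0.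
have S0 : 0 < S%:R :> R by rewrite ltr0n.
have n0 : 0 < n%:R :> R by rewrite ltr0n.
have lip i : dot (J i (x t w) *m h) (J i (x t w) *m h) <= G ^+ 2 * dot h h.
  rewrite -!l2norm_sqr -exprMn; apply: ler_sqrW; first exact: l2norm_ge0.
  exact: (jac_lipschitz st A1 l2_le_dual).
have lag : - (rho * cpsi / 8 * (S%:R^-1 * \sum_(i in K)
      dot (ys i - y t.+1 i w) (ys i - y t.+1 i w))
    + 2 * G ^+ 2 / (rho * cpsi) * dot h h)
  <= S%:R^-1 * \sum_(i in K) dot (y t.+1 i w - ys i) (J i (x t w) *m h).
  have one i : - (rho * cpsi / 8 * dot (ys i - y t.+1 i w) (ys i - y t.+1 i w)
      + 2 * G ^+ 2 / (rho * cpsi) * dot h h)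
      <= dot (y t.+1 i w - ys i) (J i (x t w) *m h).
    rewrite -[y t.+1 i w - ys i]opprB dotNl lerN2.
    have k0 : 0 < rho * cpsi / 4 by rewrite divr_gt0.
    apply: le_trans (dot_young _ _ k0) _; apply: lerD.
      by rewrite le_eqVlt; apply/orP; left; apply/eqP; field.
    apply: le_trans (ler_wpM2l _ (lip i)) _.
      by rewrite invr_ge0; apply: mulr_ge0 => //; exact: ltW.
    rewrite le_eqVlt; apply/orP; left; apply/eqP.
    have : rho * cpsi != 0 by rewrite gt_eqF.
    by move: (rho * cpsi) => rc rc1; field.
  have : S%:R^-1 * \sum_(i in K) - (rho * cpsi / 8 *
        dot (ys i - y t.+1 i w) (ys i - y t.+1 i w)
        + 2 * G ^+ 2 / (rho * cpsi) * dot h h) <=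
      S%:R^-1 * \sum_(i in K) dot (y t.+1 i w - ys i) (J i (x t w) *m h).
    by rewrite ler_wpM2l ?invr_ge0// ler_sum.
  apply: le_trans.
  rewrite sumrN big_split/= sumr_const cardS -mulr_sumr mulrN lerN2.
  rewrite mulrDr (mulrCA S%:R^-1) lerD2l.
  by rewrite -[X in _ * X <= _]mulr_natr mulrCA mulVf ?mulr1// gt_eqF.
have wob : - (dot (spread t K w) (spread t K w) / eta + eta / 4 * dot h h)
    <= dot (spread t K w) h.
  rewrite -[leRHS]opprK -dotNl lerN2 dotC.
  have k0 : 0 < eta / 2 by rewrite divr_gt0.
  apply: le_trans (dot_young _ _ k0) _.
  rewrite addrC; apply: lerD; rewrite le_eqVlt; apply/orP; left; apply/eqP.
    by rewrite dotNl dotNr opprK; field; rewrite gt_eqF.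
  by field.
have rem : `|n%:R^-1 * \sum_i dot (ys i)
      (g i (x t.+1 w) - g i (x t w) - J i (x t w) *m h)|
    <= F * (A * (Lg / 2)) * dot h h.
  apply: normr_average_le => // [|i _]; first by rewrite -[RHS]card_ord; exact: eq_card.
  have [_ fy _] := ysP i; apply: le_trans (normr_dot _ _) _; rewrite -mulrA.
  apply: ler_pM; rewrite ?l2norm_ge0//.
    exact: (dual_dom_bounded Cf0 st A1 dual_le_l2 fy).
  apply: le_trans (l2_le_dual _) _; rewrite -mulrA ler_wpM2l ?(ltW A0)//.
  by rewrite -l2norm_sqr; exact: smooth.
have split_avg : S%:R^-1 * \sum_(i in K) dot (y t.+1 i w) (J i (x t w) *m h)
    - n%:R^-1 * \sum_i dot (ys i) (g i (x t.+1 w) - g i (x t w))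
  = S%:R^-1 * \sum_(i in K) dot (y t.+1 i w - ys i) (J i (x t w) *m h)
    + dot (spread t K w) h
    - n%:R^-1 * \sum_i dot (ys i)
        (g i (x t.+1 w) - g i (x t w) - J i (x t w) *m h).
  have e1 : \sum_(i in K) dot (y t.+1 i w) (J i (x t w) *m h) =
      \sum_(i in K) dot (y t.+1 i w - ys i) (J i (x t w) *m h)
      + \sum_(i in K) dot (pull t i w) h.
    by rewrite -big_split/=; apply: eq_bigr => i _; rewrite /pull -dot_mulmx -dotDl subrK.
  have e2 : \sum_i dot (ys i) (g i (x t.+1 w) - g i (x t w)) =
      \sum_i dot (ys i) (g i (x t.+1 w) - g i (x t w) - J i (x t w) *m h)
      + \sum_i dot (pull t i w) h.
    by rewrite -big_split/=; apply: eq_bigr => i _; rewrite /pull -dot_mulmx -dotDr subrK.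
  have e3 : dot (spread t K w) h = S%:R^-1 * \sum_(i in K) dot (pull t i w) h
      - n%:R^-1 * \sum_i dot (pull t i w) h.
    rewrite /spread /dev sumrB sumr_const cardS dotZl dotBl dot_suml mulrBr.
    congr (_ - _); rewrite -[X in dot X _]scaler_nat dotZl mulrA mulVf ?mul1r ?gt_eqF//.
    by rewrite /mean dotZl dot_suml.
  by rewrite e1 e2 e3; ring.
rewrite split_avg; move: lag wob rem; rewrite ler_norml.
set p := S%:R^-1 * \sum_(i in K) dot (y t.+1 i w - ys i) _.
set q := dot (spread t K w) h; set r := n%:R^-1 * _.
move=> lag wob /andP[_ rem].
apply: le_trans (lerB (lerD lag wob) rem).
by rewrite le_eqVlt; apply/orP; left; apply/eqP; ring.
Qed.

End smooth.

(** * Geometric decay over all steps *)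

Definition initial_divergence i : R :=
  fine (psi i (ys i)) - fine (psi i (y0 i)) - dot (s0 i) (ys i - y0 i).

Lemma initial_divergence_ge0 i : 0 <= initial_divergence i.
Proof.
have [Yys _ _] := ysP i.
have := bregman_lower mupsi0 st A1 l2_le_N Yys (set_y0 st i)
  (psi_optimum_fin i) (set_s0 st i).
apply: le_trans; rewrite -/cpsi mulr_ge0 ?dot_ge0//; exact: ltW cpsi_gt0.
Qed.

Definition noise_floor : R :=
  B%:R^-1 * ((2 * tau * cpsi)^-1 * (m%:R * (10 * (A ^+ 2 * sigma0 ^+ 2)))
    + 2 * F ^+ 2 / eta * (m%:R * d%:R * (A * sigma1 ^+ 2))).

Definition noise_slope : R :=
  B%:R^-1 * ((2 * tau * cpsi)^-1 * (m%:R * d%:R * (A * sigma1 ^+ 2))).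

Let variance_boundE a : variance_bound a = noise_floor + noise_slope * a.
Proof. by rewrite /variance_bound /noise_floor /noise_slope; ring. Qed.

Let noise_floor_ge0 : 0 <= noise_floor.
Proof.
have c0 : 0 <= (2 * tau * cpsi)^-1.
  by rewrite invr_ge0; apply: mulr_ge0; [apply: mulr_ge0|]; apply: ltW => //; exact: cpsi_gt0.
rewrite /noise_floor; apply: mulr_ge0; first by rewrite invr_ge0.
apply: addr_ge0; apply: mulr_ge0.
- exact: c0.
- by apply: mulr_ge0 => //; apply: mulr_ge0 => //; rewrite -exprMn sqr_ge0.
- by apply: divr_ge0; [apply: mulr_ge0 => //; exact: sqr_ge0|exact: ltW].
- by apply: mulr_ge0 => //; apply: mulr_ge0; [exact: ltW|exact: sqr_ge0].
Qed.

(** The induction carries integrability along with the bound on the potential, since each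
    application of [expected_descent] consumes and returns it; at the end the divergences and the
    move are dropped. *)
Lemma gap_decay (cs Wbar q : R) : drift_control cs Wbar -> 0 <= Wbar ->
  cs + 4 * G ^+ 2 / (rho * cpsi) <= eta / 8 -> 2^-1 <= q -> q < 1 ->
  S%:R^-1 * (tau + rho / 2) - n%:R^-1 * (rho / 2) <= q * (S%:R^-1 * (tau + rho / 2)) ->
  eta / 2 + noise_slope <= q * ((eta + mu) / 2) ->
  rintegrable Pr (primal_gap T) /\
  (eta + mu) / 2 * (\int[Pr]_w primal_gap T w) <=
    q ^+ T * ((eta + mu) / 2 * dot (x0 - xs) (x0 - xs)
              + S%:R^-1 * (tau + rho / 2) * \sum_i initial_divergence i)
    + (noise_floor + Wbar / eta) / (1 - q).
Proof.
move=> control Wbar0 eta_large q2 q1 div_rate gap_rate.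
have q0 : 0 <= q by apply: le_trans q2; rewrite invr_ge0.
set Phi0 := _ / _ * _ + _ * _; set err := noise_floor + _.
have err0 : 0 <= err by rewrite addr_ge0// divr_ge0// ltW.
have S0 : 0 < S%:R :> R by rewrite ltr0n.
have kappa0 : 0 <= S%:R^-1 * (tau + rho / 2).
  by rewrite mulr_ge0 ?invr_ge0// addr_ge0// ?divr_ge0// ltW.
have c1_ge0 : 0 <= 4 * G ^+ 2 / (rho * cpsi).
  apply: divr_ge0; first by apply: mulr_ge0 => //; exact: sqr_ge0.
  by apply: mulr_ge0; [exact: ltW|exact: ltW cpsi_gt0].
have gap_ge0 t : 0 <= \int[Pr]_w primal_gap t w.
  by apply: Rintegral_ge0 => w _; exact: dot_ge0.
have move_ge0 t : 0 <= \int[Pr]_w primal_move t w.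
  by apply: Rintegral_ge0 => w _; exact: dot_ge0.
have div_ge0 t : (t <= T)%N -> 0 <= \sum_i \int[Pr]_w divergence t i w.
  move=> tT; apply: sumr_ge0 => i _.
  by apply: Rintegral_ge0 => w _; exact: divergence_ge0.
have decay t : (t <= T)%N -> [/\ rintegrable Pr (primal_gap t),
    forall i, rintegrable Pr (divergence t i), rintegrable Pr (primal_move t) &
    (eta + mu) / 2 * (\int[Pr]_w primal_gap t w)
      + S%:R^-1 * (tau + rho / 2) * (\sum_i \int[Pr]_w divergence t i w)
      + 4 * G ^+ 2 / (rho * cpsi) * (\int[Pr]_w primal_move t w)
    <= q ^+ t * Phi0 + err / (1 - q)].
  elim: t => [_|t ih tT].
    have -> : primal_gap 0 = cst (dot (x0 - xs) (x0 - xs)).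
      by apply/funext => w; rewrite /primal_gap /x (run_x0 run).
    have divE i : divergence 0 i = cst (initial_divergence i).
      apply/funext => w.
      by rewrite /divergence /y /s (run_y0 run) (run_s0 run).
    (* [0.-1] is 0, which matches the convention x_{-1} = x_0. *)
    have -> : primal_move 0 = cst 0.
      by apply/funext => w; rewrite /primal_move /= subrr dot0l.
    split; [exact: rintegrable_cst| |exact: rintegrable_cst|].
      by move=> i; rewrite divE; exact: rintegrable_cst.
    under eq_bigr do rewrite divE expect_cst.
    rewrite !expect_cst mulr0 addr0 expr0 mul1r lerDl divr_ge0//.
    by rewrite subr_ge0 ltW.
  have [gap_i div_i move_i bnd] := ih (ltnW tT).
  have [W [Wo Wm Wd]] := control (Ordinal tT).
  have [gap_i' div_i' move_i' step] := expected_descent (t := Ordinal tT)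
    gap_i div_i move_i Wo Wm Wd eta_large.
  have c1E : 4 * G ^+ 2 / (rho * cpsi) = 2 * (2 * G ^+ 2 / (rho * cpsi)).
    by rewrite !mulrA -natrM.
  rewrite c1E in bnd; split=> //; apply: le_trans step _.
  rewrite variance_boundE [q ^+ _]exprS -(mulrA q).
  apply: (descent_contraction _ (gap_ge0 t) (div_ge0 t (ltnW tT)) (move_ge0 t) _
    gap_rate div_rate _ bnd) => //; first by rewrite q2 q1.
  by move: c1_ge0; rewrite c1E pmulr_rge0.
have [gap_i _ _ bnd] := decay T (leqnn T); split=> //; apply: le_trans bnd.
rewrite -addrA lerDl; apply: addr_ge0; apply: mulr_ge0 => //.
exact: div_ge0.
Qed.

Section accuracy.
Hypotheses (etaE : eta = mu * theta / (1 - theta))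
  (tauE : tau = S%:R / (n%:R * (1 - theta))).

(** Dominates [1 - theta] times the potential at time 0, and is itself free of [theta]. *)
Definition initial_potential : R := mu / 2 * dot (x0 - xs) (x0 - xs)
  + (n%:R^-1 + rho / 2) * \sum_i initial_divergence i.

Definition noise_constant (w : R) : R :=
  m%:R * (10 * (A ^+ 2 * sigma0 ^+ 2)) / (2 * cpsi)
  + 4 * F ^+ 2 * (m%:R * d%:R * (A * sigma1 ^+ 2)) + 2 * w.

Lemma initial_potential_ge0 : 0 <= initial_potential.
Proof.
have mu0 := set_mu st; apply: addr_ge0; apply: mulr_ge0.
- by rewrite divr_ge0// ltW.
- exact: dot_ge0.
- by rewrite addr_ge0 ?invr_ge0// divr_ge0// ltW.
- by apply: sumr_ge0 => i _; exact: initial_divergence_ge0.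
Qed.

(** The gap has weight [mu / (2 * (1 - theta))] in the potential, so the decay is multiplied by
    [1 - theta]. The limit level [err / (kap * (1 - theta))] becomes [err / kap], and [err] is
    itself proportional to [1 - theta] by [noise_level]. *)
Lemma run_accuracy (kap cs Wbar w rate : R) :
  0 < kap -> kap <= 2^-1 -> kap <= rho / 4 ->
  drift_control cs Wbar -> 0 <= Wbar ->
  n%:R / (B%:R * S%:R) <= rate -> (mu * B%:R)^-1 <= rate ->
  Wbar / mu <= w * rate ->
  (1 - theta) * 2 <= 1 -> (1 - theta) * n%:R <= 1 ->
  (1 - theta) * (16 * (cs + 4 * G ^+ 2 / (rho * cpsi))) <= mu ->
  (1 - theta) * (2 * n%:R * (m%:R * d%:R * (A * sigma1 ^+ 2)) / cpsi) <= mu ->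
  rintegrable Pr (primal_gap T) /\
  mu / 2 * (\int[Pr]_w primal_gap T w) <=
    (1 - kap * (1 - theta)) ^+ T * initial_potential
    + noise_constant w / kap * rate * (1 - theta).
Proof.
move=> kap0 kap_half kap_rho control Wbar0 rate1 rate2 rate3 e2 en ec eV.
have mu0 := set_mu st; have c0 := cpsi_gt0.
have S1 : 1 <= S%:R :> R by rewrite ler1n.
have n1 : 1 <= n%:R :> R by rewrite ler1n.
have B1 : 1 <= B%:R :> R by rewrite ler1n.
have e0 : 0 < 1 - theta by rewrite subr_gt0; case/andP: theta01.
have thetaE : theta = 1 - (1 - theta) by rewrite opprB addrC subrK.
have V1 : 0 <= m%:R * d%:R * (A * sigma1 ^+ 2).
  by apply: mulr_ge0 => //; apply: mulr_ge0; [exact: ltW|exact: sqr_ge0].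
have V0 : 0 <= m%:R * (10 * (A ^+ 2 * sigma0 ^+ 2)).
  by apply: mulr_ge0 => //; apply: mulr_ge0 => //; rewrite -exprMn sqr_ge0.
have q_half : 2^-1 <= 1 - kap * (1 - theta).
  have : kap * (1 - theta) <= 2^-1 * 1.
    by apply: ler_pM => //; [exact: ltW|exact: ltW|move: e2 e0; lra].
  lra.
have q_lt1 : 1 - kap * (1 - theta) < 1 by rewrite gtrBl mulr_gt0.
have h1 : cs + 4 * G ^+ 2 / (rho * cpsi) <= eta / 8.
  by rewrite etaE; exact: (eta_large mu0 thetaE e0 e2).
have h2 := dual_contraction S1 n1 rho0 e0 kap_half kap_rho kap0 en.
have h3 := primal_contraction mu0 S1 n1 B1 c0 thetaE e0 kap_half V1 eV.
have h4 := initial_weight S1 n1 rho0 e0 e2.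
have h5 := noise_level mu0 S1 n1 B1 c0 thetaE e0 e2 F V0 V1 Wbar0 rate1 rate2 rate3.
rewrite -etaE -tauE in h2 h3 h4 h5.
have [gap_i bnd] := gap_decay control Wbar0 h1 q_half q_lt1 h2 h3.
split=> //.
have etamu : eta + mu = mu / (1 - theta) by rewrite etaE; exact: step_size_mu.
have qE : 1 - (1 - kap * (1 - theta)) = kap * (1 - theta) by rewrite opprB addrC subrK.
move: bnd; rewrite etamu qE; set E := \int[Pr]_w _; move=> bnd.
move: e0 bnd h4 h5; set e := 1 - theta => e0 bnd h4 h5.
have en0 : e != 0 by rewrite gt_eqF.
have kapn0 : kap != 0 by rewrite gt_eqF.
have -> : mu / 2 * E = e * (mu / e / 2 * E) by field.
apply: le_trans (ler_wpM2l (ltW e0) bnd) _; rewrite mulrDr.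
apply: lerD.
  rewrite mulrCA ler_wpM2l ?exprn_ge0//.
    by apply: le_trans q_half; rewrite invr_ge0.
  rewrite mulrDr; apply: lerD.
    by rewrite le_eqVlt; apply/orP; left; apply/eqP; field.
  rewrite mulrA ler_wpM2r//.
  by apply: sumr_ge0 => i _; exact: initial_divergence_ge0.
have -> : e * ((noise_floor + Wbar / eta) / (kap * e)) =
    (noise_floor + Wbar / eta) / kap.
  by move: (noise_floor + Wbar / eta) => z; field; rewrite kapn0 en0.
rewrite (_ : _ / kap * rate * e = noise_constant w * rate * e / kap); last first.
  by move: (noise_constant w) => z; field.
by rewrite ler_wpM2r// invr_ge0 ltW.
Qed.

End accuracy.

End run.

(** * Complexity *)

(** From [1 - z <= exp (- z)], with [L = ln eps^-1] and the integer part of [2 L / z] plus one. The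
    third [L / z] pays for the rounding, as [L >= 1 >= z]. Reaching [eps ^+ 2] instead of [eps] lets
    a small [eps] swallow the initial potential, which thus stays out of the iteration count. *)
Lemma geometric_time {R : realType} (z eps : R) :
  0 < z <= 1 -> 0 < eps <= expR (- 1) ->
  exists T : nat, T%:R <= 3 * ln eps^-1 / z /\ (1 - z) ^+ T <= eps ^+ 2.
Proof.
move=> /andP[z0 z1] /andP[eps0 eps1].
have Leps : expR (- ln eps^-1) = eps by rewrite lnV ?posrE// opprK lnK.
have L1 : 1 <= ln eps^-1 by rewrite -lerN2 -ler_expR Leps.
set L := ln eps^-1 in Leps L1 *; have L0 : 0 <= L by exact: le_trans L1.
have y0 : 0 <= 2 * L / z by rewrite divr_ge0 ?mulr_ge0// ltW.
exists (Num.trunc (2 * L / z)).+1; have /andP[lo hi] := truncn_itv y0; split.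
  rewrite -natr1; apply: le_trans (lerD lo (lexx 1)) _.
  rewrite (_ : 3 * L / z = 2 * L / z + L / z); last by field; rewrite gt_eqF.
  by rewrite lerD2l ler_pdivlMr// mul1r; exact: le_trans L1.
apply: (@le_trans _ _ (expR (- z) ^+ (Num.trunc (2 * L / z)).+1)).
  by rewrite lerXn2r ?nnegrE ?subr_ge0 ?expR_ge0// expR_ge1Dx.
rewrite -expRM_natl -Leps -expRM_natl ler_expR !mulrN lerN2.
by rewrite -ler_pdivrMr// ltW.
Qed.

Lemma alexr_reaches_of_decay {R : realType} {d m n : nat} (S B : nat)
    (mu rho K kap rate M D0 : R) (pb : fcco R d m n) psi x0 y0 s0 xs :
  0 < K -> 0 < kap <= 1 -> 0 < rate -> 0 <= D0 -> 2 <= M ->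
  (forall (theta : R) (T : nat), 0 < 1 - theta -> (1 - theta) * M <= 1 ->
    forall (dO : measure_display) (Omega : measurableType dO)
      (Pr : probability Omega R) (D : draws pb B T Omega)
      (tr : trajectory R d m n Omega),
    let eta := mu * theta / (1 - theta) in
    let tau := S%:R / (n%:R * (1 - theta)) in
    alexr_run psi x0 y0 s0 S eta tau theta Pr D tr ->
    optimal_subgradients psi tau theta rho D tr ->
    ((mu / 2)%:E * 'E_Pr[(fun w => l2norm (primal tr T w - xs) ^+ 2)%R]
      <= ((1 - kap * (1 - theta)) ^+ T * D0 + K * rate * (1 - theta))%:E)%E) ->
  alexr_reaches (6 * K / kap) 1 rate rho S B mu pb psi x0 y0 s0 xs.
Proof.
move=> K0 /andP[kap0 kap1] rate0 D00 M2 decay.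
have M0 : 0 < M by exact: lt_le_trans M2.
have Kr0 : 0 < 2 * K * rate by rewrite !mulr_gt0.
(* With [1 - theta = eps / (2 * K * rate)] the noise contributes exactly [eps / 2]. *)
exists (2 * K * rate)^-1.
(* The three bounds give, in turn, [(1 - theta) * M <= 1], [eps * D0 <= 1/2], and
   [ln eps^-1 >= 1]. *)
exists (Num.min (Num.min (2 * K * rate / M) (2 * (D0 + 1))^-1) (expR (- 1))).
split.
  by rewrite !lt_min expR_gt0 invr_gt0 divr_gt0// mulr_gt0// ltr_wpDl.
move=> eps /andP[eps0]; rewrite !lt_min -andbA => /and3P[epsM epsD eps1].
pose e := eps / (2 * K * rate).
have e0 : 0 < e by rewrite divr_gt0.
have eM : e * M <= 1.
  rewrite /e mulrAC ler_pdivrMr// mul1r -ler_pdivlMr//; exact: ltW.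
have e_half : e * 2 <= 1 by apply: le_trans eM; rewrite ler_wpM2l// ltW.
have eE : 1 - (1 - e) = e by rewrite opprB addrC subrK.
have z01 : 0 < kap * e <= 1.
  rewrite mulr_gt0//= -[leRHS]mulr1 ler_pM// ?ltW//.
  by move: e_half e0; lra.
have eps01 : 0 < eps <= expR (- 1) by rewrite eps0 ltW.
have [T [T_le T_ge]] := geometric_time z01 eps01.
exists (1 - e), T; split.
- by apply/andP; split; move: e_half e0; lra.
- by rewrite eE /e mulrC.
- apply: le_trans T_le _; rewrite expr1 le_eqVlt; apply/orP; left; apply/eqP.
  by rewrite /e; move: (ln _) => L; field; rewrite !gt_eqF.
move=> dO Omega Pr D tr eta tau run optimal.
have e0' : 0 < 1 - (1 - e) by rewrite eE.
have eM' : (1 - (1 - e)) * M <= 1 by rewrite eE.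
apply: le_trans (decay _ _ e0' eM' _ _ _ _ _ run optimal) _.
rewrite eE lee_fin.
have -> : K * rate * e = eps / 2 by rewrite /e; field; rewrite !gt_eqF.
have h : (1 - kap * e) ^+ T * D0 <= eps / 2.
  apply: le_trans (ler_wpM2r D00 T_ge) _.
  have D1 : 0 < 2 * (D0 + 1) by rewrite mulr_gt0// ltr_wpDl.
  have h2 : eps * (2 * (D0 + 1)) <= 1.
    by rewrite -ler_pdivlMr// mul1r ltW.
  have h3 : eps * D0 <= 2^-1 by move: h2 eps0; lra.
  by rewrite expr2 -mulrA ler_wpM2l// ltW.
by move: h; lra.
Qed.

Section complexity.
Context {R : realType} {d m : nat} (N : 'cV[R]_m -> R).
Context (Cg Cf sigma0 sigma1 delta Lf mupsi rho : R) (A : R).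
Hypotheses (Cg0 : 0 < Cg) (Cf0 : 0 < Cf) (Lf0 : 0 < Lf) (mupsi0 : 0 < mupsi)
  (rho0 : 0 < rho).
Hypotheses (A1 : 1 <= A) (l2_le_N : forall u, l2norm u <= A * N u)
  (dual_le_l2 : forall u, dual_norm N u <= A * l2norm u)
  (l2_le_dual : forall u, l2norm u <= A * dual_norm N u)
  (frob_le_op : forall q (M : 'M[R]_(q, m)), frobenius M <= A * op_norm N M ^+ 2).

Let kap : R := Num.min 2^-1 (rho / 4).

(** [6 * K / kap] from [alexr_reaches_of_decay], with [K] the noise constant over [kap], increased
    by 1 so as to be positive. It contains none of [n], [S], [B], [mu]. *)
Definition complexity_constant (w : R) : R :=
  6 * ((noise_constant (d := d) (m := m) Cf sigma0 sigma1 mupsi A w + 1) / kap) / kap.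

Lemma alexr_reaches_of_drift (cs Wbar w rate : R) (n S B : nat) (mu : R)
    (pb : fcco R d m n) psi x0 y0 s0 xs :
  alexr_setting N Cg Cf sigma0 sigma1 delta Lf mupsi rho
    S B mu pb psi x0 y0 s0 xs ->
  0 <= cs -> 0 <= Wbar -> 0 <= w ->
  n%:R / (B * S)%:R <= rate -> (mu * B%:R)^-1 <= rate -> Wbar / mu <= w * rate ->
  (forall (T : nat) (eta tau theta : R), 0 < eta ->
    forall (dO : measure_display) (Omega : measurableType dO)
      (Pr : probability Omega R) (D : draws pb B T Omega)
      (tr : trajectory R d m n Omega),
    alexr_run psi x0 y0 s0 S eta tau theta Pr D tr ->
    forall ys, (forall i,
      [/\ ydom pb i (ys i), conjugate (outer pb i) (ys i) \is a fin_num &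
        outer pb i (inner pb i xs) =
          dot (ys i) (inner pb i xs) - fine (conjugate (outer pb i) (ys i))]) ->
    optimal_subgradients psi tau theta rho D tr ->
    drift_control mupsi rho S A eta Pr D tr ys cs Wbar) ->
  alexr_reaches (complexity_constant w) 1 rate rho S B mu pb psi x0 y0 s0 xs.
Proof.
move=> st cs0 Wbar0 w0 rate1 rate2 rate3 drift.
have [ys ysP] := dual_optima st.
have mu0 := set_mu st; have [S0 Sn] := andP (set_outer_size st).
have B0 := set_inner_size st.
have n0 : (0 < n)%N by exact: leq_trans Sn.
have A0 : 0 < A by exact: lt_le_trans A1.
have rate0 : 0 < rate.
  by apply: lt_le_trans rate2; rewrite invr_gt0 mulr_gt0// ltr0n.
have kap0 : 0 < kap by rewrite lt_min invr_gt0 ltr0n divr_gt0.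
have kap_half : kap <= 2^-1 by rewrite ge_min lexx.
have kap_rho : kap <= rho / 4 by rewrite ge_min lexx orbT.
have c0 : 0 < cpsi mupsi A by exact: cpsi_gt0.
pose G := A * Cg.
pose V := m%:R * d%:R * (A * sigma1 ^+ 2).
have V0 : 0 <= V.
  by apply: mulr_ge0 => //; apply: mulr_ge0; [exact: ltW|exact: sqr_ge0].
(* [P] and, below, [Q] express the conditions that [eta] is large and that the multiplicative noise
   is small as upper bounds on [1 - theta]. *)
pose P := 16 * (cs + 4 * G ^+ 2 / (rho * cpsi mupsi A)) / mu.
have P0 : 0 <= P.
  apply: divr_ge0; last exact: ltW.
  apply: mulr_ge0 => //; apply: addr_ge0 => //; apply: divr_ge0.
    by apply: mulr_ge0 => //; exact: sqr_ge0.
  by apply: mulr_ge0; exact: ltW.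
pose Q := 2 * n%:R * V / cpsi mupsi A / mu.
have Q0 : 0 <= Q.
  apply: divr_ge0; last exact: ltW.
  by apply: divr_ge0; [apply: mulr_ge0 => //; exact: mulr_ge0|exact: ltW].
have nc0 : 0 <= noise_constant (d := d) (m := m) Cf sigma0 sigma1 mupsi A w.
  rewrite /noise_constant; apply: addr_ge0; last exact: mulr_ge0.
  apply: addr_ge0.
    apply: divr_ge0; last by apply: mulr_ge0 => //; exact: ltW.
    by apply: mulr_ge0 => //; apply: mulr_ge0 => //; rewrite -exprMn sqr_ge0.
  by apply: mulr_ge0 => //; apply: mulr_ge0 => //; exact: sqr_ge0.
(* A sum of nonnegative terms, so [(1 - theta) * M <= 1] implies all four smallness conditions at
   once. It depends on [n] and [mu], but enters only the threshold on [eps]. *)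
apply: (@alexr_reaches_of_decay _ _ _ _ _ _ _ _ _ _ _ (2 + n%:R + P + Q)
    (initial_potential rho mu psi x0 y0 s0 xs ys)).
- by rewrite divr_gt0// ltr_wpDl.
- by rewrite kap0/=; apply: le_trans kap_half _; rewrite invf_le1// ler1n.
- exact: rate0.
- exact: (initial_potential_ge0 mupsi0 rho0 st A1 l2_le_N ysP).
- by move: P0 Q0 (ler0n R n); lra.
move=> theta T e0 eM dO Omega Pr D tr eta tau run optimal.
have part r : 0 <= r -> r <= 2 + n%:R + P + Q -> (1 - theta) * r <= 1.
  by move=> r0 rM; apply: le_trans eM; rewrite ler_wpM2l// ltW.
have n00 : 0 <= n%:R :> R by [].
have e2 : (1 - theta) * 2 <= 1 by apply: part => //; lra.
have en : (1 - theta) * n%:R <= 1 by apply: part => //; lra.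
have eP : (1 - theta) * P <= 1 by apply: part => //; lra.
have eQ : (1 - theta) * Q <= 1 by apply: part => //; lra.
have theta01 : 0 < theta < 1 by apply/andP; split; lra.
have eta0 : 0 < eta by have /andP[t0 _] := theta01; rewrite divr_gt0 ?mulr_gt0.
have tau0 : 0 < tau by rewrite divr_gt0 ?mulr_gt0// ltr0n.
have eP' : (1 - theta) * (16 * (cs + 4 * G ^+ 2 / (rho * cpsi mupsi A))) <= mu.
  by move: eP; rewrite /P [leLHS]mulrA ler_pdivrMr// mul1r.
have eQ' : (1 - theta) * (2 * n%:R * V / cpsi mupsi A) <= mu.
  by move: eQ; rewrite /Q [leLHS]mulrA ler_pdivrMr// mul1r.
rewrite natrM in rate1.
have [gap_i bnd] := run_accuracy Cg0 Cf0 Lf0 mupsi0 rho0 st A1 l2_le_N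
  dual_le_l2 l2_le_dual frob_le_op eta0 tau0 theta01 run optimal ysP erefl erefl
  kap0 kap_half kap_rho (drift _ _ _ _ eta0 _ _ _ _ _ run _ ysP optimal)
  Wbar0 rate1 rate2 rate3 e2 en eP' eQ'.
rewrite (_ : (fun w => _) = primal_gap xs tr T); last first.
  by apply/funext => w1; rewrite l2norm_sqr.
rewrite unlock.
rewrite expect_EFin// -EFinM lee_fin; apply: le_trans bnd _.
rewrite lerD2l ler_wpM2r ?(ltW e0)// ler_wpM2r ?(ltW rate0)//.
by rewrite ler_wpM2r ?invr_ge0 ?(ltW kap0)// lerDl.
Qed.

End complexity.

Theorem theorem1 (R : realType) (d m : nat) (N : 'cV[R]_m -> R)
    (Cg Cf sigma0 sigma1 delta Lf mupsi rho : R) :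
  is_norm N -> 0 < Cg -> 0 < Cf -> 0 < Lf -> 0 < mupsi -> 0 < rho ->
  (forall Lg : R, 0 < Lg ->
   exists (K : R) (k : nat),
   forall (n S B : nat) (mu : R) (pb : fcco R d m n)
     (psi : 'I_n -> 'cV[R]_m -> \bar R)
     (x0 : 'cV[R]_d) (y0 s0 : 'I_n -> 'cV[R]_m) (xs : 'cV[R]_d),
   alexr_setting N Cg Cf sigma0 sigma1 delta Lf mupsi rho
     S B mu pb psi x0 y0 s0 xs ->
   (forall i, smooth_on (xdom pb) (dual_norm N) Lg (inner pb i) (jac pb i)) ->
   alexr_reaches K k
     (Num.max (Num.max (mu * S%:R)^-1 (mu * B%:R)^-1) (n%:R / (B * S)%:R))
     rho S B mu pb psi x0 y0 s0 xs)
  /\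
  (exists (K : R) (k : nat),
   forall (n S B : nat) (mu : R) (pb : fcco R d m n)
     (psi : 'I_n -> 'cV[R]_m -> \bar R)
     (x0 : 'cV[R]_d) (y0 s0 : 'I_n -> 'cV[R]_m) (xs : 'cV[R]_d),
   alexr_setting N Cg Cf sigma0 sigma1 delta Lf mupsi rho
     S B mu pb psi x0 y0 s0 xs ->
   alexr_reaches K k
     (Num.max mu^-1 (n%:R / (B * S)%:R))
     rho S B mu pb psi x0 y0 s0 xs).
Proof.
move=> nN Cg0 Cf0 Lf0 mupsi0 rho0.
have [A [[A1 _ l2_le_N dual_le_l2 l2_le_dual] frob_le_op]] := norm_constants nN.
have A0 : 0 < A by exact: lt_le_trans A1.
pose F := A * Cf; pose G := A * Cg.
have c0 : 0 < cpsi mupsi A by exact: cpsi_gt0.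
split=> [Lg Lg0|].
  exists (complexity_constant (d := d) (m := m) Cf sigma0 sigma1 mupsi rho A
    (delta ^+ 2)), 1%N.
  move=> n S B mu pb psi x0 y0 s0 xs st smooth.
  have mu0 := set_mu st; have /andP[S0 _] := set_outer_size st.
  apply: (alexr_reaches_of_drift Cg0 Cf0 Lf0 mupsi0 rho0 A1 l2_le_N dual_le_l2
    l2_le_dual frob_le_op
    (cs := F * (A * (Lg / 2)) + 2 * G ^+ 2 / (rho * cpsi mupsi A))
    (Wbar := delta ^+ 2 / S%:R) st).
  - apply: addr_ge0.
      by rewrite !mulr_ge0 ?invr_ge0// ltW.
    apply: divr_ge0; last by apply: mulr_ge0; exact: ltW.
    by apply: mulr_ge0 => //; exact: sqr_ge0.
  - by rewrite divr_ge0// sqr_ge0.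
  - exact: sqr_ge0.
  - by rewrite le_max lexx orbT.
  - by rewrite !le_max lexx orbT.
  (* Here [Wbar / mu = delta^2 / (mu S)], the source of the term [1 / (mu S)] in the rate. *)
  - rewrite -mulrA -invfM (mulrC S%:R) ler_wpM2l ?sqr_ge0//.
    by rewrite !le_max lexx.
  move=> T eta tau theta eta0 dO Omega Pr D tr run ys ysP _.
  exact: (smooth_drift Cf0 mupsi0 rho0 st A1 dual_le_l2 l2_le_dual eta0 run
    ysP smooth).
exists (complexity_constant (d := d) (m := m) Cf sigma0 sigma1 mupsi rho A
  (4 * F ^+ 2 * G ^+ 2)), 1%N.
move=> n S B mu pb psi x0 y0 s0 xs st; have mu0 := set_mu st.
have W0 : 0 <= 4 * F ^+ 2 * G ^+ 2.
  by apply: mulr_ge0; [apply: mulr_ge0 => //|]; exact: sqr_ge0.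
apply: (alexr_reaches_of_drift Cg0 Cf0 Lf0 mupsi0 rho0 A1 l2_le_N dual_le_l2
  l2_le_dual frob_le_op (cs := 0) (Wbar := 4 * F ^+ 2 * G ^+ 2) st) => //.
- by rewrite le_max lexx orbT.
(* Since [B >= 1], the Jacobian noise term [1 / (mu B)] is dominated by [1 / mu]. *)
- rewrite le_max lef_pV2 ?posrE ?mulr_gt0 ?ltr0n ?(set_inner_size st)//.
  by rewrite ler_peMr ?(ltW mu0)// ler1n (set_inner_size st).
- by rewrite ler_wpM2l// le_max lexx.
move=> T eta tau theta eta0 dO Omega Pr D tr run ys ysP optimal.
exact: (nonsmooth_drift Cf0 mupsi0 rho0 st A1 dual_le_l2 l2_le_dual eta0 run
  optimal ysP).
Qed.
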